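(* Let $\mu>-\frac12$. Then: (1) The operators $S_{\mu,p}$ (for $1\le p<\infty$) and $S_{\mu,\infty}$ are closed. (2) The operators $-S_{\mu,p}$ (for $1\le p<\infty$) and $-S_{\mu,\infty}$ are non-negative.
   Context: Let $r(x)=x^{-\mu-\frac12}$, $s(x)=x^{2\mu+1}/c_\mu$, $c_\mu=2^\mu\Gamma(\mu+1)$, for $x\in(0,\infty)$. $L^p(sr^p)$ ($1\le p<\infty$) is the space of (classes of) measurable $f:(0,\infty)\to\mathbb C$ with $\|f\|_{L^p(sr^p)}=\left(\int_0^\infty|f(x)|^p s(x)r(x)^p\,dx\right)^{1/p}<\infty$; $L^\infty(r)$ is the space of measurable $f$ with $\|f\|_{L^\infty(r)}=\operatorname{ess\,sup}_{x>0}|r(x)f(x)|<\infty$. $\mathcal H_\mu$ is the Fréchet space of all $\phi\in C^\infty(0,\infty)$ such that $\gamma^\mu_{m,k}(\phi)=\sup_{x>0}|x^m(x^{-1}D)^k x^{-\mu-\frac12}\phi(x)|<\infty$ for all $m,k=0,1,2,\dots$ (with $D=d/dx$), topologized by the seminorms $\gamma^\mu_{m,k}$; $\mathcal H_\mu'$ is its space of continuous linear functionals. Functions $f$ in $L^p(sr^p)$ or $L^\infty(r)$ are identified with the elements $\phi\mapsto\int_0^\infty f\phi$ of $\mathcal H_\mu'$ (this identification is injective). The Bessel operator is $S_\mu=\frac{d^2}{dx^2}-\frac{4\mu^2-1}{4x^2}$; it maps $\mathcal H_\mu$ continuously into itself and is extended to $\mathcal H_\mu'$ by $(S_\mu u,\phi)=(u,S_\mu\phi)$,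 $u\in\mathcal H'_\mu$, $\phi\in\mathcal H_\mu$. $S_{\mu,p}$ is the part of $S_\mu$ in $L^p(sr^p)$: domain $\{f\in L^p(sr^p):S_\mu f\in L^p(sr^p)\}$, $S_{\mu,p}f=S_\mu f$. $S_{\mu,\infty}$ is the part of $S_\mu$ in $L^\infty(r)$: domain $\{f\in L^\infty(r):S_\mu f\in L^\infty(r)\}$, $S_{\mu,\infty}f=S_\mu f$. A linear operator $A:D(A)\subset X\to X$ on a Banach space $X$ is non-negative if for every $\lambda>0$ the operator $\lambda+A:D(A)\to X$ is bijective with bounded inverse, and $\sup_{\lambda>0}\|\lambda(\lambda+A)^{-1}\|<\infty$. *)

(* Defs.v *)
From mathcomp Require Import all_boot all_order all_algebra.
From mathcomp Require Export complex.
From mathcomp Require Export all_classical all_reals all_analysis ess_sup_inf.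

Set Implicit Arguments.
Unset Strict Implicit.
Unset Printing Implicit Defensive.

Import Order.TTheory GRing.Theory Num.Theory.
Import numFieldNormedType.Exports.

Local Open Scope classical_set_scope.
Local Open Scope complex_scope.
Local Open Scope ring_scope.

(* Complex functions on (0, oo) are represented by total functions R -> R[i];
   only their values on (0, oo) matter. *)

Section complex_functions.
Context {R : realType}.
Implicit Types (f : R -> R[i]) (z : R[i]).

Definition half_line : set R := `]0, +oo[%classic.

Definition modulus z : R := ComplexField.Normc.normc z.

Definition cderive f : R -> R[i] := fun x =>
  (derive1 (@complex.Re R \o f) x) +i* (derive1 (@complex.Im R \o f) x).

Definition csmooth f := forall (n : nat) (x : R), 0 < x ->
  derivable (derive1n n (@complex.Re R \o f)) x 1 /\
  derivable (derive1n n (@complex.Im R \o f)) x 1.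

Definition cmeasurable f :=
  measurable_fun half_line (@complex.Re R \o f) /\
  measurable_fun half_line (@complex.Im R \o f).

Definition cintegral f : R[i] :=
  Rintegral (@lebesgue_measure R) half_line (@complex.Re R \o f) +i*
  Rintegral (@lebesgue_measure R) half_line (@complex.Im R \o f).

Definition cscale (c : R[i]) f : R -> R[i] := fun x => c * f x.

Definition same_class f g := f = g %[ae (@lebesgue_measure R) in half_line].

End complex_functions.

Section weights.
Context {R : realType}.
Implicit Types (mu p : R) (f : R -> R[i]).

Definition Gamma (a : R) : R :=
  Rintegral (@lebesgue_measure R) half_line
    (fun x => x `^ (a - 1) * expR (- x)).

Definition c_ mu : R := 2 `^ mu * Gamma (mu + 1).
Definition r_ mu (x : R) : R := x `^ (- mu - 2^-1).
Definition s_ mu (x : R) : R := x `^ (2 * mu + 1) / c_ mu.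

Definition Lp_norm mu p f : \bar R :=
  ((\int[@lebesgue_measure R]_(x in half_line)
     (modulus (f x) `^ p * s_ mu x * r_ mu x `^ p)%:E) `^ p^-1)%E.

Definition Linfty_norm mu f : \bar R :=
  ess_sup (@lebesgue_measure R)
    (EFin \o ((fun x => modulus ((r_ mu x)%:C * f x)) \_ half_line)).

End weights.

Section bessel.
Context {R : realType}.
Implicit Types (mu : R) (phi psi : R -> R[i]) (u : (R -> R[i]) -> R[i]).

Definition xD phi : R -> R[i] := fun x => (x^-1)%:C * cderive phi x.

Definition gamma_ mu (m k : nat) phi : \bar R :=
  ereal_sup [set (modulus ((x ^+ m)%:C *
     iter k xD (fun y => (y `^ (- mu - 2^-1))%:C * phi y) x))%:E
    | x in half_line].

Definition in_H mu phi :=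
  csmooth phi /\ forall m k, (gamma_ mu m k phi < +oo)%E.

(* Membership in the dual of H_mu, for functionals given on all functions but
   only considered on H_mu.  Continuity is with respect to the topology whose
   basic neighbourhoods of phi are
   {psi | gamma_(m,k) (psi - phi) < d for all m, k <= n}. *)
Definition in_dual mu u :=
  (forall (c : R[i]) phi psi, in_H mu phi -> in_H mu psi ->
     u (cscale c phi + psi) = c * u phi + u psi) /\
  (forall phi, in_H mu phi -> forall e : R, 0 < e ->
     exists (n : nat) (d : R), 0 < d /\
       forall psi, in_H mu psi ->
         (forall m k, (m <= n)%N -> (k <= n)%N ->
            (gamma_ mu m k (psi - phi)%R < d%:E)%E) ->
         modulus (u psi - u phi) < e).

Definition bessel mu phi : R -> R[i] := fun x =>
  cderive (cderive phi) x - ((4 * mu ^+ 2 - 1) / (4 * x ^+ 2))%:C * phi x.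

Definition bessel_dual mu u : (R -> R[i]) -> R[i] :=
  fun phi => u (bessel mu phi).

Definition identified mu (f : R -> R[i]) u :=
  forall phi, in_H mu phi -> u phi = cintegral (fun x => f x * phi x).

End bessel.

(* A space of classes is given by its norm N on representatives; an operator
   in it is given by its graph on representatives. *)
Section operators.
Context {R : realType}.
Local Notation F := (R -> R[i]).
Implicit Types (N : F -> \bar R) (A B : F -> F -> Prop).

Definition in_space N : set F := [set f | cmeasurable f /\ (N f < +oo)%E].

(* The part of the Bessel operator of the dual of H_mu in the space of N:
   f lies in the domain and is mapped to the class of g. *)
Definition bessel_part (mu : R) N (f g : F) :=
  [/\ in_space N f, in_space N g &
    exists u, [/\ in_dual mu u, identified mu f u &
                  identified mu g (bessel_dual mu u)]].

Definition op_opp A (f g : F) := A f (- g).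

Definition op_shift N (lambda : R) A (f g : F) :=
  in_space N g /\ exists2 h, A f h & same_class g (cscale lambda%:C f + h).

Definition op_inv A (g f : F) := A f g.

Definition op_scale (c : R) A (f g : F) :=
  exists2 h, A f h & g = cscale c%:C h.

Definition op_norm N A : \bar R :=
  ereal_sup [set y | exists f g, [/\ A f g, (N f <= 1)%E & y = N g]].

Definition op_injective A := forall f f' g g',
  A f g -> A f' g' -> same_class g g' -> same_class f f'.

Definition op_surjective N A := forall g, in_space N g -> exists f, A f g.

Definition closed_operator N A := forall (f_ g_ : nat -> F) (f g : F),
  (forall n, A (f_ n) (g_ n)) -> in_space N f -> in_space N g ->
  (fun n => N (f_ n - f)) @ \oo --> 0%E ->
  (fun n => N (g_ n - g)) @ \oo --> 0%E ->
  A f g.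

Definition nonnegative_operator N A :=
  (forall lambda : R, 0 < lambda ->
     [/\ op_injective (op_shift N lambda A),
         op_surjective N (op_shift N lambda A) &
         (op_norm N (op_inv (op_shift N lambda A)) < +oo)%E]) /\
  (ereal_sup
     [set op_norm N (op_scale lambda (op_inv (op_shift N lambda A)))
     | lambda in [set lambda : R | (0 < lambda)%R]] < +oo)%E.

End operators.

Definition S_p {R : realType} (mu p : R) := bessel_part mu (Lp_norm mu p).
Definition S_infty {R : realType} (mu : R) := bessel_part mu (Linfty_norm mu).

(* Main.v *)
Require Import Defs.
From mathcomp Require Import all_boot all_order all_algebra.
From mathcomp Require Import measurable_realfun ring lra.

(** Let [S] denote the Bessel operator, [om x = x ^ (mu + 1 / 2)], and write
    functions as [phi = om * Phi]. Since [S om = 0], the operator acts on [Phi] as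
    [L Phi = Phi'' + (2 mu + 1) / x * Phi'], which is symmetric for the weight
    [wt = om ^ 2] and annihilates constants. In terms of [Phi], the norms are those
    of the Lp spaces, including [p = oo], of a multiple of the measure [wt dx].
    So [(lam - L) ^ -1] should be an integral operator with a positive symmetric
    kernel of total mass at most [1 / lam], and such an operator has norm at most
    [1 / lam] in every Lp space.

    The kernel is explicit. The equation [L u = lam * u] has a solution [bi] that
    is regular at 0, given by a power series, and a solution [bk] that decays at
    infinity, given by reduction of order from [bi]; their Wronskian is [1 / wt]. The
    kernel is [green], and the bound on its mass is [green_schur]. It yields the
    norm estimates, trivially for [p = oo] ([Linfty_compatible]) and through
    Jensen's inequality for finite [p] ([Lp_schur]).

    The Bessel operator on the spaces is defined by duality: [S f = g] means that
    [f] paired with [S phi] equals [g] paired with [phi], for all test functions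
    [phi] ([bessel_partP]). All the spaces embed in one weighted L1 space, whose
    weight [ww] dominates the test functions, and pairings with a test function
    are continuous there. This gives
    - closedness, by passage to the limit in the weak equation
      ([bessel_part_closed]);
    - surjectivity of [lam - S]: the image of [g] under the kernel solves the weak
      equation, by Fubini's theorem and the reproduction of a test function
      [phi] from [lam * phi - S phi] by the kernel ([green_representation],
      [cresolvent_weak]);
    - injectivity of [lam - S]: if [S d = lam * d] weakly, then testing with
      [om * exp (- t * x ^ 2)] shows that the transform
      [h t = int (d * om * exp (- t * x ^ 2))] satisfies
      [4 * t ^ 2 * h' = - (lam + 4 * (mu + 1) * t) * h], so that [h] is a
      multiple of [t ^ (- mu - 1) * exp (lam / (4 * t))]. As [d] lies in the
      weighted L1 space, [h] grows at most like a power of [1 / t] at 0, hence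
      vanishes; and it determines [d] ([weak_injective]).

    What a norm has to satisfy for these arguments is collected in
    [compatible_norm]. *)

Set Implicit Arguments.
Unset Strict Implicit.
Unset Printing Implicit Defensive.
Import Order.TTheory GRing.Theory Num.Theory.
Import numFieldNormedType.Exports.
Local Open Scope classical_set_scope.
Local Open Scope complex_scope.
Local Open Scope ring_scope.

(** * Calculus on the half-line *)

Section half_line_calculus.
Context {R : realType}.
Local Notation leb := (@lebesgue_measure R).
Implicit Types (F f : R -> R) (D : set R).

Definition has_derivative F f := forall x : R, 0 < x -> is_derive x 1 F (f x).

Definition pos_continuous f := forall x : R, 0 < x -> {for x, continuous f}.

Lemma eqW d (S : porderType d) (x y : S) : x = y -> (x <= y)%O.
Proof. by move->. Qed.

Lemma half_lineE (x : R) : half_line x = (0 < x).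
Proof. by rewrite /half_line /= in_itv /= andbT. Qed.

Lemma measurable_half_line : measurable (half_line : set R).
Proof. exact: measurable_itv. Qed.

Lemma has_derivative_continuous F f : has_derivative F f -> pos_continuous F.
Proof.
move=> dF x x0; apply/differentiable_continuous/derivable1_diffP.
by have [] := dF x x0.
Qed.

Lemma pos_continuous_within f (a b : R) : 0 < a -> pos_continuous f ->
  {within `[a, b], continuous f}.
Proof.
move=> a0 cf; apply: continuous_in_subspaceT => x.
move=> /set_mem /=; rewrite in_itv /= => /andP[ax _]; apply: cf; exact: lt_le_trans ax.
Qed.

Lemma pos_continuous_measurable f D : pos_continuous f -> measurable D ->
  D `<=` half_line -> measurable_fun D f.
Proof.
move=> cf mD sD; apply: (@measurable_funS _ _ _ _ half_line) => //.
  exact: measurable_half_line.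
apply: subspace_continuous_measurable_fun; first exact: measurable_half_line.
apply: continuous_in_subspaceT => x /set_mem; rewrite half_lineE; exact: cf.
Qed.

Lemma pos_continuous_measurableE f : pos_continuous f ->
  measurable_fun half_line (fun x => (f x)%:E).
Proof.
move=> cf; apply/measurable_EFinP; apply: pos_continuous_measurable => //.
exact: measurable_half_line.
Qed.

Lemma has_derivative_le F f : has_derivative F f ->
  (forall x, 0 < x -> 0 <= f x) ->
  forall x y, 0 < x -> x <= y -> F x <= F y.
Proof.
move=> dF f0 x y x0 xy; rewrite -subr_ge0.
have [|z|z] := @MVT_segment R F f x y xy.
- move=> z; rewrite in_itv /= => /andP[xz _]; apply: dF; exact: lt_trans xz.
- by apply: pos_continuous_within => //; exact: has_derivative_continuous dF.
- rewrite in_itv /= => /andP[xz _] ->; apply: mulr_ge0; last lra.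
  by apply: f0; exact: lt_le_trans xz.
Qed.

Lemma integral_segment F f (a b : R) : has_derivative F f -> pos_continuous f ->
  0 < a -> a <= b ->
  (\int[leb]_(x in `[a, b]) (f x)%:E = (F b - F a)%:E)%E.
Proof.
move=> dF cf a0; rewrite le_eqVlt => /predU1P[<-|ab].
  by rewrite set_itv1 integral_set1 subrr.
rewrite (@continuous_FTC2 R f F a b ab) ?EFinB //.
- exact: pos_continuous_within.
- have cF := has_derivative_continuous dF; split.
  + move=> x; rewrite in_itv /= => /andP[ax _].
    by have [] := dF _ (lt_trans a0 ax).
  + exact/cvg_at_right_filter/cF.
  + by apply/cvg_at_left_filter/cF; exact: lt_trans ab.
- move=> x; rewrite in_itv /= => /andP[ax _].
  by rewrite derive1E; have [_ ->] := dF _ (lt_trans a0 ax).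
Qed.

Section exhaustion.
Variables (D : set R) (a b : nat -> R) (F f : R -> R).
Hypotheses (a0 : forall n, 0 < a n) (ab : forall n, a n <= b n).
Hypothesis nab : nondecreasing_seq (fun n => `[a n, b n]%classic).
Hypothesis DE : \bigcup_n `[a n, b n]%classic = D.
Hypotheses (dF : has_derivative F f) (cf : pos_continuous f).

Let sub_half n : `[a n, b n]%classic `<=` half_line.
Proof.
by move=> x /=; rewrite half_lineE in_itv /= => /andP[+ _]; exact: lt_le_trans.
Qed.

(** Monotone convergence along an exhaustion by compact segments, on each of
    which the fundamental theorem of calculus applies. *)
Lemma exhaustion_le (C : R) : (forall x, 0 < x -> 0 <= f x) ->
  (forall n, F (b n) - F (a n) <= C) ->
  (\int[leb]_(x in D) (f x)%:E <= C%:E)%E.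
Proof.
move=> f0 FC.
have mf n : measurable_fun `[a n, b n] (EFin \o f).
  apply/measurable_EFinP; apply: pos_continuous_measurable => //.
have cvgI : (\int[leb]_(x in `[a n, b n]) (f x)%:E @[n --> \oo] -->
    \int[leb]_(x in D) (f x)%:E)%E.
  rewrite -DE; apply: (@ge0_nondecreasing_set_cvg_integral _ (measurableTypeR R) _
    (fun n => `[a n, b n]%classic) (EFin \o f) leb) => //.
  by move=> n x /sub_half; rewrite half_lineE => /f0; rewrite lee_fin.
apply: (cvge_to_le cvgI).
by apply: nearW => n; rewrite (integral_segment dF) // lee_fin.
Qed.

(** For an integrand without a sign, dominated convergence replaces monotone
    convergence. *)
Lemma exhaustion_eq (c : R) : leb.-integrable D (EFin \o f) ->
  F (b n) - F (a n) @[n --> \oo] --> c ->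
  \int[leb]_(x in D) f x = c.
Proof.
move=> If Fc.
have mD : measurable D by rewrite -DE; apply: bigcupT_measurable.
have DS n : `[a n, b n]%classic `<=` D by move=> x xn; rewrite -DE; exists n.
have : (\int[leb]_(x in D) ((EFin \o f) \_ `[a n, b n]%classic) x @[n --> \oo] -->
    \int[leb]_(x in D) (f x)%:E)%E.
  have [] := @dominated_convergence _ _ _ leb D mD
    (fun n => (EFin \o f) \_ `[a n, b n]%classic) (EFin \o f)
    (abse \o (EFin \o f)).
  - move=> n; apply: (measurable_funS measurableT) => //.
    apply/(measurable_restrictT (EFin \o f)) => //.
    by apply/measurable_EFinP; exact: pos_continuous_measurable.
  - by have /integrableP[] := If.
  - apply: aeW => x; rewrite -DE => -[n _ xn].
    apply: cvg_near_cst; exists n => // m /= nm.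
    rewrite patchE mem_set //.
    by move: (nab nm); rewrite subsetEset; apply.
  - exact: integrable_abse.
  - apply: aeW => x n _ /=; rewrite patchE; case: ifP => // _.
    by rewrite abse0.
  - by [].
have E n : (\int[leb]_(x in D) ((EFin \o f) \_ `[a n, b n]%classic) x =
    (F (b n) - F (a n))%:E)%E.
  rewrite -(integral_segment dF) // [RHS]integral_mkcond [LHS]integral_mkcond.
  apply: eq_integral => x _; rewrite !patchE.
  case: ifP => // /negbT xD; case: ifP => // xab.
  by move: xD; rewrite notin_setE; case; apply: (DS n); exact: set_mem xab.
under eq_fun do rewrite E.
move=> H; rewrite /Rintegral.
have K : ((F (b n) - F (a n))%:E @[n --> \oo] --> c%:E)%E.
  by apply: cvg_EFin => //; exact: nearW.
by rewrite (cvg_unique (@ereal_hausdorff R) H K).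
Qed.

End exhaustion.

End half_line_calculus.

(** * Improper integrals of derivatives *)

Section improper.
Context {R : realType}.
Local Notation leb := (@lebesgue_measure R).
Variables (F f : R -> R).
Hypotheses (dF : has_derivative F f) (cf : pos_continuous f).

Let div_gt0 (x : R) n : 0 < x -> 0 < x / n.+1%:R.
Proof. by move=> x0; rewrite divr_gt0. Qed.

Let div_le (x : R) n : 0 < x -> x / n.+1%:R <= x.
Proof.
by move=> x0; rewrite ler_pdivrMr // ler_peMr ?ler1n // ltW.
Qed.

Let div_decr (x : R) m n : 0 < x -> (m <= n)%N -> x / n.+1%:R <= x / m.+1%:R.
Proof.
by move=> x0 mn; rewrite ler_pM2l // lef_pV2 ?posrE // ler_nat ltnS.
Qed.

Let div_small (x y : R) : 0 < x -> 0 < y -> exists n, x / n.+1%:R <= y.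
Proof.
move=> x0 y0; exists (Num.trunc (x / y)).
rewrite ler_pdivrMr // mulrC -ler_pdivrMr //.
by rewrite ltW // truncnS_gt.
Qed.

Let left_nd (x : R) : 0 < x ->
  nondecreasing_seq (fun n => `[x / n.+1%:R, x]%classic).
Proof.
move=> x0 m n mn; rewrite subsetEset => y /=; rewrite !in_itv /= => /andP[xy ->].
by rewrite andbT (le_trans _ xy) // div_decr.
Qed.

Let left_bigcup (x : R) : 0 < x ->
  \bigcup_n `[x / n.+1%:R, x]%classic = `]0, x]%classic.
Proof.
move=> x0; apply/seteqP; split => y /=; rewrite in_itv /=.
  by move=> [n _]; rewrite /= in_itv /= => /andP[+ ->]; rewrite andbT; exact/lt_le_trans/div_gt0.
move=> /andP[y0 yx]; have [n ny] := div_small x0 y0.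
by exists n; rewrite //= in_itv /= ny.
Qed.

Lemma integral_left_le (x C : R) : 0 < x -> (forall y, 0 < y -> 0 <= f y) ->
  (forall y, 0 < y -> y <= x -> F x - F y <= C) ->
  (\int[leb]_(y in `]0%R, x]) (f y)%:E <= C%:E)%E.
Proof.
move=> x0 f0 FC; apply: (exhaustion_le _ _ (left_nd x0) (left_bigcup x0) dF) => //.
- by move=> n; exact: div_gt0.
- by move=> n; exact: div_le.
- by move=> n; apply: FC; [exact: div_gt0|exact: div_le].
Qed.

Lemma integral_left_eq (x : R) : 0 < x ->
  leb.-integrable `]0, x] (EFin \o f) -> F y @[y --> 0^'+] --> 0 ->
  \int[leb]_(y in `]0, x]) f y = F x.
Proof.
move=> x0 If F0; apply: (exhaustion_eq _ _ (left_nd x0) (left_bigcup x0) dF) => //.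
- by move=> n; exact: div_gt0.
- by move=> n; exact: div_le.
rewrite -[X in _ --> X]subr0; apply: cvgB; first exact: cvg_cst.
move/cvg_at_rightP : F0; apply; split; first by move=> n; exact: div_gt0.
rewrite -(mulr0 x); apply: cvgMr; exact: cvg_harmonic.
Qed.

Let right_nd (x : R) : nondecreasing_seq (fun n => `[x, x + n%:R]%classic).
Proof.
move=> m n mn; rewrite subsetEset => y /=; rewrite !in_itv /= => /andP[-> yx] /=.
by rewrite (le_trans yx) // lerD2l ler_nat.
Qed.

Let right_bigcup (x : R) :
  \bigcup_n `[x, x + n%:R]%classic = `[x, +oo[%classic.
Proof.
apply/seteqP; split => y /=; rewrite in_itv /= andbT.
  by move=> [n _]; rewrite /= in_itv /= => /andP[].
move=> xy; exists (Num.trunc (y - x)).+1 => //=.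
by rewrite in_itv /= xy /= -lerBlDl ltW // truncnS_gt.
Qed.

Lemma integral_right_le (x C : R) : 0 < x -> (forall y, 0 < y -> 0 <= f y) ->
  (forall y, x <= y -> F y - F x <= C) ->
  (\int[leb]_(y in `[x, +oo[) (f y)%:E <= C%:E)%E.
Proof.
move=> x0 f0 FC; apply: (exhaustion_le _ _ (right_nd x) (right_bigcup x) dF) => //.
- by move=> n; rewrite lerDl.
- by move=> n; apply: FC; rewrite lerDl.
Qed.

Lemma integral_right_eq (x : R) : 0 < x ->
  leb.-integrable `[x, +oo[ (EFin \o f) -> F y @[y --> +oo] --> 0 ->
  \int[leb]_(y in `[x, +oo[) f y = - F x.
Proof.
move=> x0 If F0; apply: (exhaustion_eq _ _ (right_nd x) (right_bigcup x) dF) => //.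
- by move=> n; rewrite lerDl.
rewrite -[X in _ --> X]add0r; apply: cvgB; last exact: cvg_cst.
move/cvg_pinftyP : F0; apply; exact: (cvg_comp _ _ (@cvgr_idn R) (cvg_addrl x)).
Qed.

Lemma integral_half_line_le (C : R) : (forall y, 0 < y -> 0 <= f y) ->
  (forall x y, 0 < x -> x <= y -> F y - F x <= C) ->
  (\int[leb]_(y in half_line) (f y)%:E <= C%:E)%E.
Proof.
move=> f0 FC.
have E : \bigcup_n `[1 / n.+1%:R, 1 + n%:R]%classic = half_line :> set R.
  apply/seteqP; split => y; rewrite half_lineE.
    by move=> [n _] /=; rewrite in_itv /= => /andP[+ _]; exact/lt_le_trans/div_gt0.
  move=> y0; have [n ny] := div_small ltr01 y0.
  have := truncnS_gt y; set m := Num.trunc y => ym.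
  exists (maxn n m.+1) => //=; rewrite in_itv /= (le_trans _ ny) ?div_decr ?leq_maxl //=.
  by rewrite (le_trans (ltW ym)) // ler_wpDl // ler_nat leq_maxr.
apply: (exhaustion_le _ _ _ E dF) => //.
- by move=> n; rewrite (le_trans (div_le _ ltr01)) // lerDl.
- move=> m n mn; rewrite subsetEset => y /=; rewrite !in_itv /= => /andP[ly yr].
  rewrite (le_trans _ ly) ?(div_decr ltr01) //= (le_trans yr) //.
  by rewrite lerD2l ler_nat.
- move=> n; apply: FC; first exact: div_gt0 ltr01.
  by rewrite (le_trans (div_le _ ltr01)) // lerDl.
Qed.

End improper.

(** * Power weights and the Gamma function *)

Section weights.
Context {R : realType}.
Local Notation leb := (@lebesgue_measure R).

Lemma exprn_le_expR (x : R) n : 0 <= x -> x ^+ n <= n`!%:R * expR x.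
Proof.
move=> x0; case: n => [|n]; first by rewrite expr0 fact0 mul1r (le_trans _ (expR_ge1Dx x)) ?lerDl.
rewrite -ler_pdivrMl ?ltr0n ?fact_gt0 // mulrC.
by rewrite (le_trans _ (expR_ge1Dxn n x0)) // lerDr.
Qed.

Lemma powR_continuous (b : R) : pos_continuous (fun x : R => x `^ b).
Proof.
apply: (@has_derivative_continuous _ _ (fun x => b * x `^ (b - 1))) => x x0.
exact: is_derive1_powR.
Qed.

Lemma pos_continuousM (f g : R -> R) :
  pos_continuous f -> pos_continuous g -> pos_continuous (fun x => f x * g x).
Proof. by move=> cf cg x x0; apply: cvgM; [exact: cf|exact: cg]. Qed.

Lemma exprV_1D_continuous n : pos_continuous (fun x : R => (1 + x) ^- n).
Proof.
move=> x x0; apply: cvgV; first by rewrite expf_neq0 // gt_eqF //; lra.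
apply: (@continuous_comp _ _ _ (fun y : R => 1 + y) (@GRing.exp R ^~ n)).
  by apply: cvgD; [exact: cvg_cst|exact: cvg_id].
exact: exprn_continuous.
Qed.

Lemma is_derive_1D (x : R) : is_derive x 1 (fun y : R => 1 + y) 1.
Proof. by apply: is_derive_eq; rewrite add0r mulr1. Qed.

Lemma powR_1D_derive (b : R) :
  has_derivative (fun x : R => (1 + x) `^ b) (fun x => b * (1 + x) `^ (b - 1)).
Proof.
move=> x x0; have x10 : 0 < 1 + x by lra.
have := is_derive1_comp (is_derive1_powR b x10) (is_derive_1D x).
by rewrite mulr1.
Qed.

Lemma powR_1D_continuous (b : R) : pos_continuous (fun x : R => (1 + x) `^ b).
Proof. exact: has_derivative_continuous (powR_1D_derive b). Qed.

(** [(x / (1 + x)) ^ (b + 1)] is bounded by 1, and its derivative is a multiple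
    of [x ^ b (1 + x) ^ (- b - 2)]. *)
Lemma power_weight_integral (b : R) : -1 < b ->
  (\int[leb]_(x in half_line) (x `^ b * (1 + x) `^ (- b - 2))%:E
     <= ((b + 1)^-1)%:E)%E.
Proof.
move=> b1; have b0 : 0 < b + 1 by lra.
pose F (x : R) := (b + 1)^-1 * (x `^ (b + 1) * (1 + x) `^ (- (b + 1))).
apply: (@integral_half_line_le _ F).
- move=> x x0; have x10 : 0 < 1 + x by lra.
  have d1 := is_derive1_powR (b + 1) x0.
  have d2 := powR_1D_derive (- (b + 1)) x0.
  apply: is_derive_eq; rewrite /GRing.scale /=.
  have -> : (1 + x) `^ (- (b + 1)) = (1 + x) * (1 + x) `^ (- b - 2).
    rewrite -[X in X * _](powRr1 (ltW x10)) -powRD; first by congr (_ `^ _); ring.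
    by apply/implyP => _; rewrite gt_eqF.
  have -> : - (b + 1) - 1 = - b - 2 by ring.
  have -> : b + 1 - 1 = b by ring.
  rewrite powRD ?gt_eqF ?implybT // powRr1 ?ltW //.
  field; lra.
- by apply: pos_continuousM; [exact: powR_continuous|exact: powR_1D_continuous].
- by move=> x x0; rewrite mulr_ge0 ?powR_ge0.
- move=> x y x0 xy; have y0 : 0 < y by exact: lt_le_trans xy.
  rewrite lerBlDr; apply: le_trans (_ : (b + 1)^-1 <= _); last first.
    by rewrite lerDl /F !mulr_ge0 ?powR_ge0 // invr_ge0 ltW.
  rewrite /F -[leRHS]mulr1; apply: ler_wpM2l; first by rewrite invr_ge0 ltW.
  rewrite powRN ler_pdivrMr ?powR_gt0 ?mul1r //; last lra.
  by apply: ge0_ler_powR; rewrite ?nnegrE; lra.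
Qed.

Lemma power_weight_integralS (b : R) (M : nat) : -1 < b -> b + 2 <= M%:R ->
  (\int[leb]_(x in half_line) (x `^ b * (1 + x) ^- M)%:E
     <= ((b + 1)^-1)%:E)%E.
Proof.
move=> b1 bM; apply: le_trans (power_weight_integral b1).
have mh := @measurable_half_line R.
apply: ge0_le_integral => //.
- move=> x; rewrite half_lineE => x0; rewrite lee_fin mulr_ge0 ?powR_ge0 //.
  by rewrite invr_ge0 exprn_ge0 //; lra.
- apply: pos_continuous_measurableE.
  apply: pos_continuousM; first exact: powR_continuous.
  exact: exprV_1D_continuous.
- apply: pos_continuous_measurableE.
  by apply: pos_continuousM; [exact: powR_continuous|exact: powR_1D_continuous].
- move=> x; rewrite half_lineE => x0; rewrite lee_fin.
  apply: ler_wpM2l; first exact: powR_ge0.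
  rewrite -powR_mulrn; last lra.
  by rewrite -powRN ler_powR //; lra.
Qed.

Lemma Gamma_integrand_continuous (a : R) :
  pos_continuous (fun x : R => x `^ (a - 1) * expR (- x)).
Proof.
apply: pos_continuousM; first exact: powR_continuous.
by move=> x x0; apply: continuous_comp; [exact: opp_continuous|exact: continuous_expR].
Qed.

(** The real value of a divergent integral is 0, so that positivity requires
    convergence: the exponential is compared with a power weight. The lower bound
    comes from the segment from 1 to 2. *)
Lemma Gamma_gt0 (a : R) : 0 < a -> 0 < Gamma a.
Proof.
move=> a0; have mh := @measurable_half_line R.
set f := fun x : R => x `^ (a - 1) * expR (- x).
have cf : pos_continuous f by exact: Gamma_integrand_continuous.
have f0 x : 0 < x -> 0 < f x by move=> x0; rewrite mulr_gt0 ?powR_gt0 ?expR_gt0.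
pose n := (Num.trunc (a + 1)).+1.
have an : a + 1 <= n%:R by rewrite ltW // truncnS_gt.
pose K : R := n`!%:R * expR 1.
have K0 : 0 <= K by rewrite mulr_ge0 ?expR_ge0.
have fin : (\int[leb]_(x in half_line) (f x)%:E < +oo)%E.
  apply: (@le_lt_trans _ _ (K%:E * \int[leb]_(x in half_line)
      (x `^ (a - 1) * (1 + x) ^- n)%:E)%E); last first.
    apply: lte_mul_pinfty => //.
    apply: le_lt_trans (power_weight_integralS (b := a - 1) (M := n) _ _) _; [lra|lra|].
    exact: ltry.
  rewrite -ge0_integralZl_EFin //; last 2 first.
  - move=> x; rewrite half_lineE => x0; rewrite lee_fin mulr_ge0 ?powR_ge0 //.
    by rewrite invr_ge0 exprn_ge0 //; lra.
  - apply: pos_continuous_measurableE.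
    apply: pos_continuousM; first exact: powR_continuous.
    exact: exprV_1D_continuous.
  apply: ge0_le_integral => //.
  - by move=> x; rewrite half_lineE => /f0/ltW; rewrite lee_fin.
  - exact: pos_continuous_measurableE.
  - apply: pos_continuous_measurableE.
    apply: pos_continuousM; first by move=> x _; exact: cvg_cst.
    apply: pos_continuousM; first exact: powR_continuous.
    exact: exprV_1D_continuous.
  - move=> x; rewrite half_lineE => x0; rewrite lee_fin /f mulrCA.
    apply: ler_wpM2l; first exact: powR_ge0.
    rewrite ler_pdivlMr ?exprn_gt0 //; last lra.
    rewrite mulrC expRN ler_pdivrMr ?expR_gt0 // /K -mulrA -expRD.
    by apply: exprn_le_expR; lra.
have [c c12 cmin] := @EVT_min R f 1 2 (ler1n _ 2) (pos_continuous_within ltr01 cf).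
have fc0 : 0 < f c.
  by apply: f0; move: c12; rewrite in_itv /= => /andP[? _]; lra.
rewrite /Gamma /Rintegral fine_gt0 // fin andbT.
apply: (@lt_le_trans _ _ (\int[leb]_(x in `[1%R, 2%R]) (f c)%:E)%E).
  rewrite integral_cst //= lebesgue_measure_itv /= lte_fin ltr1n -EFinB -EFinM.
  by rewrite lte_fin mulr_gt0 //; lra.
have s12 : `[1, 2]%classic `<=` (half_line : set R).
  by move=> x /=; rewrite half_lineE in_itv /= => /andP[? _]; lra.
apply: (@le_trans _ _ (\int[leb]_(x in `[1%R, 2%R]) (f x)%:E)%E).
  apply: ge0_le_integral => //.
  - by move=> x _; rewrite lee_fin ltW.
  - by apply/measurable_EFinP; exact: pos_continuous_measurable.
apply: ge0_subset_integral => //.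
- exact: pos_continuous_measurableE.
- by move=> x; rewrite half_lineE => /f0/ltW; rewrite lee_fin.
Qed.

Lemma c_gt0 (mu : R) : - 2^-1 < mu -> 0 < c_ mu.
Proof.
by move=> h; rewrite /c_ mulr_gt0 ?powR_gt0 // Gamma_gt0 //; lra.
Qed.

End weights.

(** * Everywhere convergent power series *)

Section entire_series.
Context {R : realType}.
Implicit Types (c : R^nat).

(** A growth condition on the coefficients that formal differentiation
    preserves. *)
Definition exp_dominated c :=
  exists C L : R, forall n, `|c n| <= C * (L ^+ n / n`!%:R).

Lemma exp_dominated_diffs c : exp_dominated c -> exp_dominated (pseries_diffs c).
Proof.
move=> [C [L cCL]]; exists (C * L), L => n; rewrite /pseries_diffs normrM normr_nat.
apply: le_trans (ler_wpM2l _ (cCL n.+1)) _ => //.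
rewrite factS natrM exprS; apply: eqW.
by field; rewrite nat1r !pnatr_eq0 -lt0n fact_gt0.
Qed.

Lemma exp_dominated_cvg c z : exp_dominated c -> cvgn (pseries c z).
Proof.
move=> [C [L cCL]]; rewrite /pseries; apply: normed_cvg.
have C0 : 0 <= C by have := le_trans (normr_ge0 _) (cCL 0%N); rewrite expr0 fact0 divr1 mulr1.
apply: (@series_le_cvg _ _ (fun n => C * exp_coeff (`|L * z|) n)) => [//=|n|n|].
- by rewrite mulr_ge0 // exp_coeff_ge0.
- rewrite /= normrM normrX; apply: le_trans (ler_wpM2r _ (le_trans (cCL n) (_ : _ <= C * (`|L| ^+ n / n`!%:R)))) _.
  + by rewrite exprn_ge0.
  + apply: ler_wpM2l => //; apply: ler_wpM2r; first by rewrite invr_ge0.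
    by rewrite -normrX ler_norm.
  + by rewrite /exp_coeff /= normrM exprMn -!mulrA (mulrC _^-1).
- have -> : (fun n => C * exp_coeff `|L * z| n) = C *: exp_coeff `|L * z| by [].
  by apply: is_cvg_seriesZ; exact: is_cvg_series_exp_coeff.
Qed.

Definition psum c (z : R) : R := limn (pseries c z).

Lemma psum_derive c (z : R) : exp_dominated c ->
  is_derive z 1 (psum c) (psum (pseries_diffs c) z).
Proof.
move=> dc; have dc1 := exp_dominated_diffs dc; have dc2 := exp_dominated_diffs dc1.
apply: (@pseries_snd_diffs _ c (`|z| + 1)); [exact: exp_dominated_cvg..|].
by rewrite (ger0_norm (_ : 0 <= `|z| + 1)) ?addr_ge0 // ltrDl.
Qed.

Lemma psum_ge_term c z n : exp_dominated c -> (forall k, 0 <= c k) -> 0 <= z ->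
  c n * z ^+ n <= psum c z.
Proof.
move=> dc c0 z0; have t0 k : 0 <= c k * z ^+ k by rewrite mulr_ge0 ?exprn_ge0.
apply: (@le_trans _ _ (pseries c z n.+1)).
  by rewrite /pseries /series /= big_nat_recr //= lerDr sumr_ge0.
apply: nondecreasing_cvgn_le; last exact: exp_dominated_cvg.
by apply/nondecreasing_seqP => k; rewrite /pseries /series /= big_nat_recr //= lerDl.
Qed.

End entire_series.

(** * The modified Bessel series *)

Section modified_bessel_series.
Context {R : realType}.
Variables (mu lam : R).
Hypotheses (hmu : - 2^-1 < mu) (lam0 : 0 < lam).

(** The series of the modified Bessel function of the first kind, normalised
    to take the value 1 at 0 and read in the variable [z = x ^ 2]. *)
Fixpoint bessel_coef (n : nat) : R :=
  if n is m.+1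
  then bessel_coef m * (lam / 4) / (m.+1%:R * (m.+1%:R + mu)) else 1.

Let Smu n : 2^-1 < n.+1%:R + mu.
Proof.
have hm := hmu; have n0 : (0 : R) <= n%:R := ler0n _ _.
by rewrite -[n.+1%:R]natr1; lra.
Qed.

Lemma bessel_coef_gt0 n : 0 < bessel_coef n.
Proof.
have l0 := lam0; elim: n => [|n IH] //=; have Sn := Smu n.
by rewrite divr_gt0 ?mulr_gt0 //; lra.
Qed.

Lemma bessel_coef_exp_dominated : exp_dominated bessel_coef.
Proof.
have l0 := lam0; exists 1, (lam / 2); elim=> [|n IH]; first by rewrite /= normr1 fact0 expr0 divr1 mul1r.
rewrite !gtr0_norm ?bessel_coef_gt0 // in IH *.
have Sn := Smu n; rewrite /= mul1r exprS factS natrM.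
have n0 : (0 : R) < n.+1%:R by [].
have f0 : (0 : R) < n`!%:R by rewrite ltr0n fact_gt0.
apply: le_trans (_ : bessel_coef n * (lam / 2) / n.+1%:R <= _).
  rewrite -subr_ge0.
  have -> : bessel_coef n * (lam / 2) / n.+1%:R -
    bessel_coef n * (lam / 4) / (n.+1%:R * (n.+1%:R + mu)) =
    bessel_coef n * (lam / 4) * (2 * (n.+1%:R + mu) - 1) / (n.+1%:R * (n.+1%:R + mu)).
    by field; rewrite !gt_eqF //; lra.
  have c0 := bessel_coef_gt0 n.
  apply: divr_ge0; last by apply: mulr_ge0; lra.
  by apply: mulr_ge0; [apply: mulr_ge0|]; lra.
have -> : lam / 2 * (lam / 2) ^+ n / (n.+1%:R * n`!%:R) =
    (1 * ((lam / 2) ^+ n / n`!%:R)) * ((lam / 2) / n.+1%:R).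
  by field; rewrite !gt_eqF.
rewrite -mulrA; apply: ler_wpM2r => //.
by rewrite divr_ge0 ?(ltW n0) //; lra.
Qed.

Definition bI0 : R -> R := psum bessel_coef.
Definition bI1 : R -> R := psum (pseries_diffs bessel_coef).
Definition bI2 : R -> R := psum (pseries_diffs (pseries_diffs bessel_coef)).

Let dom0 := bessel_coef_exp_dominated.
Let dom1 := exp_dominated_diffs dom0.
Let dom2 := exp_dominated_diffs dom1.

Lemma bI0_derive (z : R) : is_derive z 1 bI0 (bI1 z).
Proof. exact: psum_derive. Qed.

Lemma bI1_derive (z : R) : is_derive z 1 bI1 (bI2 z).
Proof. exact: psum_derive. Qed.

Lemma bI0_ge1 z : 0 <= z -> 1 <= bI0 z.
Proof.
move=> z0; have := psum_ge_term 0 dom0 (fun k => ltW (bessel_coef_gt0 k)) z0.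
by rewrite expr0 mulr1.
Qed.

Lemma bI1_ge z n : 0 <= z -> n.+1%:R * bessel_coef n.+1 * z ^+ n <= bI1 z.
Proof.
move=> z0; apply: (psum_ge_term n dom1) => // k.
by rewrite mulr_ge0 ?(ltW (bessel_coef_gt0 _)).
Qed.

(** This is [u'' + (2 mu + 1) / x * u' = lam * u] for [u x = bI0 (x ^ 2)], after
    division by 4. *)
Lemma bI_ode z : z * bI2 z + (mu + 1) * bI1 z = lam / 4 * bI0 z.
Proof.
pose d1 := pseries_diffs bessel_coef.
have h2 : (fun n => z * series (fun i => i%:R * d1 i * z ^+ i.-1) n) @ \oo
    --> z * bI2 z.
  by apply: cvgMl_tmp; apply: pseries_diffs_equiv; exact: exp_dominated_cvg.
have h1 : (fun n => (mu + 1) * pseries d1 z n) @ \oo --> (mu + 1) * bI1 z.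
  by apply: cvgMl_tmp; exact: exp_dominated_cvg.
have h0 : (fun n => lam / 4 * pseries bessel_coef z n) @ \oo --> lam / 4 * bI0 z.
  by apply: cvgMl_tmp; exact: exp_dominated_cvg.
have E n : z * series (fun i => i%:R * d1 i * z ^+ i.-1) n +
    (mu + 1) * pseries d1 z n = lam / 4 * pseries bessel_coef z n.
  rewrite /pseries /series /= !mulr_sumr -big_split /=; apply: eq_bigr => i _.
  rewrite /d1 /pseries_diffs /=.
  have -> u : z * (i%:R * u * z ^+ i.-1) = i%:R * u * z ^+ i.
    by case: i => [|i]; rewrite ?mul0r ?mulr0 //= exprS; ring.
  have hm := hmu; have := Smu i; rewrite -[i.+1%:R]natr1 => Si; field.
  by rewrite !gt_eqF //; have i0 : (0 : R) <= i%:R := ler0n _ _; lra.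
have h21 : (fun n => z * series (fun i => i%:R * d1 i * z ^+ i.-1) n +
    (mu + 1) * pseries d1 z n) @ \oo --> z * bI2 z + (mu + 1) * bI1 z.
  exact: cvgD.
by rewrite (funext E) in h21; exact: (cvg_unique (@Rhausdorff R) h21 h0).
Qed.

End modified_bessel_series.

(** * The two solutions of the modified Bessel equation *)

Section bessel_functions.
Context {R : realType}.
Local Notation leb := (@lebesgue_measure R).
Variables (mu lam : R).
Hypotheses (hmu : - 2^-1 < mu) (lam0 : 0 < lam).

(** A multiple of [x ^ (- mu) * I_mu (sqrt lam * x)]: the solution of
    [u'' + (2 mu + 1) / x * u' = lam * u] that is regular at 0. *)
Definition bi (x : R) : R := bI0 mu lam (x ^+ 2).
Fact bessel_key : unit. Proof. exact: tt. Qed.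
(** Locked, and likewise [bk] below, to keep unification away from the power
    series. *)
Definition bi' := locked_with bessel_key (fun x : R => 2 * x * bI1 mu lam (x ^+ 2)).

Lemma bi'E : bi' = fun x => 2 * x * bI1 mu lam (x ^+ 2).
Proof. by rewrite /bi' unlock. Qed.

(** The equation has the divergence form [(wt * u')' = lam * wt * u]; the
    product [wt * u'] is the flux of [u]. *)
Definition wt (x : R) : R := x `^ (2 * mu + 1).

Lemma wt_gt0 (x : R) : 0 < x -> 0 < wt x.
Proof. exact: powR_gt0. Qed.

Lemma wt_derive : has_derivative wt (fun x => (2 * mu + 1) * (wt x / x)).
Proof.
move=> x x0; have := is_derive1_powR (2 * mu + 1) x0.
by rewrite powRB ?(gt_eqF x0) ?implybT // powRr1 // ltW.
Qed.

Lemma wt_continuous : pos_continuous wt.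
Proof. exact: powR_continuous. Qed.

Lemma is_derive_sqr (x : R) : is_derive x 1 (fun y : R => y ^+ 2) (2 * x).
Proof. by apply: is_derive_eq; rewrite /GRing.scale /=; ring. Qed.

Lemma is_derive_comp_sqr (f : R -> R) (x a : R) : is_derive (x ^+ 2) 1 f a ->
  is_derive x 1 (fun y : R => f (y ^+ 2)) (a * (2 * x)).
Proof.
move=> df; exact: (@is_derive1_comp R f (fun y => y ^+ 2) x _ _ df (is_derive_sqr x)).
Qed.

Lemma bi_derive : has_derivative bi bi'.
Proof.
move=> x x0; have := is_derive_comp_sqr (bI0_derive hmu lam0 (x ^+ 2)).
by rewrite bi'E mulrC.
Qed.

Lemma bi_ge1 x : 1 <= bi x.
Proof. by apply: bI0_ge1; rewrite ?sqr_ge0. Qed.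

Lemma bi_gt0 x : 0 < bi x.
Proof. exact: lt_le_trans (bi_ge1 x). Qed.

Lemma bi_continuous : pos_continuous bi.
Proof. exact: has_derivative_continuous bi_derive. Qed.

Lemma bi'_ge x n : 0 < x ->
  2 * (n.+1%:R * bessel_coef mu lam n.+1) * x ^+ (n.*2).+1 <= bi' x.
Proof.
move=> x0; have := bI1_ge hmu lam0 n (sqr_ge0 x).
rewrite -(ler_pM2l (_ : 0 < 2 * x)); last by rewrite mulr_gt0.
rewrite bi'E; apply: le_trans; apply: eqW.
by rewrite -exprM mul2n exprS; ring.
Qed.

Lemma bi'_gt0 x : 0 < x -> 0 < bi' x.
Proof.
move=> x0; apply: lt_le_trans (bi'_ge 0 x0); apply: mulr_gt0 => //.
by do 2 apply: mulr_gt0 => //; exact: bessel_coef_gt0.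
Qed.

Lemma bi_flux_derive :
  has_derivative (fun x => wt x * bi' x) (fun x => lam * (wt x * bi x)).
Proof.
rewrite bi'E => x x0; have x_neq0 : x != 0 by rewrite gt_eqF.
have d0 := wt_derive x0.
have d1 := is_derive_comp_sqr (bI1_derive hmu lam0 (x ^+ 2)).
have ode := bI_ode hmu lam0 (x ^+ 2).
have d2 : is_derive x 1 (fun x => 2 * x * bI1 mu lam (x ^+ 2)) (2 * bI1 mu lam (x ^+ 2)
    + 2 * x * (bI2 mu lam (x ^+ 2) * (2 * x))).
  apply: is_derive_eq; rewrite /GRing.scale /=; ring.
have d3 := is_deriveM d0 d2.
apply: (is_derive_eq d3); rewrite /GRing.scale /= /bi.
have -> : lam * (wt x * bI0 mu lam (x ^+ 2)) = 4 * wt x * (lam / 4 * bI0 mu lam (x ^+ 2)).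
  by field.
by rewrite -ode; field.
Qed.

Lemma bi'_continuous : pos_continuous bi'.
Proof.
rewrite bi'E; apply: pos_continuousM.
  by move=> x x0; apply: cvgM; [exact: cvg_cst|exact: cvg_id].
apply: has_derivative_continuous => x x0.
exact: is_derive_comp_sqr (bI1_derive hmu lam0 (x ^+ 2)).
Qed.

Lemma bi_incr x y : 0 < x -> x <= y -> bi x <= bi y.
Proof.
apply: (has_derivative_le bi_derive) => z z0; exact/ltW/bi'_gt0.
Qed.

Lemma bi_flux_incr x y : 0 < x -> x <= y -> wt x * bi' x <= wt y * bi' y.
Proof.
apply: (has_derivative_le bi_flux_derive) => z z0.
by rewrite !mulr_ge0 ?(ltW lam0) ?(ltW (bi_gt0 _)) ?powR_ge0.
Qed.

(** Reduction of order: the quotient of two solutions has a multiple of [bq] as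
    its derivative. *)
Definition bq (x : R) : R := (wt x * bi x ^+ 2)^-1.

Lemma bq_gt0 x : 0 < x -> 0 < bq x.
Proof. by move=> x0; rewrite invr_gt0 mulr_gt0 ?wt_gt0 ?exprn_gt0 ?bi_gt0. Qed.

Lemma bq_continuous : pos_continuous bq.
Proof.
move=> x x0; apply: cvgV; first by rewrite gt_eqF // -invr_gt0 bq_gt0.
apply: cvgM; first exact: wt_continuous.
by apply: cvgM; exact: bi_continuous.
Qed.

(** The flux of [bi] increases, so that [bq] is at most a multiple of
    [bi' / bi ^ 2], the derivative of [- bi ^ -1]. *)
Lemma bq_tail (x : R) : 0 < x ->
  (\int[leb]_(y in `[x, +oo[) (bq y)%:E <= ((wt x * bi' x * bi x)^-1)%:E)%E.
Proof.
move=> x0; have Ex0 : 0 < wt x * bi' x by rewrite mulr_gt0 ?wt_gt0 ?bi'_gt0.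
pose f y := (wt x * bi' x)^-1 * (bi' y / bi y ^+ 2).
pose F y := - (wt x * bi' x)^-1 * (bi y)^-1.
have cf : pos_continuous f.
  move=> y y0; apply: cvgM; first exact: cvg_cst.
  apply: cvgM; first exact: bi'_continuous.
  apply: cvgV; first by rewrite expf_neq0 // gt_eqF ?bi_gt0.
  by apply: cvgM; exact: bi_continuous.
have dF : has_derivative F f.
  move=> y y0; have d := bi_derive y0.
  have d2 := is_deriveV (lt0r_neq0 (bi_gt0 y)) d.
  apply: is_derive_eq; rewrite /f /GRing.scale /=; ring.
have f0 y : 0 < y -> 0 <= f y.
  move=> y0; rewrite mulr_ge0 ?invr_ge0 ?(ltW Ex0) //.
  by rewrite divr_ge0 ?exprn_ge0 ?(ltW (bi_gt0 _)) ?(ltW (bi'_gt0 _)).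
have sub : `[x, +oo[%classic `<=` (half_line : set R).
  by move=> y /=; rewrite half_lineE in_itv /= andbT; exact: lt_le_trans.
apply: (@le_trans _ _ (\int[leb]_(y in `[x, +oo[) (f y)%:E)%E).
  apply: ge0_le_integral => //.
  - by move=> y /sub; rewrite half_lineE => /bq_gt0/ltW; rewrite lee_fin.
  - apply/measurable_EFinP; apply: pos_continuous_measurable => //.
    exact: bq_continuous.
  - by apply/measurable_EFinP; exact: pos_continuous_measurable.
  - move=> y xy; have y0 : 0 < y by have := sub _ xy; rewrite half_lineE.
    move: xy; rewrite /= in_itv /= andbT => xy.
    rewrite lee_fin /bq /f invfM mulrA.
    apply: ler_wpM2r; first by rewrite invr_ge0 exprn_ge0 ?(ltW (bi_gt0 _)).
    have wy0 := wt_gt0 y0.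
    by rewrite ler_pdivlMl // ler_pdivrMr // [leRHS]mulrC bi_flux_incr.
apply: (integral_right_le dF cf) => // y xy.
have h : 0 <= (wt x * bi' x)^-1 * (bi y)^-1.
  by rewrite mulr_ge0 ?invr_ge0 ?(ltW Ex0) ?(ltW (bi_gt0 _)).
by rewrite /F [X in _ <= X]invfM; lra.
Qed.

Definition bJ (x : R) : R := \int[leb]_(y in `]x, +oo[) bq y.

Lemma bq_integrable (x : R) : 0 < x -> leb.-integrable `[x, +oo[ (EFin \o bq).
Proof.
move=> x0; have sub : `[x, +oo[%classic `<=` (half_line : set R).
  by move=> y /=; rewrite half_lineE in_itv /= andbT; exact: lt_le_trans.
apply/integrableP; split.
  apply/measurable_EFinP; apply: pos_continuous_measurable => //.
  exact: bq_continuous.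
apply: le_lt_trans (ltry ((wt x * bi' x * bi x)^-1)).
apply: le_trans (bq_tail x0); apply: eqW.
apply: eq_integral => y /set_mem/sub; rewrite half_lineE => y0.
by rewrite /= ger0_norm // ltW // bq_gt0.
Qed.

Lemma bJ_ge0 x : 0 < x -> 0 <= bJ x.
Proof.
move=> x0; apply: Rintegral_ge0 => y; rewrite /= in_itv /= andbT => xy.
by rewrite ltW // bq_gt0 // (lt_trans x0).
Qed.

Lemma bJ_le x : 0 < x -> bJ x <= (wt x * bi' x * bi x)^-1.
Proof.
move=> x0; have Iq := bq_integrable x0.
rewrite /bJ Rintegral_itv_obnd_cbnd; last first.
  by apply: integrableS Iq => //; apply: subset_itvr; rewrite bnd_simp.
rewrite -lee_fin fineK ?bq_tail //.
exact: integrable_fin_num.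
Qed.

Lemma bJ_derive : has_derivative bJ (fun x => - bq x).
Proof.
move=> x x0; pose c := x / 2.
have c0 : 0 < c by rewrite divr_gt0.
have cx : c < x by rewrite /c; lra.
have Iq := bq_integrable c0.
have [||||dF F'] := @continuous_FTC1 R bq (BLeft c) x (x + 1).
- by rewrite ltrDl.
- by apply: integrableS Iq => //; apply: subset_itvl; rewrite bnd_simp.
- by rewrite lte_fin.
- exact: bq_continuous.
have d : is_derive x 1 (fun y => bJ c + \int[leb]_(t in `[c, c]) bq t
    - \int[leb]_(t in `[c, y]) bq t) (- bq x).
  have d1 : is_derive x 1 (fun y => \int[leb]_(t in `[c, y]) bq t) (bq x).
    by apply: DeriveDef; rewrite -?derive1E.
  by apply: (is_derive_eq (is_deriveB (is_derive_cst _ x 1) d1)); rewrite sub0r.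
apply: near_eq_is_derive d; near=> y.
have cy : c < y by near: y; exact: lt_nbhsr.
have H z : c <= z -> \int[leb]_(t in `[c, +oo[) bq t - \int[leb]_(t in `[c, z]) bq t = bJ z.
  by move=> cz; rewrite (Rintegral_itvB Iq) // bnd_simp.
by rewrite -(H y (ltW cy)) -(H c) // subrK.
Unshelve. all: by end_near. Qed.

(** The solution that decays at infinity, a multiple of
    [x ^ (- mu) * K_mu (sqrt lam * x)]. *)
Definition bk := locked_with bessel_key (fun x : R => bi x * bJ x).

Lemma bkE : bk = fun x => bi x * bJ x.
Proof. by rewrite /bk unlock. Qed.

Definition bk' (x : R) : R := bi' x * bJ x - (wt x * bi x)^-1.

Lemma bk_derive : has_derivative bk bk'.
Proof.
rewrite bkE => x x0; have d1 := bi_derive x0; have d2 := bJ_derive x0.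
apply: (is_derive_eq (is_deriveM d1 d2)); rewrite /bk' /bq /GRing.scale /=.
by field; rewrite !gt_eqF ?wt_gt0 ?bi_gt0.
Qed.

Lemma bk_continuous : pos_continuous bk.
Proof. exact: has_derivative_continuous bk_derive. Qed.

Lemma bk_ge0 x : 0 < x -> 0 <= bk x.
Proof. by move=> x0; rewrite bkE mulr_ge0 ?bJ_ge0 ?(ltW (bi_gt0 _)). Qed.

Lemma bk_le x : 0 < x -> bk x <= (wt x * bi' x)^-1.
Proof.
move=> x0; rewrite bkE mulrC -ler_pdivlMr ?bi_gt0 //.
by rewrite -invfM bJ_le.
Qed.

(** The bound of [bq_tail] is exactly what the monotonicity of [bk] requires. *)
Lemma bk'_le0 x : 0 < x -> bk' x <= 0.
Proof.
move=> x0; rewrite /bk' subr_le0 mulrC -ler_pdivlMr ?bi'_gt0 //.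
rewrite -invfM (_ : wt x * bi x * bi' x = wt x * bi' x * bi x) ?bJ_le //.
by rewrite mulrAC.
Qed.

Lemma bk_flux_derive :
  has_derivative (fun x => wt x * bk' x) (fun x => lam * (wt x * bk x)).
Proof.
move=> x x0.
have d1 := bi_flux_derive x0; have d2 := bJ_derive x0.
have d3 := is_deriveV (lt0r_neq0 (bi_gt0 x)) (bi_derive x0).
have d := is_deriveB (is_deriveM d1 d2) d3.
have {}d : is_derive x 1 (fun x => wt x * bi' x * bJ x - (bi x)^-1)
    (lam * (wt x * bk x)).
  apply: (is_derive_eq d); rewrite bkE /bq /GRing.scale /=.
  by field; rewrite !gt_eqF ?wt_gt0 ?bi_gt0.
apply: near_eq_is_derive d; near=> y.
have y0 : 0 < y by near: y; exact: lt_nbhsr.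
by rewrite /bk'; field; rewrite !gt_eqF ?wt_gt0 ?bi_gt0.
Unshelve. all: by end_near. Qed.

Lemma wronskian x : 0 < x -> wt x * (bi' x * bk x - bi x * bk' x) = 1.
Proof.
by move=> x0; rewrite bkE /bk'; field; rewrite !gt_eqF ?wt_gt0 ?bi_gt0.
Qed.

Lemma bk_decr x y : 0 < x -> x <= y -> bk y <= bk x.
Proof.
move=> x0 xy; rewrite -lerN2.
apply: (has_derivative_le (F := fun z => - bk z) (f := fun z => - bk' z)) => //.
  by move=> z z0; have d := bk_derive z0; exact: is_deriveN.
by move=> z z0; rewrite oppr_ge0 bk'_le0.
Qed.

End bessel_functions.

(** * The weights on the half-line *)

Section test_weight.
Context {R : realType}.
Local Notation leb := (@lebesgue_measure R).
Variables (mu : R).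
Hypotheses (hmu : - 2^-1 < mu).

(** The Bessel operator annihilates [om], and acts on the quotients [phi / om] as
    [Phi |-> Phi'' + (2 mu + 1) / x * Phi']. *)
Definition om (x : R) : R := x `^ (mu + 2^-1).

Lemma om_gt0 x : 0 < x -> 0 < om x.
Proof. exact: powR_gt0. Qed.

Lemma om_ge0 x : 0 <= om x.
Proof. exact: powR_ge0. Qed.

Lemma om_continuous : pos_continuous om.
Proof. exact: powR_continuous. Qed.

Lemma om_om x : 0 < x -> om x * om x = wt mu x.
Proof.
move=> x0; rewrite /om /wt -powRD; first by congr (_ `^ _); field.
by rewrite (gt_eqF x0) implybT.
Qed.

Lemma r_om x : 0 < x -> r_ mu x * om x = 1.
Proof.
move=> x0; rewrite /r_ /om -powRD; last by rewrite (gt_eqF x0) implybT.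
by rewrite (_ : _ + _ = 0) ?powRr0 //; ring.
Qed.

(** An exponent that makes [om * ww] integrable. *)
Definition wM : nat := (Num.trunc (2 * mu + 3)).+1.

Lemma wM_ge : 2 * mu + 3 <= wM%:R.
Proof. by rewrite ltW // truncnS_gt. Qed.

(** Up to constants, [ww] dominates every test function and every section of the
    Green kernel; integrability against it is all that the weak equation asks
    of a function. *)
Definition ww (x : R) : R := om x * (1 + x) ^- wM.

Lemma ww_gt0 x : 0 < x -> 0 < ww x.
Proof.
by move=> x0; rewrite mulr_gt0 ?om_gt0 // invr_gt0 exprn_gt0 //; lra.
Qed.

Lemma ww_continuous : pos_continuous ww.
Proof.
by apply: pos_continuousM; [exact: om_continuous|exact: exprV_1D_continuous].
Qed.

Lemma om_ww_integrable : leb.-integrable half_line (EFin \o (fun x => om x * ww x)).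
Proof.
have hm := hmu.
have E x : 0 < x -> om x * ww x = wt mu x * (1 + x) ^- wM.
  by move=> x0; rewrite mulrA om_om.
apply/integrableP; split.
  apply: pos_continuous_measurableE.
  by apply: pos_continuousM; [exact: om_continuous|exact: ww_continuous].
apply: le_lt_trans (ltry (2 * mu + 1 + 1)^-1).
have wMge := wM_ge.
apply: le_trans (power_weight_integralS (b := 2 * mu + 1) (M := wM) _ _); [|lra|lra].
apply: eqW.
apply: eq_integral => x /set_mem; rewrite half_lineE => x0.
by rewrite /= E // ger0_norm // mulr_ge0 ?powR_ge0 // invr_ge0 exprn_ge0 //; lra.
Qed.

End test_weight.

(* Proves [0 <= e] by following the syntax of [e], so that no definition gets
   unfolded. *)
Ltac nonneg := repeat match goal with
  | |- is_true (0 <= _ * _)%R => apply: mulr_ge0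
  | |- is_true (0 <= _^-1)%R => rewrite invr_ge0
  | |- is_true (0 <= _ ^+ _)%R => apply: exprn_ge0
  | |- is_true (0 <= om _ _)%R => exact: om_ge0
  | |- is_true (0 <= wt _ _)%R => exact: powR_ge0
  | |- is_true (0 <= bi _ _ _)%R => apply: ltW; apply: bi_gt0; assumption
  | |- is_true (0 <= bi' _ _ _)%R => apply: ltW; apply: bi'_gt0; assumption
  | |- is_true (0 <= bk _ _ _)%R => apply: bk_ge0; assumption
  | |- is_true (0 <= _)%R => first [assumption | apply: ltW; assumption]
  end.

(** * The Green kernel *)

Section green_kernel.
Context {R : realType}.
Local Notation leb := (@lebesgue_measure R).
Variables (mu lam : R).
Hypotheses (hmu : - 2^-1 < mu) (lam0 : 0 < lam).
Local Notation om := (om mu).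
Local Notation ww := (ww mu).
Local Notation wt := (wt mu).
Local Notation bi := (bi mu lam).
Local Notation bk := (bk mu lam).
Local Notation bi' := (bi' mu lam).
Local Notation bk' := (bk' mu lam).

(** The kernel of the inverse of [lam - S], for the Bessel operator [S]. No
    further factor occurs because the Wronskian of [bi] and [bk] is [1 / wt]. *)
Definition green (x y : R) : R :=
  om x * om y * (bi (Num.min x y) * bk (Num.max x y)).

Lemma green_sym x y : green x y = green y x.
Proof. by rewrite /green minC maxC (mulrC (om x)). Qed.

Lemma green_ge0 x y : 0 < x -> 0 < y -> 0 <= green x y.
Proof.
move=> x0 y0; rewrite /green; nonneg.
by apply: bk_ge0 => //; rewrite lt_max x0.
Qed.

Lemma green_le_l x y : y <= x -> green x y = om x * bk x * (om y * bi y).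
Proof. by move=> yx; rewrite /green min_r // max_l //; ring. Qed.

Lemma green_le_r x y : x <= y -> green x y = om x * bi x * (om y * bk y).
Proof. by move=> xy; rewrite /green min_l // max_r //; ring. Qed.

Lemma green_le x y : 0 < x -> 0 < y -> green x y <= om x * bi x * bk x * om y.
Proof.
move=> x0 y0; have [yx|/ltW xy] := leP y x.
  rewrite green_le_l // (_ : _ * om y = om x * bk x * (om y * bi x)); last by ring.
  apply: ler_wpM2l; first by nonneg.
  by apply: ler_wpM2l; [exact: om_ge0|exact: bi_incr].
rewrite green_le_r // (_ : _ * om y = om x * bi x * (om y * bk x)); last by ring.
apply: ler_wpM2l; first by nonneg.
by apply: ler_wpM2l; [exact: om_ge0|exact: bk_decr].
Qed.

(** The series of [bi'] has positive coefficients, so that [bi'] outgrows every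
    power; [bk] is bounded by the inverse of the flux of [bi]. *)
Lemma green_decay x : 0 < x ->
  exists C, forall y, 0 < y -> green x y <= C * ww y.
Proof.
move=> x0; have [M EM] : exists M, M = wM mu by eexists.
have x10 : 0 < 1 + x by lra.
pose q := x / (1 + x).
have q0 : 0 < q by rewrite divr_gt0.
have [c cE] : exists c, c = 2 * (M.+1%:R * bessel_coef mu lam M.+1) by eexists.
have c0 : 0 < c by rewrite cE; do 2 apply: mulr_gt0 => //; exact: bessel_coef_gt0.
pose C1 := om x * bi x * bk x * (1 + x) ^+ M.
pose C2 := om x * bi x * (wt x * c * q ^+ M.*2.+1)^-1.
have b0 z := ltW (bi_gt0 hmu lam0 z).
have C10 : 0 <= C1.
  by rewrite /C1; nonneg.
have C20 : 0 <= C2.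
  rewrite /C2; apply: mulr_ge0; first by nonneg.
  rewrite invr_ge0; apply: mulr_ge0; last by apply: exprn_ge0; exact: ltW q0.
  by apply: mulr_ge0; [exact: powR_ge0|exact: ltW c0].
exists (C1 + C2) => y y0.
have y10 : 0 < 1 + y by lra.
have [yx|/ltW xy] := leP y x.
  apply: le_trans (green_le x0 y0) _; rewrite mulrDl.
  apply: ler_wpDr; first by rewrite mulr_ge0 // ltW // ww_gt0.
  rewrite /C1 -!mulrA; do 3 (apply: ler_wpM2l; first by nonneg).
  rewrite /ww -EM mulrCA ler_peMr ?om_ge0 //.
  rewrite ler_pdivlMr ?exprn_gt0 // mul1r lerXn2r ?nnegrE ?(ltW x10) ?(ltW y10) //.
  by rewrite lerD2l.
rewrite green_le_r // mulrDl; apply: ler_wpDl; first by rewrite mulr_ge0 // ltW // ww_gt0.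
rewrite /C2 -!mulrA; do 2 (apply: ler_wpM2l; first by nonneg).
rewrite /ww -EM mulrCA; apply: ler_wpM2l; first exact: om_ge0.
apply: le_trans (bk_le hmu lam0 y0) _.
rewrite -invfM lef_pV2 ?posrE ?mulr_gt0 ?exprn_gt0 ?powR_gt0 ?bi'_gt0 //.
rewrite [leLHS](_ : _ = wt x * (c * (q ^+ M.*2.+1 * (1 + y) ^+ M))); last by ring.
apply: ler_pM; first exact: powR_ge0.
  apply: mulr_ge0; first exact: ltW.
  by apply: mulr_ge0; apply: exprn_ge0; exact: ltW.
  have hm := hmu.
  by apply: ge0_ler_powR; rewrite ?nnegrE ?(ltW x0) ?(ltW y0) //; lra.
apply: le_trans (bi'_ge hmu lam0 M y0); rewrite -cE.
apply: ler_wpM2l; first exact: ltW.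
apply: le_trans (_ : q ^+ M.*2.+1 * (1 + y) ^+ M.*2.+1 <= _).
  apply: ler_wpM2l; first by rewrite exprn_ge0 // ltW.
  rewrite ler_weXn2l //; first lra.
  by rewrite -addnn -addnS leq_addr.
have qy : q * (1 + y) <= y.
  by rewrite /q mulrAC ler_pdivrMr // !mulrDr !mulr1 (mulrC y x) lerD2r.
rewrite -exprMn; apply: lerXn2r => //; rewrite nnegrE; last exact: ltW.
by apply: mulr_ge0; exact: ltW.
Qed.

Lemma green_continuous x : 0 < x -> pos_continuous (green x).
Proof.
move=> x0; apply: pos_continuousM.
  by apply: pos_continuousM; [move=> ? _; exact: cvg_cst|exact: om_continuous].
apply: pos_continuousM => y y0.
  apply: (@continuous_comp _ _ _ (fun z => Num.min x z) bi).
    by apply: continuous_min; [exact: cvg_cst|exact: cvg_id].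
  by apply: (bi_continuous hmu lam0); rewrite lt_min x0.
apply: (@continuous_comp _ _ _ (fun z => Num.max x z) bk).
  by apply: continuous_max; [exact: cvg_cst|exact: cvg_id].
by apply: (bk_continuous hmu lam0); rewrite lt_max x0.
Qed.

(** Schur's condition, which reflects that [om] is annihilated by the Bessel
    operator. On either side of [x] the integrand is a multiple of the derivative
    of a flux, and the boundary terms at [x] add up to the Wronskian. *)
Lemma green_schur x : 0 < x ->
  (\int[leb]_(y in half_line) (green x y * om y)%:E <= (om x / lam)%:E)%E.
Proof.
move=> x0.
have b0 z := ltW (bi_gt0 hmu lam0 z).
have split : (half_line : set R) = `]0, x]%classic `|` `]x, +oo[%classic.
  by rewrite -itv_bndbnd_setU // bnd_simp ltW.
have mg : measurable_fun half_line (fun y => (green x y * om y)%:E).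
  apply: pos_continuous_measurableE; apply: pos_continuousM; last exact: om_continuous.
  exact: green_continuous.
rewrite [in leLHS]split ge0_integral_setU //; last 3 first.
- by move: mg; rewrite split.
- move=> y; rewrite -split half_lineE => y0.
  by rewrite lee_fin mulr_ge0 ?om_ge0 // green_ge0.
- apply/disj_setPS => y [] /=; rewrite !in_itv /= => /andP[_ yx] /andP[].
  by rewrite ltNge yx.
have Ew z : 0 < z -> om z * om z = wt z by exact: om_om.
have l : (\int[leb]_(y in `]0%R, x]) (green x y * om y)%:E <=
    (om x * bk x * (lam^-1 * (wt x * bi' x)))%:E)%E.
  pose F y := om x * bk x * (lam^-1 * (wt y * bi' y)).
  pose f y := om x * bk x * (lam^-1 * (lam * (wt y * bi y))).
  have c0 : 0 <= om x * bk x * lam^-1.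
    by nonneg.
  have -> : (\int[leb]_(y in `]0%R, x]) (green x y * om y)%:E =
      \int[leb]_(y in `]0%R, x]) (f y)%:E)%E.
    apply: eq_integral => y /set_mem /=; rewrite in_itv /= => /andP[y0 yx].
    rewrite green_le_l // /f mulKf ?gt_eqF // -Ew //; congr (_%:E); ring.
  apply: (@integral_left_le _ F).
  - move=> y y0; have d := bi_flux_derive hmu lam0 y0.
    by apply: is_derive_eq; rewrite /f /GRing.scale /=; ring.
  - do 2 (apply: pos_continuousM; first by move=> ? _; exact: cvg_cst).
    apply: pos_continuousM; first by move=> ? _; exact: cvg_cst.
    by apply: pos_continuousM; [exact: wt_continuous|exact: bi_continuous].
  - by [].
  - move=> y y0; rewrite /f; nonneg.
  - move=> y y0 yx; by rewrite lerBlDr lerDl /F; nonneg.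
have r : (\int[leb]_(y in `]x, +oo[) (green x y * om y)%:E <=
    (om x * bi x * (lam^-1 * - (wt x * bk' x)))%:E)%E.
  pose F y := om x * bi x * (lam^-1 * (wt y * bk' y)).
  pose f y := om x * bi x * (lam^-1 * (lam * (wt y * bk y))).
  have c0 : 0 <= om x * bi x * lam^-1.
    by nonneg.
  have cf : pos_continuous f.
    do 2 (apply: pos_continuousM; first by move=> ? _; exact: cvg_cst).
    apply: pos_continuousM; first by move=> ? _; exact: cvg_cst.
    by apply: pos_continuousM; [exact: wt_continuous|exact: bk_continuous].
  have -> : (\int[leb]_(y in `]x, +oo[) (green x y * om y)%:E =
      \int[leb]_(y in `[x, +oo[) (f y)%:E)%E.
    rewrite -integral_itv_obnd_cbnd; last first.
      apply/measurable_EFinP; apply: pos_continuous_measurable => //.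
      by move=> y /=; rewrite half_lineE in_itv /= andbT; exact: lt_trans.
    apply: eq_integral => y /set_mem /=; rewrite in_itv /= andbT => xy.
    have y0 : 0 < y by exact: lt_trans xy.
    rewrite green_le_r 1?ltW // /f mulKf ?gt_eqF // -Ew //; congr (_%:E); ring.
  apply: (@integral_right_le _ F).
  - move=> y y0; have d := bk_flux_derive hmu lam0 y0.
    by apply: is_derive_eq; rewrite /f /GRing.scale /=; ring.
  - exact: cf.
  - by [].
  - move=> y y0; rewrite /f; nonneg.
  - move=> y xy; have y0 : 0 < y by exact: lt_le_trans xy.
    have Fy0 : F y <= 0.
      apply: mulr_ge0_le0; first by nonneg.
      apply: mulr_ge0_le0; first by nonneg.
      apply: mulr_ge0_le0; first by nonneg.
      exact: bk'_le0.
    have -> : om x * bi x * (lam^-1 * - (wt x * bk' x)) = - F x by rewrite /F; ring.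
    lra.
apply: le_trans (leeD l r) _; rewrite -EFinD lee_fin.
apply: eqW.
rewrite -[RHS]mulr1 -(wronskian hmu lam0 x0); ring.
Qed.

End green_kernel.

(** * The Green representation of a decaying function *)

Section green_representation.
Context {R : realType}.
Local Notation leb := (@lebesgue_measure R).
Variables (mu lam : R).
Hypotheses (hmu : - 2^-1 < mu) (lam0 : 0 < lam).
Local Notation om := (om mu).
Local Notation ww := (ww mu).
Local Notation wt := (wt mu).
Local Notation bi := (bi mu lam).
Local Notation bk := (bk mu lam).
Local Notation bi' := (bi' mu lam).
Local Notation bk' := (bk' mu lam).
Local Notation green := (green mu lam).

Definition fast_decay (u : R -> R) :=
  forall M : nat, exists K, forall x, 0 < x -> `|u x| <= K * (1 + x) ^- M.

Lemma fast_decay_bounded u : fast_decay u -> exists K, forall x, 0 < x -> `|u x| <= K.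
Proof.
by move=> /(_ 0%N)[K uK]; exists K => x /uK; rewrite expr0 invr1 mulr1.
Qed.

Variables (Phi Phi1 Phi2 : R -> R).
Hypotheses (dPhi : has_derivative Phi Phi1) (dPhi1 : has_derivative Phi1 Phi2).
Hypothesis cPhi2 : pos_continuous Phi2.
Hypotheses (fPhi : fast_decay Phi) (fPhi1 : fast_decay Phi1).
Let u (y : R) := lam * Phi y - (Phi2 y + (2 * mu + 1) * (Phi1 y / y)).
Hypothesis fu : fast_decay u.

Let cPhi := has_derivative_continuous dPhi.
Let cPhi1 := has_derivative_continuous dPhi1.

Let cu : pos_continuous u.
Proof.
move=> y y0; apply: cvgB; first by apply: cvgM; [exact: cvg_cst|exact: cPhi].
apply: cvgD; first exact: cPhi2.
apply: cvgM; first exact: cvg_cst.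
apply: cvgM; first exact: cPhi1.
by apply: cvgV; [rewrite gt_eqF|exact: cvg_id].
Qed.

Let V1 y := (wt y * bi' y) * Phi y - (wt y * Phi1 y) * bi y.
Let V2 y := (wt y * bk' y) * Phi y - (wt y * Phi1 y) * bk y.

Let wPhi1_derive : has_derivative (fun y => wt y * Phi1 y)
  (fun y => wt y * (Phi2 y + (2 * mu + 1) * (Phi1 y / y))).
Proof.
move=> y y0; have d1 := wt_derive mu y0; have d2 := dPhi1 y0.
apply: (is_derive_eq (is_deriveM d1 d2)); rewrite /GRing.scale /=.
by field; rewrite gt_eqF.
Qed.

Let V1_derive : has_derivative V1 (fun y => wt y * bi y * u y).
Proof.
move=> y y0.
have d1 := bi_flux_derive hmu lam0 y0; have d2 := dPhi y0.
have d3 := wPhi1_derive y0; have d4 := bi_derive hmu lam0 y0.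
have d := is_deriveB (is_deriveM d1 d2) (is_deriveM d3 d4).
by apply: (is_derive_eq d); rewrite /u /GRing.scale /=; ring.
Qed.

Let V2_derive : has_derivative V2 (fun y => wt y * bk y * u y).
Proof.
move=> y y0.
have d1 := bk_flux_derive hmu lam0 y0; have d2 := dPhi y0.
have d3 := wPhi1_derive y0; have d4 := bk_derive hmu lam0 y0.
have d := is_deriveB (is_deriveM d1 d2) (is_deriveM d3 d4).
by apply: (is_derive_eq d); rewrite /u /GRing.scale /=; ring.
Qed.

Let V1_0 : V1 y @[y --> 0^'+] --> 0.
Proof.
have hm := hmu.
have [K1 PK1] := fast_decay_bounded fPhi; have [K2 PK2] := fast_decay_bounded fPhi1.
have wt0 : wt y @[y --> 0^'+] --> (0 : R) by apply: powR_cvg0; lra.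
have bi0 : bi y @[y --> 0^'+] --> bI0 mu lam 0.
  apply: cvg_at_right_filter.
  have d := is_derive_comp_sqr (bI0_derive hmu lam0 (0 ^+ 2)).
  have c : {for 0, continuous (fun y : R => bI0 mu lam (y ^+ 2))}.
    by apply/differentiable_continuous/derivable1_diffP; case: d.
  have E : bI0 mu lam (0 ^+ 2) = bI0 mu lam 0 by rewrite expr0n.
  by rewrite -E; exact: c.
have bi'0 : bi' y @[y --> 0^'+] --> (0 : R).
  rewrite bi'E; apply: cvg_at_right_filter.
  have d := is_derive_comp_sqr (bI1_derive hmu lam0 (0 ^+ 2)).
  have c : {for 0, continuous (fun y : R => bI1 mu lam (y ^+ 2))}.
    by apply/differentiable_continuous/derivable1_diffP; case: d.
  have h : (2 * y * bI1 mu lam (y ^+ 2)) @[y --> (0 : R)] --> 2 * 0 * bI1 mu lam (0 ^+ 2).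
    by apply: cvgM; [apply: cvgM; [exact: cvg_cst|exact: cvg_id]|exact: c].
  by rewrite mulr0 mul0r in h.
have b : (wt y * (bi' y * K1 + K2 * bi y)) @[y --> 0^'+] --> (0 : R).
  rewrite -[X in _ --> X](mul0r (0 * K1 + K2 * bI0 mu lam 0)).
  apply: cvgM => //; apply: cvgD; apply: cvgM => //; exact: cvg_cst.
apply: norm_cvg0.
apply: (squeeze_cvgr _ (cvg_cst 0) b); near=> y.
have y0 : 0 < y by near: y; exact: nbhs_right_gt.
have w0 := ltW (wt_gt0 mu y0).
rewrite normr_ge0 /= /V1 -!mulrA -mulrBr normrM (ger0_norm w0).
apply: ler_wpM2l => //; apply: le_trans (ler_normB _ _) _; rewrite !normrM.
apply: lerD.
  rewrite ger0_norm ?(ltW (bi'_gt0 _ _ _)) //.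
  by apply: ler_wpM2l; [exact/ltW/bi'_gt0|exact: PK1].
rewrite (ger0_norm (ltW (bi_gt0 hmu lam0 y))).
by apply: ler_wpM2r; [exact/ltW/bi_gt0|exact: PK2].
Unshelve. all: by end_near. Qed.

Let V2_y : V2 y @[y --> +oo] --> 0.
Proof.
have hm := hmu.
pose n := wM mu.
have [K1 PK1] := fPhi 1; have [K2 PK2] := fPhi1 n.+1.
pose A := `|wt 1 * bk' 1|.
have b : ((A * K1 + K2 * bk 1) * (1 + y)^-1) @[y --> +oo] --> (0 : R).
  rewrite -[X in _ --> X](mulr0 (A * K1 + K2 * bk 1)).
  apply: cvgM; first exact: cvg_cst.
  have pos : \forall y \near +oo, (0 : R) < 1 + y.
    by near=> y; have y0 : 0 < y by []; rewrite addr_gt0.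
  exact: (proj2 (@gtr0_cvgV0 R R (pinfty_nbhs R) _ (fun y => 1 + y) pos) (cvg_addrl 1)).
apply: norm_cvg0.
apply: (squeeze_cvgr _ (cvg_cst 0) b); near=> y.
have y1 : 1 <= y by near: y; apply: nbhs_pinfty_ge; rewrite num_real.
have y0 : 0 < y by lra.
have y10 : 0 < 1 + y by lra.
rewrite normr_ge0 /= /V2; apply: le_trans (ler_normB _ _) _; rewrite mulrDl; apply: lerD.
  rewrite normrM -mulrA; apply: ler_pM => //; last by have := PK1 _ y0; rewrite expr1.
  have bn z : 0 < z -> `|wt z * bk' z| = - (wt z * bk' z).
    move=> z0; rewrite ler0_norm //; apply: mulr_ge0_le0; [by nonneg|exact: bk'_le0].
  rewrite /A !bn // lerN2.
  apply: (has_derivative_le (bk_flux_derive hmu lam0)) => // z z0.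
  by nonneg.
rewrite normrM [leRHS](_ : _ = K2 * (1 + y)^-1 * bk 1); last by ring.
apply: ler_pM => //; last by rewrite ger0_norm ?bk_ge0 // bk_decr.
rewrite normrM (ger0_norm (powR_ge0 _ _)).
apply: le_trans (ler_wpM2l (powR_ge0 _ _) (PK2 _ y0)) _.
have K20 : 0 <= K2.
  by have := le_trans (normr_ge0 _) (PK2 _ y0); rewrite pmulr_lge0 // invr_gt0 exprn_gt0.
rewrite mulrCA; apply: ler_wpM2l => //.
rewrite exprSr invfM mulrA ler_piMl ?invr_ge0 ?(ltW y10) //.
rewrite ler_pdivrMr ?exprn_gt0 // mul1r -powR_mulrn ?(ltW y10) //.
apply: (@le_trans _ _ ((1 + y) `^ (2 * mu + 1))).
  by apply: ge0_ler_powR; rewrite ?nnegrE; lra.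
by apply: ler_powR; [lra|have := wM_ge mu; rewrite -/n; lra].
Unshelve. all: by end_near. Qed.

(** By Lagrange's identity [(wt * (bi' * Phi - bi * Phi'))' = wt * bi * u], and
    the same for [bk], the integral over either side of [x] is a boundary term
    at [x]: those at 0 and at infinity vanish. The two terms at [x] add up by the
    Wronskian. *)
Lemma green_representation x : 0 < x ->
  leb.-integrable half_line (EFin \o (fun y => green x y * (om y * u y))) /\
  \int[leb]_(y in half_line) (green x y * (om y * u y)) = om x * Phi x.
Proof.
move=> x0; have mh := @measurable_half_line R.
have split : (half_line : set R) = `]0, x]%classic `|` `]x, +oo[%classic.
  by rewrite -itv_bndbnd_setU // bnd_simp ltW.
have cg : pos_continuous (green x) by exact: green_continuous.
have [K PK] := fu (wM mu).
pose C := om x * bi x * bk x * K.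
have I : leb.-integrable half_line (EFin \o (fun y => green x y * (om y * u y))).
  apply: (@le_integrable _ (measurableTypeR R) R leb _ mh _ (fun y => C%:E * (om y * ww y)%:E)%E).
  - apply: pos_continuous_measurableE; apply: pos_continuousM => //.
    by apply: pos_continuousM => //; exact: om_continuous.
  - move=> y; rewrite half_lineE => y0; rewrite -EFinM !abse_EFin lee_fin.
    apply: le_trans (ler_norm _).
    rewrite normrM (ger0_norm (green_ge0 hmu lam0 x0 y0)) normrM (ger0_norm (om_ge0 _ _)).
    rewrite (_ : C * (om y * ww y) = om x * bi x * bk x * om y * (om y * (K * (1 + y) ^- wM mu))); last by rewrite /C /ww; ring.
    apply: ler_pM => //; first exact: green_ge0.
    + by apply: mulr_ge0; [exact: om_ge0|].
    + exact: green_le.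
    + by apply: ler_wpM2l; [exact: om_ge0|exact: PK].
  - by apply: integrableZl => //; exact: om_ww_integrable.
split=> //.
have Il : leb.-integrable `]0, x] (EFin \o (fun y => green x y * (om y * u y))).
  by apply: integrableS I => // y yx; rewrite split; left.
have Ir : leb.-integrable `]x, +oo[ (EFin \o (fun y => green x y * (om y * u y))).
  by apply: integrableS I => // y yx; rewrite split; right.
rewrite [in LHS]split Rintegral_setU //; last 2 first.
- by rewrite -split.
- apply/disj_setPS => y [] /=; rewrite !in_itv /= => /andP[_ yx] /andP[].
  by rewrite ltNge yx.
have Ew z : 0 < z -> om z * om z = wt z by exact: om_om.
have dl : has_derivative (fun y => om x * bk x * V1 y) (fun y => om x * bk x * (wt y * bi y * u y)).
  by move=> y y0; have d := V1_derive y0; apply: is_derive_eq; rewrite /GRing.scale /= ?mul0r ?addr0.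
have dr : has_derivative (fun y => om x * bi x * V2 y) (fun y => om x * bi x * (wt y * bk y * u y)).
  by move=> y y0; have d := V2_derive y0; apply: is_derive_eq; rewrite /GRing.scale /= ?mul0r ?addr0.
have El : {in `]0, x]%classic, (fun y => green x y * (om y * u y)) =1
    (fun y => om x * bk x * (wt y * bi y * u y))}.
  move=> y /set_mem /=; rewrite in_itv /= => /andP[y0 yx].
  by rewrite green_le_l // -Ew //; ring.
have Er : {in `]x, +oo[%classic, (fun y => green x y * (om y * u y)) =1
    (fun y => om x * bi x * (wt y * bk y * u y))}.
  move=> y /set_mem /=; rewrite in_itv /= andbT => xy.
  have y0 : 0 < y by exact: lt_trans xy.
  by rewrite green_le_r 1?ltW // -Ew //; ring.
have l : \int[leb]_(y in `]0, x]) (green x y * (om y * u y)) = om x * bk x * V1 x.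
  transitivity (\int[leb]_(y in `]0, x]) (om x * bk x * (wt y * bi y * u y))).
    by apply: eq_Rintegral => y yx; exact: El.
  apply: (integral_left_eq dl) => //.
  - apply: pos_continuousM; first by move=> ? _; exact: cvg_cst.
    apply: pos_continuousM => //; apply: pos_continuousM; [exact: wt_continuous|exact: bi_continuous].
  - by apply: eq_integrable Il => // y yx /=; rewrite El.
  - rewrite -[X in _ --> X](mulr0 (om x * bk x)).
    by apply: cvgM; [exact: cvg_cst|exact: V1_0].
have r : \int[leb]_(y in `]x, +oo[) (green x y * (om y * u y)) = - (om x * bi x * V2 x).
  have cf : pos_continuous (fun y => om x * bi x * (wt y * bk y * u y)).
    apply: pos_continuousM; first by move=> ? _; exact: cvg_cst.
    apply: pos_continuousM => //; apply: pos_continuousM; [exact: wt_continuous|exact: bk_continuous].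
  have Ir' : leb.-integrable `]x, +oo[ (EFin \o (fun y => om x * bi x * (wt y * bk y * u y))).
    by apply: eq_integrable Ir => // y yx /=; rewrite Er.
  transitivity (\int[leb]_(y in `]x, +oo[) (om x * bi x * (wt y * bk y * u y))).
    by apply: eq_Rintegral => y yx; exact: Er.
  rewrite Rintegral_itv_obnd_cbnd //.
  apply: (integral_right_eq dr) => //.
  - apply/integrableP; split.
      apply/measurable_EFinP; apply: pos_continuous_measurable => //.
      by move=> y /=; rewrite half_lineE in_itv /= andbT; exact: lt_le_trans.
    rewrite -integral_itv_obnd_cbnd; first by have /integrableP[] := Ir'.
    by have /integrableP[? _] := Ir'; exact: measurableT_comp.
  - rewrite -[X in _ --> X](mulr0 (om x * bi x)).
    by apply: cvgM; [exact: cvg_cst|exact: V2_y].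
rewrite l r /V1 /V2 -[RHS]mulr1 -(wronskian hmu lam0 x0); ring.
Qed.

End green_representation.

(** * Double integrals over a square *)

Section square_integrals.
Context {R : realType}.
Local Notation leb := (@lebesgue_measure R).
Local Notation T := (measurableTypeR R).
Variable D : set T.
Hypothesis mD : measurable D.
Implicit Types h : T * T -> \bar R.

(** Product measures live on the whole plane, so that double integrals over a
    square are those of the extension by 0. *)
Let patch h := h \_ (D `*` D).

Let mDD : measurable (D `*` D).
Proof. exact: measurableX. Qed.

Let patchE1 h x : (\int[leb]_y patch h (x, y) =
  ((fun x => \int[leb]_(y in D) h (x, y)) \_ D) x)%E.
Proof.
rewrite [RHS]patchE; case: ifPn => xD.
  rewrite [RHS]integral_mkcond; apply: eq_integral => y _; rewrite /patch !patchE.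
  have [yD|yD] := boolP (y \in D).
    by rewrite mem_set //; split; exact: set_mem.
  by rewrite memNset // => -[_ /mem_set /= yD']; rewrite yD' in yD.
transitivity (0%E : \bar R); last by [].
apply: integral0_eq => y _; rewrite /patch patchE memNset //.
by move=> [/mem_set /= xD' _]; rewrite xD' in xD.
Qed.

Let patchE2 h y : (\int[leb]_x patch h (x, y) =
  ((fun y => \int[leb]_(x in D) h (x, y)) \_ D) y)%E.
Proof.
rewrite [RHS]patchE; case: ifPn => yD.
  rewrite [RHS]integral_mkcond; apply: eq_integral => x _; rewrite /patch !patchE.
  have [xD|xD] := boolP (x \in D).
    by rewrite mem_set //; split; exact: set_mem.
  by rewrite memNset // => -[/mem_set /= xD' _]; rewrite xD' in xD.
transitivity (0%E : \bar R); last by [].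
apply: integral0_eq => x _; rewrite /patch patchE memNset //.
by move=> [_ /mem_set /= yD']; rewrite yD' in yD.
Qed.

Let patch_measurable h : measurable_fun (D `*` D) h -> measurable_fun [set: T * T] (patch h).
Proof. by move=> mh; apply/(measurable_restrictT h). Qed.

Let patch_ge0 h : (forall x y, D x -> D y -> (0 <= h (x, y))%E) ->
  forall p, (0 <= patch h p)%E.
Proof.
move=> h0 [x y]; rewrite /patch patchE; case: ifPn => // /set_mem [/= Dx Dy].
exact: h0.
Qed.

Lemma square_integral_measurable h : measurable_fun (D `*` D) h ->
  (forall x y, D x -> D y -> (0 <= h (x, y))%E) ->
  measurable_fun D (fun x => \int[leb]_(y in D) h (x, y))%E.
Proof.
move=> mh h0; apply/(measurable_restrictT _ mD).
rewrite [X in measurable_fun _ X](_ : _ = fun x => (\int[leb]_y patch h (x, y))%E).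
  apply: (measurable_fun_fubini_tonelli_F (patch h)).
    exact: patch_measurable.
  exact: patch_ge0.
by apply/funext => x; rewrite patchE1.
Qed.

Lemma square_tonelli h : measurable_fun (D `*` D) h ->
  (forall x y, D x -> D y -> (0 <= h (x, y))%E) ->
  (\int[leb]_(x in D) \int[leb]_(y in D) h (x, y) =
   \int[leb]_(y in D) \int[leb]_(x in D) h (x, y))%E.
Proof.
move=> mh h0; rewrite [LHS]integral_mkcond [RHS]integral_mkcond.
under eq_integral do rewrite -patchE1.
under [RHS]eq_integral do rewrite -patchE2.
apply: (fubini_tonelli (patch h)); [exact: patch_measurable|exact: patch_ge0].
Qed.

Lemma square_fubini h : measurable_fun (D `*` D) h ->
  (\int[leb]_(x in D) \int[leb]_(y in D) `|h (x, y)| < +oo)%E ->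
  (\int[leb]_(x in D) \int[leb]_(y in D) h (x, y) =
   \int[leb]_(y in D) \int[leb]_(x in D) h (x, y))%E.
Proof.
move=> mh h0; rewrite [LHS]integral_mkcond [RHS]integral_mkcond.
under eq_integral do rewrite -patchE1.
under [RHS]eq_integral do rewrite -patchE2.
apply: Fubini; apply/integrable12ltyP; first exact: patch_measurable.
apply: le_lt_trans h0; rewrite [leRHS]integral_mkcond.
apply: eqW; apply: eq_integral => x _.
rewrite -(patchE1 (fun p => `|h p|%E)); apply: eq_integral => y _.
by rewrite /patch !patchE; case: ifP => // _; rewrite abse0.
Qed.

Lemma square_Rintegral_measurable (h : T * T -> R) : measurable_fun (D `*` D) h ->
  measurable_fun D (fun x => \int[leb]_(y in D) h (x, y)).
Proof.
move=> mh; rewrite /Rintegral; apply: (measurableT_comp (fine_measurable measurableT)).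
have mE : measurable_fun (D `*` D) (EFin \o h) by exact/measurable_EFinP.
rewrite (_ : (fun x => _) = (fun x => \int[leb]_(y in D) (EFin \o h)^\+ (x, y) -
    \int[leb]_(y in D) (EFin \o h)^\- (x, y))%E).
  apply: emeasurable_funB; apply: square_integral_measurable => //.
  - exact: measurable_funepos.
  - exact: measurable_funeneg.
by apply/funext => x; rewrite [LHS]integralE; congr (_ - _)%E; apply: eq_integral => y _; rewrite ?funeposE ?funenegE.
Qed.

End square_integrals.

(** * The resolvent as an integral operator *)

Section resolvent.
Context {R : realType}.
Local Notation leb := (@lebesgue_measure R).
Local Notation T := (measurableTypeR R).
Local Notation D := (half_line : set T).
Variables (mu lam : R).
Hypotheses (hmu : - 2^-1 < mu) (lam0 : 0 < lam).
Local Notation om := (om mu).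
Local Notation ww := (ww mu).
Local Notation green := (green mu lam).
Implicit Types g psi : R -> R.

Let mD : measurable D := @measurable_half_line R.

(** The real functions that can be paired with every test function. *)
Definition weighted_L1 g := measurable_fun D g /\
  leb.-integrable D (EFin \o (fun y => g y * ww y)).

Lemma weighted_L1_norm g : weighted_L1 g -> weighted_L1 (fun y => `|g y|).
Proof.
move=> [mg Ig]; split; first exact: measurableT_comp.
apply: eq_integrable (integrable_norm Ig) => // y /set_mem; rewrite half_lineE => y0.
by rewrite /= normrM (ger0_norm (ltW (ww_gt0 _ y0))).
Qed.

Lemma weighted_integrable g psi (K : R) : weighted_L1 g -> measurable_fun D psi ->
  (forall y, 0 < y -> `|psi y| <= K * ww y) ->
  leb.-integrable D (EFin \o (fun y => g y * psi y)).
Proof.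
move=> [mg Ig] mpsi psiK.
apply: (@le_integrable _ T R leb _ mD _ (fun y => K%:E * (g y * ww y)%:E)%E).
- by apply/measurable_EFinP; exact: measurable_funM.
- move=> y; rewrite half_lineE => y0; rewrite -EFinM !abse_EFin lee_fin.
  rewrite [in leRHS]mulrCA normrM [leRHS]normrM; apply: ler_wpM2l => //.
  exact: le_trans (psiK _ y0) (ler_norm _).
- exact: integrableZl.
Qed.

Lemma green_measurable2 : measurable_fun (D `*` D) (fun p : T * T => green p.1 p.2).
Proof.
have mDD : measurable (D `*` D) by exact: measurableX.
have m1 : measurable_fun (D `*` D) (fst : T * T -> T).
  exact: measurable_funS (measurable_fst).
have m2 : measurable_fun (D `*` D) (snd : T * T -> T).
  exact: measurable_funS (measurable_snd).
have mo : measurable_fun [set: T] om by exact: measurable_powR.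
apply: measurable_funM.
  by apply: measurable_funM; exact: measurableT_comp.
apply: measurable_funM.
  apply: (@measurable_comp _ _ _ _ _ _ D _ _ (fun p : T * T => Num.min p.1 p.2)) => //.
  - by move=> _ [[x y] [/= + + <-]]; rewrite !half_lineE lt_min => -> ->.
  - by apply: pos_continuous_measurable => //; exact: bi_continuous.
  - exact: measurable_minr.
apply: (@measurable_comp _ _ _ _ _ _ D _ _ (fun p : T * T => Num.max p.1 p.2)) => //.
- by move=> _ [[x y] [/= + + <-]]; rewrite !half_lineE lt_max => ->.
- by apply: pos_continuous_measurable => //; exact: bk_continuous.
- exact: measurable_maxr.
Qed.

Lemma green_integrable x g : 0 < x -> weighted_L1 g ->
  leb.-integrable D (EFin \o (fun y => green x y * g y)).
Proof.
move=> x0 wg; have [C gC] := green_decay hmu lam0 x0.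
have mg : measurable_fun D (green x).
  by apply: pos_continuous_measurable => //; exact: green_continuous.
have : leb.-integrable D (EFin \o (fun y => g y * green x y)).
  apply: (weighted_integrable (K := C) wg mg) => y y0.
  by rewrite ger0_norm ?gC // green_ge0.
by apply: eq_integrable => // y _ /=; rewrite mulrC.
Qed.

Definition resolvent g (x : R) : R := \int[leb]_(y in D) (green x y * g y).

Lemma resolvent_measurable g : measurable_fun D g -> measurable_fun D (resolvent g).
Proof.
move=> mg; apply: (@square_Rintegral_measurable _ D mD
  (fun p : T * T => green p.1 p.2 * g p.2)).
apply: measurable_funM; first exact: green_measurable2.
apply: (@measurable_comp _ _ _ _ _ _ D) => //.
  by move=> _ [[x y] [_ /= yD] <-].
apply: measurable_funS measurable_snd => //.
Qed.

Lemma resolvent_EFin x g : 0 < x -> weighted_L1 g ->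
  ((resolvent g x)%:E = \int[leb]_(y in D) (green x y * g y)%:E)%E.
Proof.
move=> x0 wg; rewrite /resolvent /Rintegral fineK //.
by apply: integrable_fin_num => //; exact: green_integrable.
Qed.

Section weak_equation.
Variables (Phi Phi1 Phi2 g : R -> R).
Hypotheses (dPhi : has_derivative Phi Phi1) (dPhi1 : has_derivative Phi1 Phi2).
Hypothesis cPhi2 : pos_continuous Phi2.
Hypotheses (fPhi : fast_decay Phi) (fPhi1 : fast_decay Phi1).
Let u (y : R) := lam * Phi y - (Phi2 y + (2 * mu + 1) * (Phi1 y / y)).
Hypothesis fu : fast_decay u.
Hypotheses (wg : weighted_L1 g) (wBg : weighted_L1 (resolvent (fun y => `|g y|))).

(** After the exchange of the two integrations, the inner integral is the Green
    representation of the test function [om * Phi], because the kernel is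
    symmetric. Absolute convergence is the last hypothesis. *)
Lemma resolvent_weak :
  \int[leb]_(x in D) (resolvent g x * (om x * u x)) =
  \int[leb]_(y in D) (g y * (om y * Phi y)).
Proof.
have [K uK] := fu (wM mu).
have cu : pos_continuous u.
  have cPhi := has_derivative_continuous dPhi.
  have cPhi1 := has_derivative_continuous dPhi1.
  move=> y y0; apply: cvgB; first by apply: cvgM; [exact: cvg_cst|exact: cPhi].
  apply: cvgD; first exact: cPhi2.
  apply: cvgM; first exact: cvg_cst.
  apply: cvgM; first exact: cPhi1.
  by apply: cvgV; [rewrite gt_eqF|exact: cvg_id].
pose psi x := om x * u x.
have cpsi : pos_continuous psi by apply: pos_continuousM => //; exact: om_continuous.
have mpsi : measurable_fun D psi by exact: pos_continuous_measurable.
have psiK x : 0 < x -> `|psi x| <= K * ww x.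
  move=> x0; rewrite /psi normrM (ger0_norm (om_ge0 _ _)) /ww mulrCA.
  by apply: ler_wpM2l; [exact: om_ge0|exact: uK].
pose h (p : T * T) := ((green p.1 p.2 * g p.2) * psi p.1)%:E.
have mh : measurable_fun (D `*` D) h.
  apply/measurable_EFinP; apply: measurable_funM.
    apply: measurable_funM; first exact: green_measurable2.
    apply: (@measurable_comp _ _ _ _ _ _ D) => //; last 2 first.
    - by have [] := wg.
    - by apply: measurable_funS measurable_snd => //.
    - by move=> _ [[x y] [_ /= yD] <-].
  apply: (@measurable_comp _ _ _ _ _ _ D) => //; last first.
  - by apply: measurable_funS measurable_fst => //.
  - by move=> _ [[x y] [/= xD _] <-].
rewrite /Rintegral; congr fine.
have hfin : (\int[leb]_(x in D) \int[leb]_(y in D) `|h (x, y)| < +oo)%E.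
  have Ig := weighted_integrable wBg mpsi psiK.
  have /integrableP[_] := Ig; apply: le_lt_trans.
  apply: eqW.
  apply: eq_integral => x /set_mem; rewrite half_lineE => x0.
  have wag := weighted_L1_norm wg.
  rewrite /= normrM EFinM ger0_norm; last first.
    apply: Rintegral_ge0 => y; rewrite half_lineE => y0.
    by rewrite mulr_ge0 // green_ge0.
  rewrite resolvent_EFin // muleC -integralZl //; last exact: green_integrable.
  apply: eq_integral => y /set_mem; rewrite half_lineE => y0.
  by rewrite /h /= normrM normrM (ger0_norm (green_ge0 hmu lam0 x0 y0)) mulrC EFinM.
transitivity (\int[leb]_(x in D) \int[leb]_(y in D) h (x, y))%E.
  apply: eq_integral => x /set_mem; rewrite half_lineE => x0.
  rewrite EFinM resolvent_EFin // muleC -integralZl //; last exact: green_integrable.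
  by apply: eq_integral => y _; rewrite /h /= -EFinM mulrC.
rewrite square_fubini //; apply: eq_integral => y /set_mem; rewrite half_lineE => y0.
have [I E] := green_representation hmu lam0 dPhi dPhi1 cPhi2 fPhi fPhi1 fu y0.
transitivity ((g y)%:E * \int[leb]_(x in D) (green y x * psi x)%:E)%E.
  rewrite -integralZl //; apply: eq_integral => x _.
  by rewrite /h /= green_sym -EFinM; congr (_%:E); ring.
rewrite EFinM; congr (_ * _)%E; rewrite -E /Rintegral fineK //.
exact: integrable_fin_num.
Qed.

End weak_equation.
End resolvent.

(** * Smooth functions on the half-line *)

Section smooth_functions.
Context {R : realType}.
Implicit Types f g : R -> R.

Definition smooth f := forall (n : nat) (x : R), 0 < x -> derivable (derive1n n f) x 1.

(** A recursive form of differentiability up to order [n], which is the one that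
    inductive closure proofs need. *)
Fixpoint smooth_upto (n : nat) f : Prop :=
  if n is m.+1 then (forall x, 0 < x -> derivable f x 1) /\ smooth_upto m (derive1 f)
  else True.

Lemma smoothP f : smooth f <-> forall n, smooth_upto n f.
Proof.
split=> [+ n|].
  elim: n f => [|n IH] f sf //=; split; first exact: (sf 0%N).
  by apply: IH => m x x0; rewrite -derive1Sn; exact: sf.
move=> sf n; elim: n f sf => [|n IH] f sf x x0.
  by rewrite derive1n0; have [df _] := sf 1%N; exact: df.
by rewrite derive1Sn; apply: IH => // m; have [] := sf m.+1.
Qed.

Lemma smooth_derive1 f : smooth f -> smooth (derive1 f).
Proof. by move=> sf n x x0; rewrite -derive1Sn; exact: sf. Qed.

Lemma smooth_has_derivative f : smooth f -> has_derivative f (derive1 f).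
Proof.
move=> sf x x0; apply: DeriveDef; last by rewrite derive1E.
exact: (sf 0%N).
Qed.

Lemma smooth_continuous f : smooth f -> pos_continuous f.
Proof. by move/smooth_has_derivative/has_derivative_continuous. Qed.

Lemma pos_near (x : R) (P : R -> Prop) : 0 < x -> (forall y, 0 < y -> P y) ->
  \forall y \near x, P y.
Proof.
move=> x0 PP; near=> y; apply: PP; near: y; exact: lt_nbhsr.
Unshelve. all: by end_near. Qed.

Lemma has_derivativeE f f' x : has_derivative f f' -> 0 < x -> derive1 f x = f' x.
Proof. by move=> df x0; rewrite derive1E; have [_ ->] := df x x0. Qed.

Lemma eq_derive1 f g : (forall x, 0 < x -> f x = g x) ->
  forall x, 0 < x -> derive1 f x = derive1 g x.
Proof.
move=> fg x x0; rewrite !derive1E; apply: near_eq_derive.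
exact: pos_near x0 fg.
Qed.

Lemma eq_smooth_upto n f g : (forall x, 0 < x -> f x = g x) ->
  smooth_upto n f -> smooth_upto n g.
Proof.
elim: n f g => [|n IH] f g fg //= [df sf]; split.
  move=> x x0; apply: near_eq_derivable (df x x0); exact: pos_near x0 fg.
exact: IH (eq_derive1 fg) sf.
Qed.

Lemma smooth_upto_le n f : smooth_upto n.+1 f -> smooth_upto n f.
Proof. by elim: n f => [|n IH] f //= [df sf]; split=> //; exact: IH. Qed.

Lemma smooth_uptoD n f g : smooth_upto n f -> smooth_upto n g ->
  smooth_upto n (fun x => f x + g x).
Proof.
elim: n f g => [|n IH] f g //= [df sf] [dg sg]; split.
  by move=> x x0; apply: derivableD; [exact: df|exact: dg].
apply: eq_smooth_upto (IH _ _ sf sg) => x x0.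
by rewrite !derive1E (deriveD (df x x0) (dg x x0)).
Qed.

Lemma smooth_uptoM n f g : smooth_upto n f -> smooth_upto n g ->
  smooth_upto n (fun x => f x * g x).
Proof.
elim: n f g => [|n IH] f g //= [df sf] [dg sg]; split.
  by move=> x x0; apply: derivableM; [exact: df|exact: dg].
have sf' : smooth_upto n f by exact: smooth_upto_le (conj df sf).
have sg' : smooth_upto n g by exact: smooth_upto_le (conj dg sg).
apply: eq_smooth_upto (smooth_uptoD (IH _ _ sf' sg) (IH _ _ sg' sf)) => x x0.
by rewrite !derive1E (deriveM (df x x0) (dg x x0)).
Qed.

Lemma smooth_upto_cst n (c : R) : smooth_upto n (fun=> c).
Proof.
elim: n c => [|n IH] c //=; split=> //.
by apply: eq_smooth_upto (IH 0) => x _; rewrite derive1_cst.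
Qed.

Lemma smooth_upto_powR n (a : R) : smooth_upto n (fun x => x `^ a).
Proof.
elim: n a => [|n IH] a //=; split.
  by move=> x x0; apply: derivable_powR; rewrite in_itv /= x0.
apply: eq_smooth_upto (smooth_uptoM (smooth_upto_cst n a) (IH (a - 1))) => x x0.
by rewrite powR_derive1 // in_itv /= x0.
Qed.

Lemma smoothM f g : smooth f -> smooth g -> smooth (fun x => f x * g x).
Proof. by move=> /smoothP sf /smoothP sg; apply/smoothP => n; exact: smooth_uptoM. Qed.

Lemma smoothD f g : smooth f -> smooth g -> smooth (fun x => f x + g x).
Proof. by move=> /smoothP sf /smoothP sg; apply/smoothP => n; exact: smooth_uptoD. Qed.

Lemma smooth_cst (c : R) : smooth (fun=> c).
Proof. by apply/smoothP => n; exact: smooth_upto_cst. Qed.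

Lemma smooth_powR (a : R) : smooth (fun x => x `^ a).
Proof. by apply/smoothP => n; exact: smooth_upto_powR. Qed.

Lemma eq_smooth f g : (forall x, 0 < x -> f x = g x) -> smooth f -> smooth g.
Proof. by move=> fg /smoothP sf; apply/smoothP => n; exact: eq_smooth_upto (sf n). Qed.

Lemma smooth_inv : smooth (fun x : R => x^-1).
Proof.
have E (x : R) : 0 < x -> x `^ (-1) = x^-1 by move=> /ltW x0; rewrite powR_inv1.
exact: (eq_smooth E (@smooth_powR (-1))).
Qed.

Lemma smooth_id : smooth (fun x : R => x).
Proof.
have E (x : R) : 0 < x -> x `^ 1 = x by move=> /ltW x0; rewrite powRr1.
exact: (eq_smooth E (@smooth_powR 1)).
Qed.

Lemma gauss_derive (t : R) : has_derivative (fun x => expR (- t * x ^+ 2))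
  (fun x => (- (2 * t)) * x * expR (- t * x ^+ 2)).
Proof.
move=> x _.
have d1 : is_derive x 1 (fun y : R => - t * y ^+ 2) (- t * (2 * x)).
  have d := is_derive_sqr x.
  by apply: is_derive_eq; rewrite /GRing.scale /= ?mul0r ?addr0.
have d2 := @is_derive1_comp _ expR (fun y : R => - t * y ^+ 2) x _ _ (is_derive_expR _) d1.
by apply: (is_derive_eq d2); ring.
Qed.

Lemma smooth_gauss (t : R) : smooth (fun x : R => expR (- t * x ^+ 2)).
Proof.
apply/smoothP; elim=> [|n IH] //=; split.
  by move=> x x0; have [] := gauss_derive t x0.
have /smoothP si := smooth_id.
apply: eq_smooth_upto (smooth_uptoM (smooth_uptoM (smooth_upto_cst n (- (2 * t))) (si n)) IH).
by move=> x x0; rewrite (has_derivativeE (gauss_derive t) x0).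
Qed.

End smooth_functions.

(** * Real test functions and the Bessel operator *)

Section real_test_functions.
Context {R : realType}.
Implicit Types f g phi : R -> R.
Variable mu : R.
Local Notation om := (om mu).

(** The operator [T = x ^ -1 * d/dx] of the seminorms of the test space. *)
Definition rxD f : R -> R := fun x => x^-1 * derive1 f x.

Lemma eq_iter_rxD k f g : (forall x, 0 < x -> f x = g x) ->
  forall x, 0 < x -> iter k rxD f x = iter k rxD g x.
Proof.
move=> fg; elim: k => [|k IH] //= x x0.
by rewrite /rxD (eq_derive1 IH x0).
Qed.

Lemma smooth_iter_rxD k f : smooth f -> smooth (iter k rxD f).
Proof.
move=> sf; elim: k => [//|k IH]; rewrite iterS.
by apply: smoothM; [exact: smooth_inv|exact: smooth_derive1].
Qed.

Definition unweight phi : R -> R := fun y => r_ mu y * phi y.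

Lemma unweightE phi x : 0 < x -> om x * unweight phi x = phi x.
Proof.
by move=> x0; rewrite mulrA (mulrC (om x)) (r_om mu x0) mul1r.
Qed.

Lemma unweight_om f x : 0 < x -> unweight (fun y => om y * f y) x = f x.
Proof. by move=> x0; rewrite /unweight mulrA (r_om mu x0) mul1r. Qed.

Definition real_test phi := smooth phi /\
  forall m k : nat, exists K, forall x, 0 < x ->
    `|x ^+ m * iter k rxD (unweight phi) x| <= K.

Lemma smooth_unweight phi : smooth phi -> smooth (unweight phi).
Proof. by move=> sphi; apply: smoothM; [exact: smooth_powR|exact: sphi]. Qed.

Lemma fast_decayP f : fast_decay f <-> forall m : nat, exists K, forall x, 0 < x -> `|x ^+ m * f x| <= K.
Proof.
split=> [ff m|ff M].
  have [K fK] := ff m; exists K => x x0.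
  have x10 : 0 < 1 + x by lra.
  rewrite normrM (ger0_norm (exprn_ge0 m (ltW x0))).
  apply: le_trans (_ : (1 + x) ^+ m * `|f x| <= _).
    apply: ler_wpM2r => //; apply: lerXn2r; rewrite ?nnegrE ?(ltW x0) ?(ltW x10) //.
    lra.
  by rewrite mulrC -ler_pdivlMr ?exprn_gt0 // fK.
have [K0 f0] := ff 0%N; have [KM fM] := ff M.
exists (2 ^+ M * (K0 + KM)) => x x0; have x10 : 0 < 1 + x by lra.
have := f0 x x0; have := fM x x0; rewrite !normrM expr0 normr1 mul1r => h1 h0.
rewrite (ger0_norm (exprn_ge0 _ (ltW x0))) in h1.
rewrite ler_pdivlMr ?exprn_gt0 //.
have h2 : 0 <= `|f x| := normr_ge0 _.
have xM0 := exprn_ge0 M (ltW x0).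
have p0 : (0 : R) <= 2 ^+ M by apply: exprn_ge0.
have [x1|x1] := leP x 1.
  apply: le_trans (_ : `|f x| * 2 ^+ M <= _).
    by apply: ler_wpM2l => //; apply: lerXn2r; rewrite ?nnegrE ?(ltW x10) //; lra.
  by rewrite mulrC; apply: ler_wpM2l => //; have := mulr_ge0 xM0 h2; lra.
apply: le_trans (_ : `|f x| * (2 * x) ^+ M <= _).
  apply: ler_wpM2l => //; apply: lerXn2r; rewrite ?nnegrE ?(ltW x10) //; last lra.
  by rewrite mulr_ge0 // ltW.
by rewrite exprMn mulrCA; apply: ler_wpM2l => //; rewrite mulrC; lra.
Qed.

Lemma fast_decayD f g : fast_decay f -> fast_decay g -> fast_decay (fun x => f x + g x).
Proof.
move=> ff fg M; have [Kf fK] := ff M; have [Kg gK] := fg M.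
exists (Kf + Kg) => x x0; apply: le_trans (ler_normD _ _) _.
by rewrite mulrDl; apply: lerD; [exact: fK|exact: gK].
Qed.

Lemma fast_decayZ (c : R) f : fast_decay f -> fast_decay (fun x => c * f x).
Proof.
move=> ff M; have [K fK] := ff M; exists (`|c| * K) => x x0.
by rewrite normrM -mulrA; apply: ler_wpM2l => //; exact: fK.
Qed.

Lemma fast_decayX f : fast_decay f -> fast_decay (fun x => x * f x).
Proof.
move=> /fast_decayP ff; apply/fast_decayP => m; have [K fK] := ff m.+1.
by exists K => x x0; rewrite mulrA -exprSr; exact: fK.
Qed.

Lemma eq_fast_decay f g : (forall x, 0 < x -> f x = g x) -> fast_decay f -> fast_decay g.
Proof. by move=> fg ff M; have [K fK] := ff M; exists K => x x0; rewrite -fg // fK. Qed.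

Lemma real_test_decay phi k : real_test phi -> fast_decay (iter k rxD (unweight phi)).
Proof. by move=> [_ phiB]; apply/fast_decayP => m; exact: phiB. Qed.

Definition rbessel phi : R -> R := fun x =>
  derive1 (derive1 phi) x - (4 * mu ^+ 2 - 1) / (4 * x ^+ 2) * phi x.

(** The form [x ^ 2 * T ^ 2 + (2 mu + 2) * T] of the Bessel operator on the
    quotients by [om], in which it is easy to commute it with [T]. *)
Definition rbessel_unweight (Phi : R -> R) : R -> R := fun x =>
  x ^+ 2 * iter 2 rxD Phi x + (2 * mu + 2) * iter 1 rxD Phi x.

Lemma is_derive_mul f g (x a b : R) : is_derive x 1 f a -> is_derive x 1 g b ->
  is_derive x 1 (fun y => f y * g y) (a * g x + f x * b).
Proof.
by move=> df dg; apply: (is_derive_eq (is_deriveM df dg)); rewrite /GRing.scale /=; ring.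
Qed.

Lemma om_derive : has_derivative om (fun x => (mu + 2^-1) * (om x / x)).
Proof.
move=> x x0; have := is_derive1_powR (mu + 2^-1) x0.
by rewrite powRB ?(gt_eqF x0) ?implybT // powRr1 // ltW.
Qed.

Lemma derive1_rxD (Phi : R -> R) x : 0 < x -> derive1 Phi x = x * rxD Phi x.
Proof. by move=> x0; rewrite /rxD mulrA mulfV ?mul1r // gt_eqF. Qed.

Lemma rxD_derive (Phi : R -> R) : smooth Phi ->
  has_derivative (fun x => x * rxD Phi x)
    (fun x => rxD Phi x + x ^+ 2 * rxD (rxD Phi) x).
Proof.
move=> sPhi x x0.
have d := smooth_has_derivative (@smooth_iter_rxD 1 _ sPhi) x0.
apply: (is_derive_eq (is_deriveM (is_derive_id x 1) d)).
by rewrite /GRing.scale /= /rxD /=; field; rewrite gt_eqF.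
Qed.

Lemma rbesselE phi x : smooth phi -> 0 < x ->
  rbessel phi x = om x * rbessel_unweight (unweight phi) x.
Proof.
move=> sphi x0; have sPhi := smooth_unweight sphi.
set Phi := unweight phi in sPhi *.
have d1 : has_derivative phi (fun x => om x * ((mu + 2^-1) * Phi x / x + derive1 Phi x)).
  move=> y y0; have dom := om_derive y0; have dP := smooth_has_derivative sPhi y0.
  have d := is_deriveM dom dP.
  apply: near_eq_is_derive (is_derive_eq d _).
    by apply: pos_near y0 _ => z z0; exact: unweightE.
  by rewrite /GRing.scale /=; field; rewrite gt_eqF.
have d2 : is_derive x 1 (fun x => om x * ((mu + 2^-1) * Phi x / x + derive1 Phi x))
   ((mu + 2^-1) * (om x / x) * ((mu + 2^-1) * Phi x / x + derive1 Phi x) +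
    om x * ((mu + 2^-1) * (derive1 Phi x / x - Phi x / x ^+ 2) + derive1 (derive1 Phi) x)).
  have dom := om_derive x0; have dP := smooth_has_derivative sPhi x0.
  have dP' := smooth_has_derivative (smooth_derive1 sPhi) x0.
  have di := is_deriveV (lt0r_neq0 x0) (is_derive_id x 1).
  have dc : is_derive x 1 (fun y => (mu + 2^-1) * Phi y) ((mu + 2^-1) * derive1 Phi x).
    exact: is_deriveZ.
  have e : is_derive x 1 (fun x => (mu + 2^-1) * Phi x / x + derive1 Phi x)
      ((mu + 2^-1) * derive1 Phi x * x^-1 + (mu + 2^-1) * Phi x * (- x ^- 2 *: 1)
       + derive1 (derive1 Phi) x).
    exact: (is_deriveD (is_derive_mul dc di) dP').
  apply: (is_derive_eq (is_derive_mul dom e)); rewrite /GRing.scale /=.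
  by field; rewrite gt_eqF.
rewrite /rbessel /rbessel_unweight.
rewrite (eq_derive1 (fun y y0 => has_derivativeE d1 y0) x0).
rewrite derive1E; case: d2 => _ ->.
rewrite (eq_derive1 (fun y y0 => derive1_rxD Phi y0) x0).
rewrite (has_derivativeE (rxD_derive sPhi) x0) (derive1_rxD Phi x0) /=.
by rewrite -(unweightE phi x0) -/Phi; field; rewrite gt_eqF.
Qed.

(** The commutator of [T] with multiplication by [x ^ 2] is 2. As every seminorm
    is a weighted supremum of an iterate of [T], the Bessel operator therefore
    preserves the test space. *)
Lemma iter_rxD_bessel k (Phi : R -> R) x : smooth Phi -> 0 < x ->
  iter k rxD (rbessel_unweight Phi) x = x ^+ 2 * iter k.+2 rxD Phi x
    + (2 * k%:R + 2 * mu + 2) * iter k.+1 rxD Phi x.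
Proof.
move=> sPhi; elim: k x => [|k IH] x x0; first by rewrite /rbessel_unweight /= mulr0 add0r.
rewrite iterS [LHS]/rxD (eq_derive1 IH x0).
have d2 := smooth_has_derivative (@smooth_iter_rxD k.+2 _ sPhi) x0.
have d1 := smooth_has_derivative (@smooth_iter_rxD k.+1 _ sPhi) x0.
have d : is_derive x 1 (fun y => y ^+ 2 * iter k.+2 rxD Phi y
      + (2 * k%:R + 2 * mu + 2) * iter k.+1 rxD Phi y)
    (2 * x * iter k.+2 rxD Phi x + x ^+ 2 * derive1 (iter k.+2 rxD Phi) x
      + (2 * k%:R + 2 * mu + 2) * derive1 (iter k.+1 rxD Phi) x).
  exact: (is_deriveD (is_derive_mul (is_derive_sqr x) d2) (is_deriveZ _ d1)).
rewrite derive1E; have [_ ->] := d.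
rewrite !derive1_rxD // -[rxD (iter k.+2 _ _)]/(iter k.+3 rxD Phi).
rewrite -[rxD (iter k.+1 _ _)]/(iter k.+2 rxD Phi) -[k.+1%:R]natr1.
move: (iter k.+3 rxD Phi x) (iter k.+2 rxD Phi x) (k%:R : R) => a b c.
by field; rewrite gt_eqF.
Qed.

Lemma real_test_bessel phi : real_test phi -> real_test (rbessel phi).
Proof.
move=> tphi; have [sphi _] := tphi; have sPhi := smooth_unweight sphi.
split.
  apply: smoothD; first by do 2 apply: smooth_derive1.
  apply: (@eq_smooth _ (fun x => - ((4 * mu ^+ 2 - 1) / 4) * (x `^ (- 2) * phi x))).
    move=> x x0; rewrite powRN powR_mulrn ?(ltW x0) //.
    by field; rewrite gt_eqF.
  apply: smoothM; first exact: smooth_cst.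
  by apply: smoothM; [exact: smooth_powR|exact: sphi].
move=> m k; apply/fast_decayP: m.
apply: (@eq_fast_decay (fun x => x * (x * iter k.+2 rxD (unweight phi) x)
    + (2 * k%:R + 2 * mu + 2) * iter k.+1 rxD (unweight phi) x)).
  have E y : 0 < y -> rbessel_unweight (unweight phi) y = unweight (rbessel phi) y.
    by move=> y0; rewrite [RHS]/unweight rbesselE // mulrA r_om // mul1r.
  move=> x x0; rewrite -(eq_iter_rxD k E x0).
  by rewrite iter_rxD_bessel // mulrA.
apply: fast_decayD; last by apply: fast_decayZ; exact: real_test_decay.
by do 2 apply: fast_decayX; exact: real_test_decay.
Qed.

(** After division by [om], these are eigenfunctions of [T]. *)
Definition gauss_test (t : R) : R -> R := fun x => om x * expR (- t * x ^+ 2).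

Lemma unweight_gauss t x : 0 < x -> unweight (gauss_test t) x = expR (- t * x ^+ 2).
Proof. exact: unweight_om. Qed.

Lemma iter_rxD_gauss t k x : 0 < x ->
  iter k rxD (fun x => expR (- t * x ^+ 2)) x = (- (2 * t)) ^+ k * expR (- t * x ^+ 2).
Proof.
elim: k x => [|k IH] x x0; first by rewrite /= expr0 mul1r.
rewrite iterS [LHS]/rxD (eq_derive1 IH x0).
have d := is_deriveZ ((- (2 * t)) ^+ k) (gauss_derive t x0).
rewrite derive1E; have [_ /= E] := d; rewrite [X in _ * X]E.
by rewrite /GRing.scale /= [(- (2 * t)) ^+ k.+1]exprS; field; rewrite gt_eqF.
Qed.

Lemma gauss_decay t : 0 < t -> fast_decay (fun x : R => expR (- t * x ^+ 2)).
Proof.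
move=> t0; apply/fast_decayP => m; exists (1 + m`!%:R / t ^+ m) => x x0.
rewrite ger0_norm ?mulr_ge0 ?expR_ge0 ?exprn_ge0 ?(ltW x0) //.
have e0 : 0 < expR (t * x ^+ 2) := expR_gt0 _.
have y0 : 0 <= t * x ^+ 2 by rewrite mulr_ge0 ?sqr_ge0 // ltW.
have h := exprn_le_expR m y0.
have e1 : 1 <= expR (t * x ^+ 2).
  by apply: le_trans (expR_ge1Dx _); rewrite lerDl.
have xm : x ^+ m <= 1 + (x ^+ 2) ^+ m.
  have q := sqr_ge0 (x ^+ m - 1); have q2 := exprn_ge0 m (ltW x0).
  by rewrite -exprM mulnC exprM; nra.
rewrite mulNr expRN ler_pdivrMr //; apply: le_trans xm _.
rewrite mulrDl mul1r; apply: lerD => //.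
rewrite exprMn in h.
by rewrite mulrAC ler_pdivlMr ?exprn_gt0 // mulrC.
Qed.

Lemma real_test_gauss t : 0 < t -> real_test (gauss_test t).
Proof.
move=> t0; split; first by apply: smoothM; [exact: smooth_powR|exact: smooth_gauss].
move=> m k; apply/fast_decayP: m.
apply: (eq_fast_decay _ (fast_decayZ ((- (2 * t)) ^+ k) (gauss_decay t0))) => x x0.
by rewrite (eq_iter_rxD k (@unweight_gauss t)) // iter_rxD_gauss.
Qed.

Lemma rbessel_gauss t x : 0 < x -> rbessel (gauss_test t) x =
  om x * (4 * t ^+ 2 * x ^+ 2 - 4 * (mu + 1) * t) * expR (- t * x ^+ 2).
Proof.
move=> x0; rewrite rbesselE //; last first.
  by apply: smoothM; [exact: smooth_powR|exact: smooth_gauss].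
rewrite /rbessel_unweight !(eq_iter_rxD _ (@unweight_gauss t)) // !iter_rxD_gauss //.
ring.
Qed.

Lemma real_test0 : real_test (fun=> 0).
Proof.
split=> [|m k]; first exact: smooth_cst.
exists 0 => x x0; have E (y : R) : 0 < y -> unweight (fun=> 0) y = 0 by rewrite /unweight mulr0.
rewrite (eq_iter_rxD k E x0).
suff -> : iter k rxD (fun=> 0) x = 0 by rewrite mulr0 normr0.
elim: k x x0 => [|k IH] x x0 //.
by rewrite iterS /rxD (eq_derive1 IH x0) derive1_cst mulr0.
Qed.

End real_test_functions.

(** * Gaussian integrals determine a function *)

Section zero_test.
Context {R : realType}.
Local Notation leb := (@lebesgue_measure R).
Local Notation T := (measurableTypeR R).
Local Notation D := (half_line : set T).

Let mD : measurable D := @measurable_half_line R.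

(** Lebesgue differentiation of the primitive of [e], which is constant. *)
Lemma tail_zero_ae (e : R -> R) : leb.-integrable D (EFin \o e) ->
  (forall b, 0 < b -> \int[leb]_(y in `]b, +oo[) e y = 0) ->
  e = (fun=> 0) %[ae leb in D].
Proof.
move=> Ie tail0; pose f : R -> R := e \_ D.
have If : leb.-integrable [set: T] (EFin \o f).
  by move: Ie; rewrite integrable_mkcond //= restrict_EFin.
have If' y : leb.-integrable `]-oo, y] (EFin \o f).
  by apply: integrableS If.
have Lf : locally_integrable [set: R] f by exact: integrable_locally.
have cst x : 0 < x -> \int[leb]_(t in `]-oo, x]) f t = \int[leb]_t f t.
  move=> x0; have := @Rintegral_itvB R f -oo%O +oo%O x.
  rewrite set_itvE => /(_ If isT isT).
  have -> : \int[leb]_(y in `]x, +oo[) f y = 0.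
    rewrite -[RHS](tail0 x x0); apply: eq_Rintegral => y /set_mem /=.
    rewrite in_itv /= andbT => xy; rewrite /f patchE mem_set //.
    by rewrite half_lineE; exact: lt_trans xy.
  by move/eqP; rewrite subr_eq0 => /eqP <-.
have := FTC1Ny If' Lf; apply: filterS; first exact: (ae_filter_ringOfSetsType leb).
move=> x; case=> dF F'x.
rewrite half_lineE => x0; have fx : f x = e x by rewrite /f patchE mem_set ?half_lineE.
rewrite -fx -F'x derive1E.
have E : \forall y \near x, \int[leb]_(t in `]-oo, y]) f t = \int[leb]_t f t.
  by apply: pos_near x0 _ => y; exact: cst.
by rewrite (near_eq_derive _ E) derive_cst.
Qed.

Lemma bernoulli_inequality (s : R) N : 0 <= s -> s <= 1 -> 1 - N%:R * s <= (1 - s) ^+ N.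
Proof.
move=> s0 s1; elim: N => [|N IH]; first by rewrite mul0r subr0 expr0.
rewrite exprS -natr1; apply: le_trans (ler_wpM2l _ IH); last lra.
have := mulr_ge0 (ler0n R N) (sqr_ge0 s); rewrite expr2; lra.
Qed.

(** By Bernoulli's inequality, and in [step_cvg0] by [1 - u <= exp (- u)], all
    depends on whether [(2 * s) ^ n] tends to 0 or to infinity. *)
Lemma step_cvg1 (s : R) : 0 <= s -> s < 2^-1 ->
  (1 - s ^+ n) ^+ (2 ^ n) @[n --> \oo] --> (1 : R).
Proof.
move=> s0 s1.
have c : (1 - (2 * s) ^+ n) @[n --> \oo] --> (1 : R).
  rewrite -[X in _ --> X]subr0; apply: cvgB; first exact: cvg_cst.
  by apply: cvg_expr; rewrite ger0_norm; lra.
apply: (squeeze_cvgr _ c (cvg_cst (1 : R))); near=> n.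
have sn0 : 0 <= s ^+ n by apply: exprn_ge0.
have sn1 : s ^+ n <= 1 by apply: exprn_ile1 => //; lra.
apply/andP; split; last by apply: exprn_ile1; lra.
apply: le_trans (bernoulli_inequality _ sn0 sn1).
by rewrite exprMn natrX.
Unshelve. all: by end_near. Qed.

Lemma step_cvg0 (s : R) : 2^-1 < s -> s <= 1 ->
  (1 - s ^+ n) ^+ (2 ^ n) @[n --> \oo] --> (0 : R).
Proof.
move=> s0 s1.
have c : ((2 * s)^-1 ^+ n) @[n --> \oo] --> (0 : R).
  apply: cvg_expr; rewrite ger0_norm; last by rewrite invr_ge0; lra.
  by rewrite invf_lt1; lra.
apply: (squeeze_cvgr _ (cvg_cst (0 : R)) c); near=> n.
have sn0 : 0 <= s ^+ n by apply: exprn_ge0; lra.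
have sn1 : s ^+ n <= 1 by apply: exprn_ile1 => //; lra.
apply/andP; split; first by apply: exprn_ge0; lra.
apply: (@le_trans _ _ (expR (- s ^+ n) ^+ (2 ^ n))).
  apply: lerXn2r; rewrite ?nnegrE ?expR_ge0 //; first lra.
  exact: expR_ge1Dx.
rewrite -expRM_natl expRM_natl -expRM_natl mulrN expRN exprVn natrX -exprMn.
have p0 : 0 < (2 * s) ^+ n by apply: exprn_gt0; lra.
rewrite lef_pV2 ?posrE ?expR_gt0 //.
by apply: le_trans (expR_ge1Dx _); lra.
Unshelve. all: by end_near. Qed.

(** The powers of [1 - exp (- n * t * y ^ 2)] are combinations of Gaussians. The
    power with exponent [2 ^ n] tends to the indicator of
    [exp (- t * y ^ 2) < 1 / 2], and every half-line is of this form. *)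
Lemma gauss_transform_zero_ae (e : R -> R) : leb.-integrable D (EFin \o e) ->
  (forall t, 0 <= t -> \int[leb]_(y in D) (e y * expR (- t * y ^+ 2)) = 0) ->
  e = (fun=> 0) %[ae leb in D].
Proof.
move=> Ie e0; have me : measurable_fun D e.
  by have /integrableP[/measurable_EFinP] := Ie.
have mexp (t : R) : measurable_fun D (fun y => expR (- t * y ^+ 2)).
  by apply: pos_continuous_measurable => //; apply/smooth_continuous/smooth_gauss.
have exp01 (t y : R) : 0 <= t -> 0 <= expR (- t * y ^+ 2) <= 1.
  by move=> t0; rewrite expR_ge0 -expR0 ler_expR mulNr oppr_le0 mulr_ge0 ?sqr_ge0.
pose q c N (y : R) : R := (1 - expR (- c * y ^+ 2)) ^+ N.
have q01 c N y : 0 <= c -> 0 <= q c N y <= 1.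
  move=> c0; have /andP[h0 h1] := exp01 _ y c0; rewrite /q.
  by rewrite exprn_ge0 ?exprn_ile1 //; lra.
have mq c N : measurable_fun D (q c N).
  by apply: measurable_funX; apply: measurable_funB.
have Iq t c N : 0 <= t -> 0 <= c ->
    leb.-integrable D (EFin \o (fun y => e y * (expR (- t * y ^+ 2) * q c N y))).
  move=> t0 c0; apply: le_integrable Ie => //.
    apply/measurable_EFinP; apply: measurable_funM => //; exact: measurable_funM.
  move=> y _; rewrite !abse_EFin lee_fin normrM ler_piMr //.
  have /andP[h0 h1] := exp01 _ y t0; have /andP[h2 h3] := q01 c N y c0.
  by rewrite ger0_norm ?mulr_ge0 // mulr_ile1.
have eq0 N : forall t c, 0 <= t -> 0 <= c ->
    \int[leb]_(y in D) (e y * (expR (- t * y ^+ 2) * q c N y)) = 0.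
  elim: N => [|N IH] t c t0 c0.
    by rewrite -[RHS](e0 t t0); apply: eq_Rintegral => y _; rewrite /q expr0 mulr1.
  have tc0 : 0 <= t + c by rewrite addr_ge0.
  rewrite -[RHS](subrr 0) -{1}(IH t c t0 c0) -(IH (t + c) c tc0 c0).
  rewrite -RintegralB //; [|exact: Iq|exact: Iq].
  apply: eq_Rintegral => y _; rewrite /q [(1 - _) ^+ N.+1]exprS.
  have -> : expR (- (t + c) * y ^+ 2) = expR (- t * y ^+ 2) * expR (- c * y ^+ 2).
    by rewrite -expRD; congr expR; ring.
  by ring.
apply: tail_zero_ae => // b b0.
pose t := ln 2 / b ^+ 2.
have b20 : 0 < b ^+ 2 by rewrite exprn_gt0.
have t0 : 0 < t by rewrite divr_gt0 // ln_gt0 // ltr1n.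
have tb : expR (- t * b ^+ 2) = 2^-1.
  by rewrite /t mulNr divfK ?gt_eqF // expRN lnK ?posrE.
pose f n y := e y * (expR (- 0 * y ^+ 2) * q (n%:R * t) (2 ^ n)%N y).
have nt0 n : 0 <= n%:R * t by rewrite mulr_ge0 // ltW.
have [] := @dominated_convergence _ T R leb D mD (fun n => EFin \o f n)
  (EFin \o (fun y => e y * (\1_(`]b, +oo[%classic : set R) y))) (abse \o (EFin \o e)).
- by move=> n; have /integrableP[] := Iq 0 (n%:R * t) (2 ^ n)%N (lexx 0) (nt0 n).
- by apply/measurable_EFinP; apply: measurable_funM.
- exists [set b]; split; [exact: measurable_set1|exact: lebesgue_measure_set1|].
  move=> y /=; apply: contra_notP => yb; rewrite half_lineE => y0.
  apply: cvg_EFin; first exact: nearW.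
  have E n : f n y = e y * (1 - expR (- t * y ^+ 2) ^+ n) ^+ (2 ^ n).
    rewrite /f /q oppr0 mul0r expR0 mul1r -expRM_natl.
    by congr (_ * (1 - expR _) ^+ _); ring.
  suff L : (1 - expR (- t * y ^+ 2) ^+ n) ^+ (2 ^ n) @[n --> \oo] -->
      (\1_(`]b, +oo[%classic : set R) y : R).
    have {L} : e y * (1 - expR (- t * y ^+ 2) ^+ n) ^+ (2 ^ n) @[n --> \oo] -->
        e y * (\1_(`]b, +oo[%classic : set R) y : R).
      by apply: cvgM; [exact: cvg_cst|exact: L].
    by rewrite -(funext E).
  rewrite indicE; have [by_|yb'] := ltP b y.
    rewrite mem_set /=; last by rewrite in_itv /= by_.
    apply: step_cvg1; first exact: expR_ge0.
    by rewrite -tb ltr_expR !mulNr ltrN2 ltr_pM2l // ltrXn2r ?nnegrE ?(ltW b0) ?(ltW y0).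
  rewrite memNset /=; last by rewrite in_itv /= ltNge yb'.
  have {}yb' : y < b by rewrite lt_neqAle yb' andbT; apply/eqP.
  apply: step_cvg0; last by have /andP[] := exp01 _ y (ltW t0).
  by rewrite -tb ltr_expR !mulNr ltrN2 ltr_pM2l // ltrXn2r ?nnegrE ?(ltW b0) ?(ltW y0).
- exact: integrable_abse.
- apply: aeW => y n _; rewrite /= lee_fin /f normrM ler_piMr //.
  have /andP[h0 h1] := exp01 _ y (lexx 0).
  have /andP[h2 h3] := q01 _ (2 ^ n)%N y (nt0 n).
  by rewrite ger0_norm ?mulr_ge0 // mulr_ile1.
move=> I _ cv.
have {}cv : (\int[leb]_(y in D) (f n y)%:E @[n --> \oo] -->
    \int[leb]_(y in D) (e y * \1_(`]b, +oo[%classic : set R) y)%:E)%E by exact: cv.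
have fE n : (\int[leb]_(y in D) (f n y)%:E = 0)%E.
  have H := eq0 (2 ^ n)%N 0 (n%:R * t) (lexx 0) (nt0 n).
  have /fineK <- := integrable_fin_num mD (Iq 0 (n%:R * t) (2 ^ n)%N (lexx 0) (nt0 n)).
  by rewrite -[X in X%:E]/(Rintegral _ _ _) H.
rewrite (funext fE) in cv.
have z := cvg_unique (@ereal_hausdorff R) cv (cvg_cst 0%E).
have Eb : \int[leb]_(y in `]b, +oo[) e y =
    \int[leb]_(y in D) (e y * \1_(`]b, +oo[%classic : set R) y).
  rewrite [LHS]Rintegral_mkcond [RHS]Rintegral_mkcond; apply: eq_Rintegral => y _.
  rewrite !patchE indicE; have [|] := boolP (y \in `]b, +oo[%classic).
    move=> /set_mem /=; rewrite in_itv /= andbT => by_.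
    by rewrite mem_set ?mulr1 // half_lineE; exact: lt_trans by_.
  by rewrite mulr0 if_same.
by rewrite Eb /Rintegral z.
Qed.

End zero_test.

(** * Uniqueness for the weak eigenvalue equation *)

Section weak_injectivity.
Context {R : realType}.
Local Notation leb := (@lebesgue_measure R).
Local Notation T := (measurableTypeR R).
Local Notation D := (half_line : set T).
Variables (mu lam : R) (d : R -> R).
Hypotheses (hmu : - 2^-1 < mu) (lam0 : 0 < lam).
Hypothesis wd : weighted_L1 mu d.
Local Notation om := (om mu).
Local Notation ww := (ww mu).

Let mD : measurable D := @measurable_half_line R.

Lemma decay_integrable (u : R -> R) : pos_continuous u -> fast_decay u ->
  leb.-integrable D (EFin \o (fun y => d y * (om y * u y))).
Proof.
move=> cu /(_ (wM mu))[K uK]; apply: (weighted_integrable (K := K) wd).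
  apply: pos_continuous_measurable => //.
  by apply: pos_continuousM => //; exact: om_continuous.
move=> y y0; rewrite normrM (ger0_norm (om_ge0 _ _)) /ww mulrCA.
by apply: ler_wpM2l; [exact: om_ge0|exact: uK].
Qed.

Let gauss (t y : R) : R := expR (- t * y ^+ 2).

Let cgauss t : pos_continuous (gauss t).
Proof. exact/smooth_continuous/smooth_gauss. Qed.

(* The Gaussian transform of [d], and the opposite of its derivative. *)
Let h (t : R) : R := \int[leb]_(y in D) (d y * (om y * gauss t y)).
Let h2 (t : R) : R := \int[leb]_(y in D) (d y * (om y * (y * (y * gauss t y)))).

Let cygauss t : pos_continuous (fun y => y * (y * gauss t y)).
Proof. by do 2 (apply: pos_continuousM; first by move=> ? _; exact: cvg_id). Qed.

Let fygauss t : 0 < t -> fast_decay (fun y => y * (y * gauss t y)).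
Proof. by move=> t0; do 2 apply: fast_decayX; exact: gauss_decay. Qed.

Let h_derive : has_derivative h (fun t => - h2 t).
Proof.
move=> a a0.
pose f (t y : R) := d y * (om y * gauss t y).
have dgauss (t y : R) : is_derive t 1 (fun t => gauss t y) (- (y ^+ 2) * gauss t y).
  have d1 : is_derive t 1 (fun t => - t * y ^+ 2) (- (y ^+ 2)).
    by apply: is_derive_eq; rewrite /GRing.scale /=; ring.
  have d2 := @is_derive1_comp _ expR (fun t : R => - t * y ^+ 2) t _ _ (is_derive_expR _) d1.
  by apply: (is_derive_eq d2); rewrite mulrC.
have df (t y : R) : is_derive t 1 (f ^~ y) (- (d y * (om y * (y * (y * gauss t y))))).
  have dg := dgauss t y.
  by apply: is_derive_eq; rewrite /GRing.scale /=; ring.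
have pf (t y : R) : partial1of2 f t y = - (d y * (om y * (y * (y * gauss t y)))).
  by rewrite partial1of2E; have [_ ->] := df t y.
pose G (y : R) := `|d y * (om y * (y * (y * gauss (a / 2) y)))|.
have a20 : 0 < a / 2 by rewrite divr_gt0.
have Ia : `]a / 2, (a + 1)[%classic a by rewrite /= in_itv /=; lra.
have Iu (t : R) : `]a / 2, (a + 1)[%classic t -> 0 < t.
  by rewrite /= in_itv /= => /andP[? _]; lra.
have If t : `]a / 2, (a + 1)[%classic t -> leb.-integrable D (EFin \o f t).
  by move=> /Iu t0; apply: decay_integrable => //; exact: gauss_decay.
have Df t y : `]a / 2, (a + 1)[%classic t -> D y -> derivable (f ^~ y) t 1.
  by move=> _ _; have [] := df t y.
have G0 y : 0 <= G y by exact: normr_ge0.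
have IG : leb.-integrable D (EFin \o G).
  have I : leb.-integrable D (EFin \o (fun y => d y * (om y * (y * (y * gauss (a / 2) y))))).
    by apply: decay_integrable => //; exact: fygauss.
  exact: integrable_norm I.
have GU t y : `]a / 2, (a + 1)[%classic t -> D y -> `|partial1of2 f t y| <= G y.
  move=> It; rewrite half_lineE => y0; rewrite pf normrN /G.
  rewrite normrM [leRHS]normrM; apply: ler_wpM2l => //.
  rewrite normrM [leRHS]normrM; apply: ler_wpM2l => //.
  rewrite normrM [leRHS]normrM; apply: ler_wpM2l => //.
  rewrite normrM [leRHS]normrM; apply: ler_wpM2l => //.
  rewrite !ger0_norm ?expR_ge0 // ler_expR !mulNr lerN2 ler_wpM2r ?sqr_ge0 //.
  by move: It; rewrite /= in_itv /= => /andP[? _]; lra.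
have dh := @derivable_under_integral R _ T leb f D mD a _ _ Ia If Df G G0 IG GU.
have h' := @differentiation_under_integral R _ T leb f D mD a _ _ Ia If Df G G0 IG GU.
apply: DeriveDef; first exact: dh.
rewrite -derive1E [LHS]h' /h2 -[RHS]mulN1r -RintegralZl //.
  by apply: eq_Rintegral => y _; rewrite pf mulN1r.
by apply: decay_integrable => //; exact: fygauss.
Qed.

Hypothesis eqd : forall t, 0 < t ->
  \int[leb]_(y in D) (d y * rbessel mu (gauss_test mu t) y) =
  lam * \int[leb]_(y in D) (d y * gauss_test mu t y).

(** The weak equation on Gaussians becomes a differential equation for the
    transform, since multiplication by [- y ^ 2] is differentiation in [t]. Its
    solutions are the multiples of [t ^ (- mu - 1) * exp (lam / (4 * t))]. *)
Let h_ode t : 0 < t -> 4 * t ^+ 2 * h2 t = (lam + 4 * (mu + 1) * t) * h t.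
Proof.
move=> t0; have I1 : leb.-integrable D (EFin \o (fun y => d y * (om y * gauss t y))).
  by apply: decay_integrable => //; exact: gauss_decay.
have I2 : leb.-integrable D (EFin \o (fun y => d y * (om y * (y * (y * gauss t y))))).
  by apply: decay_integrable => //; exact: fygauss.
have := eqd t0.
have -> : \int[leb]_(y in D) (d y * gauss_test mu t y) = h t by [].
have -> : \int[leb]_(y in D) (d y * rbessel mu (gauss_test mu t) y) =
    4 * t ^+ 2 * h2 t - 4 * (mu + 1) * t * h t.
  rewrite /h /h2 -RintegralZl // -RintegralZl // -RintegralB //.
  - apply: eq_Rintegral => y /set_mem; rewrite half_lineE => y0.
    by rewrite rbessel_gauss // /gauss; ring.
  - by apply: (@integrableZl _ T R leb D mD (4 * t ^+ 2)) I2.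
  - by apply: (@integrableZl _ T R leb D mD (4 * (mu + 1) * t)) I1.
by rewrite mulrDl; lra.
Qed.

Let E (t : R) : R := t `^ (mu + 1) * (expR (- (lam / 4) * t^-1) * h t).

Let E_derive : has_derivative E (fun=> 0).
Proof.
move=> t t0; have tn0 : t != 0 by rewrite gt_eqF.
have d1 := is_derive1_powR (mu + 1) t0.
have d2 : is_derive t 1 (fun t : R => expR (- (lam / 4) * t^-1))
    (expR (- (lam / 4) * t^-1) * (lam / 4 / t ^+ 2)).
  have di := is_deriveV tn0 (is_derive_id t 1).
  have dz : is_derive t 1 (fun t : R => - (lam / 4) * t^-1) (lam / 4 / t ^+ 2).
    by apply: (is_derive_eq (is_deriveZ (- (lam / 4)) di)); rewrite /GRing.scale /=; field.
  exact: (@is_derive1_comp _ expR (fun t : R => - (lam / 4) * t^-1) t _ _ (is_derive_expR _) dz).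
have d3 := h_derive t0.
apply: (is_derive_eq (is_derive_mul d1 (is_derive_mul d2 d3))).
have -> : h2 t = (lam + 4 * (mu + 1) * t) * h t / (4 * t ^+ 2).
  by rewrite -h_ode //; field.
have -> : mu + 1 - 1 = mu by ring.
rewrite powRD ?tn0 ?implybT // powRr1 ?(ltW t0) //.
by field.
Qed.

(** A Gaussian is at most a multiple of [t ^ - wM] times the decay of [ww]. *)
Let h_bound : exists C, 0 <= C /\ forall t, 0 < t -> t <= 1 -> `|h t| <= C * t ^- (wM mu).
Proof.
have [M EM] : exists M, M = wM mu by eexists.
pose I : R := \int[leb]_(y in D) `|d y * ww y|.
have I0 : 0 <= I by apply: Rintegral_ge0.
have [md Id] := wd.
exists (2 ^+ M * (1 + M`!%:R) * I); split.
  by rewrite !mulr_ge0 ?exprn_ge0 // addr_ge0.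
move=> t t0 t1; rewrite -EM.
have tM0 : 0 < t ^+ M by rewrite exprn_gt0.
have key y : 0 < y -> gauss t y <= 2 ^+ M * (1 + M`!%:R) * t ^- M * (1 + y) ^- M.
  move=> y0; have y10 : 0 < 1 + y by lra.
  rewrite ler_pdivlMr ?exprn_gt0 //.
  have g1 : gauss t y <= 1.
    by rewrite /gauss -expR0 ler_expR mulNr oppr_le0 mulr_ge0 ?sqr_ge0 // ltW.
  have g2 : t ^+ M * (y ^+ 2) ^+ M * gauss t y <= M`!%:R.
    rewrite /gauss mulNr expRN ler_pdivrMr ?expR_gt0 // -exprMn.
    by apply: exprn_le_expR; rewrite mulr_ge0 ?sqr_ge0 // ltW.
  have e : (1 + y) ^+ M <= 2 ^+ M * (1 + (y ^+ 2) ^+ M).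
    have [y1|y1] := leP y 1.
      apply: (@le_trans _ _ (2 ^+ M)).
        by apply: lerXn2r; rewrite ?nnegrE ?(ltW y10) //; lra.
      rewrite ler_peMr ?exprn_ge0 // lerDl exprn_ge0 ?sqr_ge0 //.
    apply: (@le_trans _ _ ((2 * y ^+ 2) ^+ M)).
      have y2 : 1 + y <= 2 * y ^+ 2 by rewrite expr2; nra.
      by apply: lerXn2r => //; rewrite nnegrE; [exact: ltW|exact: le_trans (ltW y10) y2].
    by rewrite exprMn; apply: ler_wpM2l; rewrite ?exprn_ge0 ?lerDr.
  have gs0 : 0 <= gauss t y := expR_ge0 _.
  apply: le_trans (ler_wpM2l gs0 e) _.
  rewrite mulrCA -!mulrA; apply: ler_wpM2l; first exact: exprn_ge0.
  rewrite ler_pdivlMr // mulrDr mulr1 mulrDl; apply: lerD.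
    by rewrite -[leRHS]mulr1; apply: ler_pM => //; [exact: ltW|apply: exprn_ile1 => //; exact: ltW].
  by apply: le_trans g2; apply: eqW; ring.
have If : leb.-integrable D (EFin \o (fun y => d y * (om y * gauss t y))).
  by apply: decay_integrable => //; exact: gauss_decay.
apply: le_trans (le_normr_Rintegral mD If) _.
have -> : 2 ^+ M * (1 + M`!%:R) * I / t ^+ M =
    \int[leb]_(y in D) (2 ^+ M * (1 + M`!%:R) * t ^- M * `|d y * ww y|).
  by rewrite RintegralZl //; [rewrite /I; ring|exact: integrable_norm Id].
apply: le_Rintegral => //.
- exact: integrable_norm If.
- exact: (@integrableZl _ T R leb D mD (2 ^+ M * (1 + M`!%:R) * t ^- M) _
    (integrable_norm Id)).
move=> y; rewrite half_lineE => y0.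
rewrite normrM [in leRHS]normrM mulrCA; apply: ler_wpM2l => //.
rewrite (ger0_norm (ltW (ww_gt0 mu y0))) normrM (ger0_norm (om_ge0 _ _)) /ww -EM.
rewrite mulrCA; apply: ler_wpM2l; first exact: om_ge0.
by rewrite ger0_norm ?expR_ge0 // key.
Qed.

(** [E] is constant and tends to 0 at 0, because the factor [exp (- lam / (4 t))]
    beats the polynomial growth of [h]. *)
Let h_eq0 t : 0 < t -> h t = 0.
Proof.
have hm := hmu; have l0 := lam0.
have Ec s t' : 0 < s -> s <= t' -> E s = E t'.
  move=> s0 st; apply/eqP; rewrite eq_le; apply/andP; split.
    by apply: (has_derivative_le E_derive).
  rewrite -lerN2; apply: (has_derivative_le (F := fun z => - E z) (f := fun=> 0)) => //.
  move=> z z0; have dz := E_derive z0.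
  by apply: (is_derive_eq (is_deriveN dz)); rewrite oppr0.
have [C [C0 hC]] := h_bound; have [M EM] : exists M, M = wM mu by eexists.
pose C' := C * (M`!%:R * (4 / lam) ^+ M).
have Ebound s : 0 < s -> s <= 1 -> `|E s| <= s `^ (mu + 1) * C'.
  move=> s0 s1; rewrite /E normrM (ger0_norm (powR_ge0 _ _)).
  apply: ler_wpM2l; first exact: powR_ge0.
  rewrite normrM (ger0_norm (expR_ge0 _)).
  have h1 := hC s s0 s1; rewrite -EM in h1.
  have l4 : 0 < lam / 4 by lra.
  have e1 : expR (- (lam / 4) * s^-1) <= M`!%:R * (4 / lam) ^+ M * s ^+ M.
    rewrite mulNr expRN -[leLHS]mul1r ler_pdivrMr ?expR_gt0 //.
    have := @exprn_le_expR R (lam / 4 * s^-1) M (ltW (mulr_gt0 l4 (etrans (invr_gt0 s) s0))).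
    rewrite exprMn exprVn => e2.
    have -> : M`!%:R * (4 / lam) ^+ M * s ^+ M * expR (lam / 4 / s) =
       (4 / lam) ^+ M * s ^+ M * (M`!%:R * expR (lam / 4 / s)) by ring.
    apply: le_trans (ler_wpM2l _ e2); last first.
      by rewrite mulr_ge0 ?exprn_ge0 ?divr_ge0 ?(ltW l0) ?(ltW s0).
    rewrite mulrACA -exprMn mulfV ?gt_eqF ?exprn_gt0 // mulr1.
    rewrite (_ : 4 / lam * (lam / 4) = 1) ?expr1n //.
    by field; rewrite gt_eqF.
  apply: le_trans (ler_pM (expR_ge0 _) (normr_ge0 _) e1 h1) _.
  rewrite /C'; apply: eqW.
  by field; rewrite expf_neq0 ?gt_eqF.
move=> t0.
have lim0 : E s @[s --> 0^'+] --> 0.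
  have b : s `^ (mu + 1) * C' @[s --> 0^'+] --> (0 : R).
    rewrite -[X in _ --> X](mul0r C'); apply: cvgM; last exact: cvg_cst.
    by apply: powR_cvg0; lra.
  apply: norm_cvg0; apply: (squeeze_cvgr _ (cvg_cst (0 : R)) b); near=> s.
  have s0 : 0 < s by [].
  have s1 : s <= 1 by near: s; exact: nbhs_right_le.
  by rewrite normr_ge0 /= Ebound.
have limE : E s @[s --> 0^'+] --> E t.
  apply: cvg_near_cst; near=> s.
  have s0 : 0 < s by [].
  have st : s <= t by near: s; exact: nbhs_right_le.
  exact: Ec.
have Et0 : E t = 0 := cvg_unique (@Rhausdorff R) limE lim0.
have p0 : t `^ (mu + 1) * expR (- (lam / 4) * t^-1) != 0.
  by rewrite mulf_neq0 // gt_eqF ?powR_gt0 ?expR_gt0.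
by apply: (mulfI p0); rewrite mulr0 -mulrA; exact: Et0.
Unshelve. all: by end_near. Qed.

(** The transform vanishes, and it determines [d]. *)
Lemma weak_injective : d = (fun=> 0) %[ae leb in D].
Proof.
have Ie : leb.-integrable D (EFin \o (fun y => d y * (om y * gauss 1 y))).
  by apply: decay_integrable => //; exact: gauss_decay.
have := gauss_transform_zero_ae Ie.
have H t : 0 <= t -> \int[leb]_(y in D) (d y * (om y * gauss 1 y) * expR (- t * y ^+ 2)) = 0.
  move=> t0; rewrite -(h_eq0 (t := 1 + t)); last lra.
  apply: eq_Rintegral => y _; rewrite /gauss opprD mulrDl expRD; ring.
move=> /(_ H); apply: filterS.
move=> y + Dy => /(_ Dy) /eqP; move: Dy; rewrite half_lineE => y0.
rewrite mulf_eq0 => /orP[/eqP//|].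
by rewrite mulf_eq0 !gt_eqF ?expR_gt0 ?om_gt0.
Qed.

End weak_injectivity.

(** * Complex-valued functions and the dual of the test space *)

Section complex_values.
Context {R : realType}.
Local Notation leb := (@lebesgue_measure R).
Local Notation T := (measurableTypeR R).
Local Notation D := (half_line : set T).
Local Notation Re := (@complex.Re R).
Local Notation Im := (@complex.Im R).
Implicit Types (f g phi psi chi : R -> R[i]) (z w : R[i]) (mu : R).

Let mD : measurable D := @measurable_half_line R.

Lemma complex_eq z w : Re z = Re w -> Im z = Im w -> z = w.
Proof. by case: z w => [a b] [c d] /= -> ->. Qed.

Lemma ReM z w : Re (z * w) = Re z * Re w - Im z * Im w.
Proof. by case: z w => [a b] [c d]. Qed.

Lemma ImM z w : Im (z * w) = Re z * Im w + Im z * Re w.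
Proof. by case: z w => [a b] [c d]. Qed.

Lemma ReD z w : Re (z + w) = Re z + Re w.
Proof. by case: z w => [a b] [c d]. Qed.

Lemma ImD z w : Im (z + w) = Im z + Im w.
Proof. by case: z w => [a b] [c d]. Qed.

Lemma ReN z : Re (- z) = - Re z.
Proof. by case: z. Qed.

Lemma ImN z : Im (- z) = - Im z.
Proof. by case: z. Qed.

Lemma ReZ (r : R) z : Re (r%:C * z) = r * Re z.
Proof. by rewrite ReM /= mul0r subr0. Qed.

Lemma ImZ (r : R) z : Im (r%:C * z) = r * Im z.
Proof. by rewrite ImM /= mul0r addr0. Qed.

Lemma modulusE z : modulus z = Num.sqrt (Re z ^+ 2 + Im z ^+ 2).
Proof. by case: z. Qed.

Lemma modulus_ge0 z : 0 <= modulus z.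
Proof. by rewrite modulusE sqrtr_ge0. Qed.

Lemma modulus_sqr z : modulus z ^+ 2 = Re z ^+ 2 + Im z ^+ 2.
Proof. by rewrite modulusE sqr_sqrtr // addr_ge0 ?sqr_ge0. Qed.

Lemma Re_le_modulus z : `|Re z| <= modulus z.
Proof.
by rewrite modulusE -sqrtr_sqr ler_sqrt ?addr_ge0 ?sqr_ge0 // lerDl sqr_ge0.
Qed.

Lemma Im_le_modulus z : `|Im z| <= modulus z.
Proof.
by rewrite modulusE -sqrtr_sqr ler_sqrt ?addr_ge0 ?sqr_ge0 // lerDr sqr_ge0.
Qed.

Lemma modulus_le z : modulus z <= `|Re z| + `|Im z|.
Proof.
have h : 0 <= `|Re z| + `|Im z| by rewrite addr_ge0.
rewrite modulusE -[leRHS]ger0_norm // -sqrtr_sqr; apply: ler_wsqrtr.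
have := mulr_ge0 (normr_ge0 (Re z)) (normr_ge0 (Im z)).
by rewrite sqrrD !real_normK ?num_real //; lra.
Qed.

Lemma modulusM z w : modulus (z * w) = modulus z * modulus w.
Proof. exact: ComplexField.Normc.normcM. Qed.

Lemma modulusD z w : modulus (z + w) <= modulus z + modulus w.
Proof. exact: le_normcD. Qed.

Lemma modulusN z : modulus (- z) = modulus z.
Proof. exact: normcN. Qed.

Lemma modulus_real (r : R) : modulus r%:C = `|r|.
Proof. by rewrite modulusE /= expr0n addr0 sqrtr_sqr. Qed.

Lemma modulus_eq0 z : modulus z = 0 -> z = 0.
Proof. exact: ComplexField.Normc.eq0_normc. Qed.

Lemma cmeasurable_modulus f : cmeasurable f -> measurable_fun D (modulus \o f).
Proof.
move=> [mr mi].
have -> : modulus \o f = fun x => Num.sqrt (Re (f x) ^+ 2 + Im (f x) ^+ 2).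
  by apply/funext => x; rewrite /= modulusE.
apply: (measurableT_comp (continuous_measurable_fun (@sqrt_continuous R))).
by apply: measurable_funD; exact: measurable_funX.
Qed.

Lemma cmeasurableD f g : cmeasurable f -> cmeasurable g -> cmeasurable (f + g).
Proof.
move=> [mr mi] [mr' mi']; split.
  have -> : Re \o (f + g) = (fun x => (Re \o f) x + (Re \o g) x).
    by apply/funext => x; rewrite /= ReD.
  exact: measurable_funD.
have -> : Im \o (f + g) = (fun x => (Im \o f) x + (Im \o g) x).
  by apply/funext => x; rewrite /= ImD.
exact: measurable_funD.
Qed.

Lemma cmeasurableM f g : cmeasurable f -> cmeasurable g ->
  cmeasurable (fun x => f x * g x).
Proof.
move=> [mr mi] [mr' mi']; split.
  have -> : Re \o (fun x => f x * g x) = (fun x => (Re \o f) x * (Re \o g) x - (Im \o f) x * (Im \o g) x).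
    by apply/funext => x; rewrite /= ReM.
  by apply: measurable_funB; exact: measurable_funM.
have -> : Im \o (fun x => f x * g x) = (fun x => (Re \o f) x * (Im \o g) x + (Im \o f) x * (Re \o g) x).
  by apply/funext => x; rewrite /= ImM.
by apply: measurable_funD; exact: measurable_funM.
Qed.

Lemma cmeasurable_cst z : cmeasurable (fun=> z).
Proof. by split; exact: measurable_cst. Qed.

Lemma cmeasurableZ z f : cmeasurable f -> cmeasurable (cscale z f).
Proof. by move=> mf; apply: cmeasurableM => //; exact: cmeasurable_cst. Qed.

Lemma cmeasurableN f : cmeasurable f -> cmeasurable (- f).
Proof.
move=> [mr mi]; split.
  have -> : Re \o (- f) = (fun x => - (Re \o f) x) by apply/funext => x; rewrite /= ReN.
  exact: measurableT_comp.
have -> : Im \o (- f) = (fun x => - (Im \o f) x) by apply/funext => x; rewrite /= ImN.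
exact: measurableT_comp.
Qed.

Lemma integrable_scale (c : R) (h : R -> R) : leb.-integrable D (EFin \o h) ->
  leb.-integrable D (EFin \o (fun x => c * h x)).
Proof. by move=> hI; exact: (@integrableZl _ T R leb D mD c _ hI). Qed.

Definition cintegrable f := leb.-integrable D (EFin \o (Re \o f)) /\
  leb.-integrable D (EFin \o (Im \o f)).

Lemma cintegralD f g : cintegrable f -> cintegrable g ->
  cintegral (f + g) = cintegral f + cintegral g.
Proof.
move=> [fr fi] [gr gi]; apply: complex_eq; rewrite ?ReD ?ImD /= -RintegralD //.
  by apply: eq_Rintegral => x _; rewrite /= ReD.
by apply: eq_Rintegral => x _; rewrite /= ImD.
Qed.

Lemma cintegrableD f g : cintegrable f -> cintegrable g -> cintegrable (f + g).
Proof.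
move=> [fr fi] [gr gi]; split.
  apply: eq_integrable (@integrableD _ T R leb D mD _ _ fr gr) => // x _.
  by rewrite /= ReD EFinD.
apply: eq_integrable (@integrableD _ T R leb D mD _ _ fi gi) => // x _.
by rewrite /= ImD EFinD.
Qed.

Lemma cintegrableZ z f : cintegrable f -> cintegrable (cscale z f).
Proof.
move=> [fr fi]; split.
  apply: eq_integrable (@integrableB _ T R leb D mD _ _
    (integrable_scale (Re z) fr) (integrable_scale (Im z) fi)) => // x _.
  by rewrite /= /cscale ReM EFinB.
apply: eq_integrable (@integrableD _ T R leb D mD _ _
  (integrable_scale (Re z) fi) (integrable_scale (Im z) fr)) => // x _.
by rewrite /= /cscale ImM EFinD.
Qed.

Lemma cintegralZ z f : cintegrable f -> cintegral (cscale z f) = z * cintegral f.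
Proof.
move=> [fr fi]; apply: complex_eq; rewrite ?ReM ?ImM /= -!RintegralZl //.
  rewrite -RintegralB //; do ?[exact: integrable_scale].
  by apply: eq_Rintegral => x _; rewrite /cscale /= ReM.
rewrite -RintegralD //; do ?[exact: integrable_scale].
by apply: eq_Rintegral => x _; rewrite /cscale /= ImM.
Qed.

Lemma eq_cintegral f g : (forall x, 0 < x -> f x = g x) -> cintegral f = cintegral g.
Proof.
move=> fg; rewrite /cintegral; congr (_ +i* _); apply: eq_Rintegral => x /set_mem;
  by rewrite half_lineE => x0 /=; rewrite fg.
Qed.

Variables (mu : R).
Hypothesis hmu : - 2^-1 < mu.
Local Notation ww := (ww mu).

(** The norm of the common ambient space, in which all pairings with test
    functions are continuous. *)
Definition wnorm f : \bar R := (\int[leb]_(x in D) (modulus (f x) * ww x)%:E)%E.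

Let mmw f : cmeasurable f -> measurable_fun D (fun x => (modulus (f x) * ww x)%:E).
Proof.
move=> mf; apply/measurable_EFinP; apply: measurable_funM.
  exact: cmeasurable_modulus.
by apply: pos_continuous_measurable => //; exact: ww_continuous.
Qed.

Lemma wnorm_weighted_L1 f : cmeasurable f -> (wnorm f < +oo)%E ->
  weighted_L1 mu (Re \o f) /\ weighted_L1 mu (Im \o f).
Proof.
move=> mf fN; have [mr mi] := mf.
have mw : measurable_fun D ww.
  by apply: pos_continuous_measurable => //; exact: ww_continuous.
have I : leb.-integrable D (fun x => (modulus (f x) * ww x)%:E).
  apply/integrableP; split; first exact: mmw.
  apply: le_lt_trans fN; apply: eqW.
  apply: eq_integral => x /set_mem; rewrite half_lineE => x0.
  by rewrite gee0_abs // lee_fin mulr_ge0 ?modulus_ge0 // ltW // ww_gt0.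
by split; split=> //; apply: le_integrable I => //;
  do ?[by apply/measurable_EFinP; exact: measurable_funM];
  move=> x; rewrite half_lineE => x0; rewrite !abse_EFin lee_fin !normrM;
  apply: ler_wpM2r => //=; rewrite (ger0_norm (modulus_ge0 _)) ?Re_le_modulus ?Im_le_modulus.
Qed.

Lemma weighted_cintegrable f chi (K : R) : cmeasurable f -> (wnorm f < +oo)%E ->
  cmeasurable chi -> 0 <= K -> (forall x, 0 < x -> modulus (chi x) <= K * ww x) ->
  cintegrable (fun x => f x * chi x) /\
  ((modulus (cintegral (fun x => f x * chi x)))%:E <= (2 * K)%:E * wnorm f)%E.
Proof.
move=> mf fN mchi K0 chiK.
have nn x : 0 < x -> 0 <= modulus (f x) * ww x.
  by move=> x0; rewrite mulr_ge0 ?modulus_ge0 // ltW // ww_gt0.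
have I : leb.-integrable D (fun x => (modulus (f x) * ww x)%:E).
  apply/integrableP; split; first exact: mmw.
  apply: le_lt_trans fN; apply: eqW.
  apply: eq_integral => x /set_mem; rewrite half_lineE => x0.
  by rewrite gee0_abs // lee_fin nn.
have KI := @integrableZl _ T R leb D mD K _ I.
have bnd x : 0 < x -> modulus (f x * chi x) <= K * (modulus (f x) * ww x).
  move=> x0; rewrite modulusM mulrCA; apply: ler_wpM2l; first exact: modulus_ge0.
  exact: chiK.
have [mpr mpi] := cmeasurableM mf mchi.
have part (h : R -> R) : measurable_fun D h ->
    (forall x, `|h x| <= modulus (f x * chi x)) ->
    leb.-integrable D (EFin \o h) /\
    (`|\int[leb]_(x in D) h x|%:E <= K%:E * wnorm f)%E.
  move=> mh hb.
  have hI : leb.-integrable D (EFin \o h).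
    apply: le_integrable KI => //; first exact/measurable_EFinP.
    move=> x; rewrite half_lineE => x0; rewrite -EFinM !abse_EFin lee_fin.
    apply: le_trans (hb x) _; apply: le_trans (bnd x x0) _; exact: ler_norm.
  split=> //.
  rewrite EFin_normr_Rintegral //.
  apply: (@le_trans _ _ (\int[leb]_(x in D) `|(EFin \o h) x|)%E).
    have /integrableP[mhE _] := hI.
    exact: (@le_abse_integral _ T R leb D (EFin \o h) mD mhE).
  rewrite /wnorm -ge0_integralZl //; last 2 first.
  - exact: mmw.
  - by move=> x; rewrite half_lineE => /nn; rewrite lee_fin.
  apply: ge0_le_integral => //.
  - by apply: measurableT_comp => //; have /integrableP[] := hI.
  - by have /integrableP[] := KI.
  - move=> x; rewrite half_lineE => x0; rewrite -EFinM abse_EFin lee_fin.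
    by apply: le_trans (hb x) (bnd x x0).
have [Ir Br] := part _ mpr (fun x => Re_le_modulus _).
have [Ii Bi] := part _ mpi (fun x => Im_le_modulus _).
split=> //.
apply: (@le_trans _ _ (`|Re (cintegral (fun x => f x * chi x))|%:E +
    `|Im (cintegral (fun x => f x * chi x))|%:E)%E).
  by rewrite -EFinD lee_fin modulus_le.
apply: le_trans (leeD Br Bi) _.
rewrite -ge0_muleDl ?lee_fin // -EFinD.
by rewrite (_ : K + K = 2 * K) //; ring.
Qed.

Lemma Re_iter_xD k phi : Re \o iter k xD phi = iter k rxD (Re \o phi).
Proof.
elim: k => [|k IH] //=; rewrite -IH; apply/funext => x.
by rewrite /xD /rxD /= mul0r subr0.
Qed.

Lemma Im_iter_xD k phi : Im \o iter k xD phi = iter k rxD (Im \o phi).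
Proof.
elim: k => [|k IH] //=; rewrite -IH; apply/funext => x.
by rewrite /xD /rxD /= mul0r addr0.
Qed.

Let cunweight phi : R -> R[i] := fun y => (y `^ (- mu - 2^-1))%:C * phi y.

Let Re_cunweight phi : Re \o cunweight phi = unweight mu (Re \o phi).
Proof. by apply/funext => x; rewrite /= ReZ. Qed.

Let Im_cunweight phi : Im \o cunweight phi = unweight mu (Im \o phi).
Proof. by apply/funext => x; rewrite /= ImZ. Qed.

Let gammaE m k phi x :
  (Re ((x ^+ m)%:C * iter k xD (cunweight phi) x) =
     x ^+ m * iter k rxD (unweight mu (Re \o phi)) x) *
  (Im ((x ^+ m)%:C * iter k xD (cunweight phi) x) =
     x ^+ m * iter k rxD (unweight mu (Im \o phi)) x).
Proof.
by rewrite ReZ ImZ -Re_cunweight -Im_cunweight -Re_iter_xD -Im_iter_xD.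
Qed.

Lemma gamma_le m k phi (K : R) : (gamma_ mu m k phi <= K%:E)%E ->
  forall x, 0 < x -> modulus ((x ^+ m)%:C * iter k xD (cunweight phi) x) <= K.
Proof.
move=> gK x x0; rewrite -lee_fin; apply: le_trans gK.
by apply: ereal_sup_ubound; exists x; rewrite ?half_lineE.
Qed.

Lemma gamma_fin m k phi : (gamma_ mu m k phi < +oo)%E ->
  exists K, (gamma_ mu m k phi <= K%:E)%E.
Proof.
case: (gamma_ mu m k phi) => [r _|//|_]; first by exists r.
by exists 0; rewrite leNye.
Qed.

Lemma in_H_real phi : in_H mu phi <->
  real_test mu (Re \o phi) /\ real_test mu (Im \o phi).
Proof.
split=> [[sphi gphi]|[[sr br] [si bi]]].
  split; split.
  - by move=> n x x0; have [] := sphi n x x0.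
  - move=> m k; have [K /gamma_le gK] := gamma_fin (gphi m k); exists K => x x0.
    apply: le_trans (gK x x0); rewrite -(gammaE m k phi x).1; exact: Re_le_modulus.
  - by move=> n x x0; have [] := sphi n x x0.
  - move=> m k; have [K /gamma_le gK] := gamma_fin (gphi m k); exists K => x x0.
    apply: le_trans (gK x x0); rewrite -(gammaE m k phi x).2; exact: Im_le_modulus.
split=> [n x x0|m k]; first by split; [exact: sr|exact: si].
have [K1 h1] := br m k; have [K2 h2] := bi m k.
apply: (@le_lt_trans _ _ (K1 + K2)%:E); last exact: ltry.
apply: ge_ereal_sup => _ [x xD <-]; move: xD; rewrite half_lineE lee_fin => x0.
apply: le_trans (modulus_le _) _; rewrite !(gammaE m k phi x).
by apply: lerD; [exact: h1|exact: h2].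
Qed.

Lemma Re_bessel phi : Re \o bessel mu phi = rbessel mu (Re \o phi).
Proof.
by apply/funext => x; rewrite /bessel /= ReD ReN ReZ.
Qed.

Lemma Im_bessel phi : Im \o bessel mu phi = rbessel mu (Im \o phi).
Proof.
by apply/funext => x; rewrite /bessel /= ImD ImN ImZ.
Qed.

Lemma in_H_bessel phi : in_H mu phi -> in_H mu (bessel mu phi).
Proof.
move=> /in_H_real[tr ti]; apply/in_H_real; rewrite Re_bessel Im_bessel.
by split; exact: real_test_bessel.
Qed.

Lemma in_H_cmeasurable phi : in_H mu phi -> cmeasurable phi.
Proof.
move=> /in_H_real[[sr _] [si _]]; split; apply: pos_continuous_measurable => //;
  exact: smooth_continuous.
Qed.

(** [(1 + x) ^ M] is at most [2 ^ M * (1 + x ^ M)], so that two seminorms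
    suffice. *)
Lemma gamma_test_bound phi (K : R) : (gamma_ mu 0 0 phi <= K%:E)%E ->
  (gamma_ mu (wM mu) 0 phi <= K%:E)%E ->
  forall x, 0 < x -> modulus (phi x) <= 2 ^+ (wM mu) * (2 * K) * ww x.
Proof.
have [M EM] : exists M, M = wM mu by eexists.
move=> /gamma_le g0 /gamma_le; rewrite -EM => gM x x0.
have := gM x x0; have := g0 x x0; rewrite /= /cunweight !modulusM !modulus_real.
set r := x `^ (- mu - 2^-1); have r0 : 0 < r by rewrite powR_gt0.
have rom : om mu x * r = 1 by rewrite mulrC; exact: r_om.
have xM0 : 0 <= x ^+ M by rewrite exprn_ge0 // ltW.
rewrite expr0 normr1 mul1r (ger0_norm (ltW r0)) (ger0_norm xM0) => h0 hM.
have x10 : 0 < 1 + x by lra.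
rewrite /ww -EM.
have om0 := om_gt0 mu x0.
set u := modulus (phi x) in h0 hM *.
have -> : u = om mu x * (r * u) by rewrite mulrA rom mul1r.
rewrite [leRHS]mulrCA; apply: ler_wpM2l; first exact: ltW.
rewrite ler_pdivlMr ?exprn_gt0 //.
have ru0 : 0 <= r * u by rewrite mulr_ge0 ?modulus_ge0 // ltW.
have e : (1 + x) ^+ M <= 2 ^+ M * (1 + x ^+ M).
  have [x1|x1] := leP x 1.
    apply: (@le_trans _ _ (2 ^+ M)).
      by apply: lerXn2r; rewrite ?nnegrE ?(ltW x10) //; lra.
    by rewrite ler_peMr ?exprn_ge0 // lerDl.
  apply: (@le_trans _ _ ((2 * x) ^+ M)).
    by apply: lerXn2r; rewrite ?nnegrE ?(ltW x10) ?mulr_ge0 ?(ltW x0) //; lra.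
  by rewrite exprMn; apply: ler_wpM2l; rewrite ?exprn_ge0 ?lerDr.
apply: le_trans (ler_wpM2l ru0 e) _.
rewrite mulrCA; apply: ler_wpM2l; first exact: exprn_ge0.
by rewrite mulrDr mulr1 (mulrC (r * u)); lra.
Qed.

Lemma in_H_bound phi : in_H mu phi -> exists K, 0 <= K /\
  forall x, 0 < x -> modulus (phi x) <= K * ww x.
Proof.
move=> [_ g]; have [K0 h0] := gamma_fin (g 0%N 0%N).
have [KM hM] := gamma_fin (g (wM mu) 0%N).
pose K := `|K0| + `|KM|; have K00 : 0 <= K by rewrite addr_ge0.
exists (2 ^+ wM mu * (2 * K)); split; first by rewrite !mulr_ge0 ?exprn_ge0.
apply: gamma_test_bound.
  apply: le_trans h0 _; rewrite lee_fin /K; have := ler_norm K0.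
  by have := normr_ge0 KM; lra.
apply: le_trans hM _; rewrite lee_fin /K; have := ler_norm KM.
by have := normr_ge0 K0; lra.
Qed.

Lemma in_H_pairing f phi : cmeasurable f -> (wnorm f < +oo)%E -> in_H mu phi ->
  cintegrable (fun x => f x * phi x).
Proof.
move=> mf fN Hphi; have [K [K0 phiK]] := in_H_bound Hphi.
by have [] := weighted_cintegrable mf fN (in_H_cmeasurable Hphi) K0 phiK.
Qed.

(** Continuity holds because two seminorms of a test function bound its quotient
    by [ww]. *)
Lemma pairing_in_dual f : cmeasurable f -> (wnorm f < +oo)%E ->
  in_dual mu (fun phi => cintegral (fun x => f x * phi x)).
Proof.
move=> mf fN; split=> [c phi psi Hphi Hpsi|phi Hphi e e0].
  rewrite -cintegralZ; last exact: in_H_pairing.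
  have I1 := cintegrableZ c (in_H_pairing mf fN Hphi).
  rewrite -(cintegralD I1 (in_H_pairing mf fN Hpsi)).
  by apply: eq_cintegral => x x0; rewrite /cscale !fctE; ring.
have [A AE] : exists A : R, wnorm f = A%:E.
  exists (fine (wnorm f)); rewrite fineK // ge0_fin_numE //.
  apply: integral_ge0 => x; rewrite half_lineE => x0.
  by rewrite lee_fin mulr_ge0 ?modulus_ge0 // ltW // ww_gt0.
have A0 : 0 <= A.
  rewrite -lee_fin -AE; apply: integral_ge0 => x; rewrite half_lineE => x0.
  by rewrite lee_fin mulr_ge0 ?modulus_ge0 // ltW // ww_gt0.
have [M EM] : exists M, M = wM mu by eexists.
pose B : R := 2 ^+ M * 4 * (A + 1).
have B0 : 0 < B by rewrite !mulr_gt0 ?exprn_gt0 //; lra.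
exists M, (e / B); split; first by rewrite divr_gt0.
move=> psi Hpsi gpsi.
have chiK := @gamma_test_bound (psi - phi) (e / B).
have Hc : cmeasurable (psi - phi).
  by apply: cmeasurableD; [|apply: cmeasurableN]; exact: in_H_cmeasurable.
have eB : 0 <= e / B by rewrite divr_ge0 ?ltW.
have {}chiK := chiK (ltW (gpsi 0%N 0%N (leq0n _) (leq0n _))).
rewrite -EM in chiK.
have {}chiK := chiK (ltW (gpsi M 0%N (leqnn _) (leq0n _))).
have K0 : 0 <= 2 ^+ M * (2 * (e / B)) by rewrite mulr_ge0 ?exprn_ge0 // mulr_ge0.
have [_] := weighted_cintegrable mf fN Hc K0 chiK.
have -> : cintegral (fun x => f x * (psi - phi) x) =
    cintegral (fun x => f x * psi x) - cintegral (fun x => f x * phi x).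
  have Ip := in_H_pairing mf fN Hpsi; have Iq := in_H_pairing mf fN Hphi.
  apply/eqP; rewrite -subr_eq opprK eq_sym; apply/eqP.
  have I3 : cintegrable (fun x => f x * (psi - phi) x).
    by have [] := weighted_cintegrable mf fN Hc K0 chiK.
  rewrite -(cintegralD I3 Iq); apply: eq_cintegral => x _; rewrite !fctE; ring.
move=> h; rewrite -lte_fin; apply: le_lt_trans h _.
rewrite AE -EFinM lte_fin.
have -> : 2 * (2 ^+ M * (2 * (e / B))) * A = e * (A / (A + 1)).
  by rewrite /B; field; rewrite expf_neq0 // andbT gt_eqF //; lra.
by rewrite -[ltRHS]mulr1 ltr_pM2l // ltr_pdivrMr; lra.
Qed.

Definition weak_bessel f g := forall phi, in_H mu phi ->
  cintegral (fun x => f x * bessel mu phi x) = cintegral (fun x => g x * phi x).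

(** The functional in the definition of the part is the pairing with [f], which
    is continuous as soon as [f] lies in the ambient space. *)
Lemma bessel_partP N f g : (forall f, in_space N f -> (wnorm f < +oo)%E) ->
  bessel_part mu N f g <-> [/\ in_space N f, in_space N g & weak_bessel f g].
Proof.
move=> Nw; split=> [[sf sg [u [du uf ug]]]|[sf sg fg]].
  split=> // phi Hphi.
  by rewrite -(ug _ Hphi) -(uf _ (in_H_bessel Hphi)).
split=> //; exists (fun phi => cintegral (fun x => f x * phi x)); split=> //.
apply: pairing_in_dual; [by have [] := sf|exact: Nw].
Qed.

End complex_values.

(** * Norms compatible with the Green kernel *)

Section compatible_norms.
Context {R : realType}.
Local Notation leb := (@lebesgue_measure R).
Local Notation T := (measurableTypeR R).
Local Notation D := (half_line : set T).
Local Notation Re := (@complex.Re R).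
Local Notation Im := (@complex.Im R).
Local Notation F := (R -> R[i]).
Implicit Types (f g phi : F).

Let mD : measurable D := @measurable_half_line R.

(** The properties of a norm on which closedness and non-negativity rest: it is
    monotone in the modulus, its space embeds in the ambient weighted L1 space,
    and Schur's test holds for the Green kernel with the constant [1 / lam]. *)
Record compatible_norm (mu : R) (N : F -> \bar R) : Prop := CompatibleNorm {
  compatible_mono : forall f g, cmeasurable f -> cmeasurable g ->
    (\forall x \ae leb, D x -> modulus (f x) <= modulus (g x)) -> (N f <= N g)%E;
  compatible_scale : forall (c : R) f, 0 <= c -> cmeasurable f ->
    (N (cscale c%:C f) <= c%:E * N f)%E;
  compatible_add : forall f g, in_space N f -> in_space N g -> (N (f + g)%R < +oo)%E;
  compatible_embed : exists C : R, 0 < C /\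
    forall f, in_space N f -> (wnorm mu f <= C%:E * N f)%E;
  compatible_schur : forall (lam : R) f g, 0 < lam -> cmeasurable f -> in_space N g ->
    (forall x, 0 < x -> ((modulus (f x))%:E <=
       \int[leb]_(y in D) (green mu lam x y * modulus (g y))%:E)%E) ->
    (N f <= (lam^-1)%:E * N g)%E
}.

Variables (mu : R) (N : F -> \bar R).
Hypotheses (hmu : - 2^-1 < mu) (cN : compatible_norm mu N).

Lemma in_space_wnorm f : in_space N f -> (wnorm mu f < +oo)%E.
Proof.
move=> sf; have [C [C0 emb]] := compatible_embed cN.
by apply: le_lt_trans (emb _ sf) _; apply: lte_mul_pinfty; [rewrite lee_fin ltW| |case: sf].
Qed.

Lemma in_spaceN f : in_space N f -> in_space N (- f).
Proof.
move=> [mf Nf]; split; first exact: cmeasurableN.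
apply: le_lt_trans Nf; apply: (compatible_mono cN) => //; first exact: cmeasurableN.
by apply: aeW => x _; rewrite modulusN.
Qed.

Lemma in_spaceD f g : in_space N f -> in_space N g -> in_space N (f + g).
Proof.
move=> sf sg; split; last exact: (compatible_add cN).
by apply: cmeasurableD; [case: sf|case: sg].
Qed.

Lemma in_spaceZ (c : R) f : 0 <= c -> in_space N f -> in_space N (cscale c%:C f).
Proof.
move=> c0 [mf Nf]; split; first exact: cmeasurableZ.
apply: le_lt_trans (compatible_scale cN c0 mf) _.
by apply: lte_mul_pinfty => //; rewrite lee_fin.
Qed.

Lemma in_space_weighted_L1 f : in_space N f ->
  weighted_L1 mu (Re \o f) /\ weighted_L1 mu (Im \o f).
Proof. by move=> sf; apply: wnorm_weighted_L1; [case: sf|exact: in_space_wnorm]. Qed.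

Lemma in_space_pairing f phi : in_space N f -> in_H mu phi ->
  cintegrable (fun x => f x * phi x).
Proof. by move=> sf; apply: in_H_pairing => //; [case: sf|exact: in_space_wnorm]. Qed.

Lemma bessel_part_weak f g : bessel_part mu N f g <->
  [/\ in_space N f, in_space N g & weak_bessel mu f g].
Proof. exact: bessel_partP in_space_wnorm. Qed.

Lemma pairing_bound chi (K : R) : cmeasurable chi -> 0 <= K ->
  (forall x, 0 < x -> modulus (chi x) <= K * ww mu x) ->
  exists C : R, 0 <= C /\ forall f, in_space N f ->
    ((modulus (cintegral (fun x => f x * chi x)))%:E <= C%:E * N f)%E.
Proof.
move=> mchi K0 chiK; have [C [C0 emb]] := compatible_embed cN.
exists (2 * K * C); split; first by rewrite !mulr_ge0 // ltW.
move=> f sf; have [mf _] := sf.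
have [_ h] := weighted_cintegrable mf (in_space_wnorm sf) mchi K0 chiK.
apply: le_trans h _; rewrite (EFinM (2 * K) C) -muleA; apply: lee_wpmul2l; last exact: emb.
by rewrite lee_fin mulr_ge0.
Qed.

Lemma cintegral_pairingB f g phi : in_space N f -> in_space N g -> in_H mu phi ->
  cintegral (fun x => (f - g) x * phi x) =
  cintegral (fun x => f x * phi x) - cintegral (fun x => g x * phi x).
Proof.
move=> sf sg Hphi; apply/eqP; rewrite -subr_eq opprK eq_sym; apply/eqP.
rewrite -cintegralD.
- by apply: eq_cintegral => x _; rewrite !fctE; ring.
- by apply: in_space_pairing => //; apply: in_spaceD => //; exact: in_spaceN.
- exact: in_space_pairing.
Qed.

(** Both sides of the weak equation are continuous in the norm, for a fixed test
    function. *)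
Lemma bessel_part_closed : closed_operator N (bessel_part mu N).
Proof.
move=> f_ g_ f g Afg sf sg fc gc; apply/bessel_part_weak; split=> // phi Hphi.
have HS := in_H_bessel Hphi.
have [K1 [K10 b1]] := in_H_bound HS; have [K2 [K20 b2]] := in_H_bound Hphi.
have [C1 [C10 c1]] := pairing_bound (in_H_cmeasurable HS) K10 b1.
have [C2 [C20 c2]] := pairing_bound (in_H_cmeasurable Hphi) K20 b2.
set z := cintegral (fun x => f x * bessel mu phi x).
set w := cintegral (fun x => g x * phi x).
have bnd n : ((modulus (z - w)%R)%:E <= C1%:E * N (f_ n - f)%R + C2%:E * N (g_ n - g)%R)%E.
  have [sfn sgn fgn] := (bessel_part_weak _ _).1 (Afg n).
  have sf' : in_space N (f_ n - f) by apply: in_spaceD => //; exact: in_spaceN.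
  have sg' : in_space N (g_ n - g) by apply: in_spaceD => //; exact: in_spaceN.
  apply: le_trans (leeD (c1 _ sf') (c2 _ sg')); rewrite -EFinD lee_fin.
  rewrite !cintegral_pairingB // (fgn _ Hphi) -/z -/w.
  set v := cintegral _.
  have -> : z - w = - (v - z) + (v - w) by ring.
  by apply: le_trans (modulusD _ _) _; rewrite modulusN.
have lim : (C1%:E * N (f_ n - f)%R + C2%:E * N (g_ n - g)%R @[n --> \oo] -->
    C1%:E * 0 + C2%:E * 0)%E.
  by apply: cvgeD; [rewrite !mule0|exact: cvgeZl|exact: cvgeZl].
rewrite !mule0 adde0 in lim.
have : ((modulus (z - w)%R)%:E <= 0)%E.
  by apply: (cvge_to_ge lim); apply: nearW.
rewrite lee_fin => h; apply/eqP; rewrite -subr_eq0; apply/eqP.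
by apply: modulus_eq0; apply/eqP; rewrite eq_le h modulus_ge0.
Qed.

Section resolvent_equation.
Variable lam : R.
Hypothesis lam0 : 0 < lam.
Local Notation resolvent := (resolvent mu lam).
Local Notation green := (green mu lam).

Lemma real_resolvent_weak (g phi : R -> R) : weighted_L1 mu g ->
  weighted_L1 mu (resolvent (fun y => `|g y|)) -> real_test mu phi ->
  \int[leb]_(x in D) (resolvent g x * (lam * phi x - rbessel mu phi x)) =
  \int[leb]_(x in D) (g x * phi x).
Proof.
move=> wg wBg tphi; have [sphi _] := tphi.
pose Phi := unweight mu phi; have sPhi : smooth Phi by exact: smooth_unweight.
have f0 : fast_decay Phi := @real_test_decay _ _ _ 0 tphi.
have f1 : fast_decay (iter 1 rxD Phi) := @real_test_decay _ _ _ 1 tphi.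
have f2 : fast_decay (iter 2 rxD Phi) := @real_test_decay _ _ _ 2 tphi.
have uE x : 0 < x -> lam * Phi x - rbessel_unweight mu Phi x =
    lam * Phi x - (derive1 (derive1 Phi) x + (2 * mu + 1) * (derive1 Phi x / x)).
  move=> x0; rewrite /rbessel_unweight (eq_derive1 (fun y y0 => derive1_rxD Phi y0) x0).
  rewrite (has_derivativeE (rxD_derive sPhi) x0) (derive1_rxD Phi x0) /=.
  by field; rewrite gt_eqF.
have fu : fast_decay (fun x => lam * Phi x - (derive1 (derive1 Phi) x + (2 * mu + 1) * (derive1 Phi x / x))).
  apply: (eq_fast_decay uE); apply: fast_decayD; first exact: fast_decayZ.
  have : fast_decay (fun x => - 1 * (x * (x * iter 2 rxD Phi x) + (2 * mu + 2) * iter 1 rxD Phi x)).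
    apply: fast_decayZ; apply: fast_decayD; last exact: fast_decayZ.
    by do 2 apply: fast_decayX.
  by apply: eq_fast_decay => x _; rewrite /rbessel_unweight mulN1r mulrA.
have fd : fast_decay (derive1 Phi).
  by apply: (eq_fast_decay (fun x x0 => esym (derive1_rxD Phi x0))); exact: fast_decayX.
have s1 := smooth_derive1 sPhi; have s2 := smooth_derive1 s1.
have := resolvent_weak hmu lam0 (smooth_has_derivative sPhi) (smooth_has_derivative s1)
  (smooth_continuous s2) f0 fd fu wg wBg.
move=> E; transitivity (\int[leb]_(x in D) (resolvent g x * (om mu x *
    (lam * Phi x - (derive1 (derive1 Phi) x + (2 * mu + 1) * (derive1 Phi x / x)))))).
  apply: eq_Rintegral => x /set_mem; rewrite half_lineE => x0.
  by rewrite -uE // (rbesselE _ sphi x0) -{1}(unweightE mu phi x0) -/Phi; ring.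
rewrite E; apply: eq_Rintegral => x /set_mem; rewrite half_lineE => x0.
by rewrite unweightE.
Qed.

Definition cresolvent g : F := fun x => resolvent (Re \o g) x +i* resolvent (Im \o g) x.

Let modulus_resolvent g := resolvent (modulus \o g).

Lemma modulus_weighted_L1 g : cmeasurable g -> (wnorm mu g < +oo)%E ->
  weighted_L1 mu (modulus \o g).
Proof.
move=> mg gN; split; first exact: cmeasurable_modulus.
apply/integrableP; split.
  apply/measurable_EFinP; apply: measurable_funM; first exact: cmeasurable_modulus.
  by apply: pos_continuous_measurable => //; exact: ww_continuous.
apply: le_lt_trans gN; apply: eqW.
apply: eq_integral => x /set_mem; rewrite half_lineE => x0.
by rewrite gee0_abs // lee_fin mulr_ge0 ?modulus_ge0 // ltW // ww_gt0.
Qed.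

Lemma cresolvent_measurable g : cmeasurable g -> cmeasurable (cresolvent g).
Proof.
by move=> [mr mi]; split; apply: resolvent_measurable.
Qed.

Lemma resolvent_le (h k : R -> R) x : 0 < x -> weighted_L1 mu h -> weighted_L1 mu k ->
  (forall y, h y <= k y) -> resolvent h x <= resolvent k x.
Proof.
move=> x0 wh wk hk; apply: le_Rintegral => //; [exact: green_integrable..|].
by move=> y; rewrite half_lineE => y0; apply: ler_wpM2l => //; exact: green_ge0.
Qed.

(** The inequality for the real part of the product with the conjugate of
    the value at [x] is the one for the modulus: bounding the two parts
    separately would lose a constant. *)
Lemma cresolvent_le g x : 0 < x -> in_space N g ->
  modulus (cresolvent g x) <= modulus_resolvent g x.
Proof.
move=> x0 sg; have [wr wi] := in_space_weighted_L1 sg.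
have [mg _] := sg.
have wm := modulus_weighted_L1 mg (in_space_wnorm sg).
set z := cresolvent g x.
have Bz : 0 <= modulus_resolvent g x.
  apply: Rintegral_ge0 => y; rewrite half_lineE => y0.
  by rewrite mulr_ge0 ?modulus_ge0 // green_ge0.
have key : modulus z ^+ 2 <= modulus z * modulus_resolvent g x.
  have Z (c : R) (h : R -> R) : weighted_L1 mu h ->
      leb.-integrable D (EFin \o (fun y => c * (green x y * h y))).
    by move=> wh; apply: integrable_scale; exact: green_integrable.
  rewrite modulus_sqr !expr2 -[X in X * _ + _]/(resolvent (Re \o g) x).
  have -> : resolvent (Re \o g) x * Re z + Im z * Im z =
    \int[leb]_(y in D) (Re z * (green x y * Re (g y)) + Im z * (green x y * Im (g y))).
    rewrite RintegralD //; [|exact: (Z _ _ wr)|exact: (Z _ _ wi)].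
    rewrite !RintegralZl //; do ?[exact: (green_integrable hmu lam0 x0 wi)|exact: (green_integrable hmu lam0 x0 wr)].
  rewrite /modulus_resolvent /(resolvent _ _) -RintegralZl //; last exact: green_integrable.
  apply: le_Rintegral => //.
  - exact: (@integrableD _ T R leb D mD _ _ (Z _ _ wr) (Z _ _ wi)).
  - exact: (Z (modulus z) _ wm).
  move=> y; rewrite half_lineE => y0.
  have G0 := green_ge0 hmu lam0 x0 y0.
  have -> : Re z * (green x y * Re (g y)) + Im z * (green x y * Im (g y)) =
    green x y * (Re z * Re (g y) + Im z * Im (g y)) by ring.
  rewrite mulrCA; apply: ler_wpM2l => //.
  have h : `|Re (conjc z * g y)| <= modulus (conjc z * g y) by exact: Re_le_modulus.
  apply: le_trans (le_trans (ler_norm _) _); last first.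
    apply: le_trans h _; rewrite modulusM.
    by rewrite (_ : modulus (conjc z) = modulus z) // !modulusE; case: (z) => a b /=; rewrite sqrrN.
  by rewrite ReM; case: (z) => a b /=; rewrite mulNr opprK.
have [z0|z0] := eqVneq (modulus z) 0; first by rewrite z0.
have z1 : 0 < modulus z by rewrite lt_def z0 modulus_ge0.
by rewrite -(ler_pM2l z1) -expr2.
Qed.

Lemma cresolvent_norm g : in_space N g -> (N (cresolvent g) <= (lam^-1)%:E * N g)%E.
Proof.
move=> sg; have [mg _] := sg.
apply: (compatible_schur cN lam0) => //; first exact: cresolvent_measurable.
move=> x x0; have wm := modulus_weighted_L1 mg (in_space_wnorm sg).
by rewrite -(resolvent_EFin hmu lam0 x0 wm) lee_fin cresolvent_le.
Qed.

Lemma in_space_cresolvent g : in_space N g -> in_space N (cresolvent g).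
Proof.
move=> sg; split; first by apply: cresolvent_measurable; case: sg.
apply: le_lt_trans (cresolvent_norm sg) _; apply: lte_mul_pinfty => //; last by case: sg.
by rewrite lee_fin invr_ge0 ltW.
Qed.

(** The absolute convergence that the exchange of integrations in
    [resolvent_weak] requires; it comes from Schur's test applied to the
    modulus. *)
Lemma modulus_resolvent_weighted_L1 g : in_space N g ->
  weighted_L1 mu (modulus_resolvent g).
Proof.
move=> sg; have [mg Ng] := sg.
have wm := modulus_weighted_L1 mg (in_space_wnorm sg).
have mB : measurable_fun D (modulus_resolvent g) by apply: resolvent_measurable; case: wm.
pose b : F := fun x => (modulus_resolvent g x)%:C.
have sb : in_space N b.
  have mb : cmeasurable b by split => //; exact: measurable_cst.
  split=> //; apply: (@le_lt_trans _ _ ((lam^-1)%:E * N g)%E).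
    apply: (compatible_schur cN lam0) => // x x0.
    rewrite -(resolvent_EFin hmu lam0 x0 wm) lee_fin modulus_real ger0_norm //.
    apply: Rintegral_ge0 => y; rewrite half_lineE => y0.
    by rewrite mulr_ge0 ?modulus_ge0 // green_ge0.
  by apply: lte_mul_pinfty => //; rewrite lee_fin invr_ge0 ltW.
by have [] := in_space_weighted_L1 sb.
Qed.

Lemma part_resolvent_weighted_L1 g (h : R -> R) : in_space N g -> weighted_L1 mu h ->
  (forall y, `|h y| <= modulus (g y)) ->
  weighted_L1 mu (resolvent (fun y => `|h y|)).
Proof.
move=> sg wh hg; have wah := weighted_L1_norm wh; have [mg _] := sg.
have wm := modulus_weighted_L1 mg (in_space_wnorm sg).
have [mB IB] := modulus_resolvent_weighted_L1 sg.
have mres : measurable_fun D (resolvent (fun y => `|h y|)).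
  by apply: resolvent_measurable; case: wah.
split=> //; apply: le_integrable IB => //.
  apply/measurable_EFinP; apply: measurable_funM => //.
  by apply: pos_continuous_measurable => //; exact: ww_continuous.
move=> x; rewrite half_lineE => x0; rewrite !abse_EFin lee_fin !normrM.
apply: ler_wpM2r => //.
have r0 : 0 <= resolvent (fun y => `|h y|) x.
  by apply: Rintegral_ge0 => y; rewrite half_lineE => y0; rewrite mulr_ge0 // green_ge0.
rewrite (ger0_norm r0); apply: le_trans (ler_norm _).
by apply: resolvent_le => // y; exact: hg.
Qed.

Lemma cresolvent_weak g phi : in_space N g -> in_H mu phi ->
  cintegral (fun x => cresolvent g x * (lam%:C * phi x - bessel mu phi x)) =
  cintegral (fun x => g x * phi x).
Proof.
move=> sg Hphi; have [wr wi] := in_space_weighted_L1 sg.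
have [tr ti] := (in_H_real mu phi).1 Hphi.
have Br := part_resolvent_weighted_L1 sg wr (fun y => Re_le_modulus (g y)).
have Bi := part_resolvent_weighted_L1 sg wi (fun y => Im_le_modulus (g y)).
have [mg _] := sg.
have sr := in_space_cresolvent sg; have [wrr wri] := in_space_weighted_L1 sr.
have [K [K0 bK]] := in_H_bound Hphi; have [K' [K'0 bK']] := in_H_bound (in_H_bessel Hphi).
pose psi x := lam%:C * phi x - bessel mu phi x.
have mpsi : cmeasurable psi.
  have := cmeasurableD (cmeasurableZ lam%:C (in_H_cmeasurable Hphi))
    (cmeasurableN (in_H_cmeasurable (in_H_bessel Hphi))).
  exact.
have Repsi x : Re (psi x) = lam * Re (phi x) - rbessel mu (Re \o phi) x.
  by rewrite /psi ReD ReZ ReN -Re_bessel.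
have Impsi x : Im (psi x) = lam * Im (phi x) - rbessel mu (Im \o phi) x.
  by rewrite /psi ImD ImZ ImN -Im_bessel.
have psiK x : 0 < x -> modulus (psi x) <= (lam * K + K') * ww mu x.
  move=> x0; apply: le_trans (modulusD _ _) _; rewrite modulusN modulusM modulus_real.
  rewrite (ger0_norm (ltW lam0)) mulrDl -mulrA; apply: lerD; last exact: bK'.
  by apply: ler_wpM2l; [exact: ltW|exact: bK].
have mRe : measurable_fun D (Re \o psi) by case: mpsi.
have mIm : measurable_fun D (Im \o psi) by case: mpsi.
have bRe x : 0 < x -> `|(Re \o psi) x| <= (lam * K + K') * ww mu x.
  by move=> x0; apply: le_trans (Re_le_modulus _) (psiK _ x0).
have bIm x : 0 < x -> `|(Im \o psi) x| <= (lam * K + K') * ww mu x.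
  by move=> x0; apply: le_trans (Im_le_modulus _) (psiK _ x0).
have mphi := in_H_cmeasurable Hphi.
have [mphir mphii] := mphi.
have cRe x : 0 < x -> `|(Re \o phi) x| <= K * ww mu x.
  by move=> x0; apply: le_trans (Re_le_modulus _) (bK _ x0).
have cIm x : 0 < x -> `|(Im \o phi) x| <= K * ww mu x.
  by move=> x0; apply: le_trans (Im_le_modulus _) (bK _ x0).
have E11 := real_resolvent_weak wr Br tr; have E12 := real_resolvent_weak wr Br ti.
have E21 := real_resolvent_weak wi Bi tr; have E22 := real_resolvent_weak wi Bi ti.
apply: complex_eq; rewrite /cintegral /=.
  transitivity (\int[leb]_(x in D) (resolvent (Re \o g) x * Re (psi x))
      - \int[leb]_(x in D) (resolvent (Im \o g) x * Im (psi x))).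
    rewrite -RintegralB //; last 2 first.
    - exact: (weighted_integrable wrr mRe bRe).
    - exact: (weighted_integrable wri mIm bIm).
    by apply: eq_Rintegral => x _; rewrite /= -[in LHS]/(psi x) ReM.
  transitivity (\int[leb]_(x in D) ((Re \o g) x * (Re \o phi) x)
      - \int[leb]_(x in D) ((Im \o g) x * (Im \o phi) x)).
    rewrite -E11 -E22; congr (_ - _); apply: eq_Rintegral => x _.
      by rewrite Repsi.
    by rewrite Impsi.
  rewrite -RintegralB //; last 2 first.
  - exact: (weighted_integrable wr mphir cRe).
  - exact: (weighted_integrable wi mphii cIm).
  by apply: eq_Rintegral => x _; rewrite /= ReM.
transitivity (\int[leb]_(x in D) (resolvent (Re \o g) x * Im (psi x))
    + \int[leb]_(x in D) (resolvent (Im \o g) x * Re (psi x))).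
  rewrite -RintegralD //; last 2 first.
  - exact: (weighted_integrable wrr mIm bIm).
  - exact: (weighted_integrable wri mRe bRe).
  by apply: eq_Rintegral => x _; rewrite /= -[in LHS]/(psi x) ImM.
transitivity (\int[leb]_(x in D) ((Re \o g) x * (Im \o phi) x)
    + \int[leb]_(x in D) ((Im \o g) x * (Re \o phi) x)).
  rewrite -E12 -E21; congr (_ + _); apply: eq_Rintegral => x _.
    by rewrite Impsi.
  by rewrite Repsi.
rewrite -RintegralD //; last 2 first.
- exact: (weighted_integrable wr mphii cIm).
- exact: (weighted_integrable wi mphir cRe).
by apply: eq_Rintegral => x _; rewrite /= ImM.
Qed.

End resolvent_equation.
End compatible_norms.

(** * Non-negativity *)

Section nonnegativity.
Context {R : realType}.
Local Notation leb := (@lebesgue_measure R).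
Local Notation T := (measurableTypeR R).
Local Notation D := (half_line : set T).
Local Notation Re := (@complex.Re R).
Local Notation Im := (@complex.Im R).
Local Notation F := (R -> R[i]).
Implicit Types (f g h phi : F).
Variables (mu : R) (N : F -> \bar R).
Hypotheses (hmu : - 2^-1 < mu) (cN : compatible_norm mu N).
Variable lam : R.
Hypothesis lam0 : 0 < lam.

Let mD : measurable D := @measurable_half_line R.
Let A := op_shift N lam (op_opp (bessel_part mu N)).

(** The Green operator is a right inverse. *)
Lemma shift_onto g : in_space N g -> A (cresolvent mu lam g) g.
Proof.
move=> sg; split=> //; set f := cresolvent mu lam g.
have sf : in_space N f := in_space_cresolvent hmu cN lam0 sg.
exists (g - cscale lam%:C f); last by apply: aeW => x _; rewrite !fctE; ring.
have sh : in_space N (- (g - cscale lam%:C f)).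
  apply: (in_spaceN cN); apply: (in_spaceD cN) => //; apply: (in_spaceN cN).
  by apply: (in_spaceZ cN) => //; exact: ltW.
apply/(bessel_part_weak cN); split=> // phi Hphi.
have E := cresolvent_weak hmu cN lam0 sg Hphi.
have I1 := in_space_pairing cN sf (in_H_bessel Hphi).
have I2 := in_space_pairing cN sg Hphi.
have I3 := in_space_pairing cN sh Hphi.
apply/eqP; rewrite -subr_eq0; apply/eqP.
have -> : cintegral (fun x => f x * bessel mu phi x) -
    cintegral (fun x => (- (g - cscale lam%:C f)) x * phi x) =
    cintegral (fun x => g x * phi x) -
    cintegral (fun x => f x * (lam%:C * phi x - bessel mu phi x)).
  have I4 : cintegrable (fun x => f x * (lam%:C * phi x - bessel mu phi x)).
    have J1 := cintegrableZ lam%:C (in_space_pairing cN sf Hphi).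
    suff <- : cscale lam%:C (fun x => f x * phi x) +
        cscale (-1) (fun x => f x * bessel mu phi x) =
        (fun x => f x * (lam%:C * phi x - bessel mu phi x)).
      exact: cintegrableD J1 (cintegrableZ (-1) I1).
    by apply/funext => x; rewrite /cscale !fctE; ring.
  apply/eqP; rewrite subr_eq addrAC -subr_eq opprK; apply/eqP.
  rewrite -!cintegralD //; apply: eq_cintegral => x _; rewrite !fctE /cscale; ring.
by rewrite E subrr.
Qed.

Lemma in_H_gauss t : 0 < t -> in_H mu (fun x => (gauss_test mu t x)%:C).
Proof.
by move=> t0; apply/in_H_real; split; [exact: real_test_gauss|exact: real_test0].
Qed.

Lemma bessel_gauss t x : bessel mu (fun x => (gauss_test mu t x)%:C) x =
  (rbessel mu (gauss_test mu t) x)%:C.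
Proof.
apply: complex_eq; first by rewrite -[LHS]/((Re \o bessel mu _) x) Re_bessel.
rewrite -[LHS]/((Im \o bessel mu _) x) Im_bessel /rbessel /=.
have -> : (Im \o (fun x => (gauss_test mu t x)%:C)) = (fun=> 0) by [].
have -> : derive1 (fun=> 0 : R) = (fun=> 0 : R) by apply/funext => y; rewrite derive1_cst.
by rewrite derive1_cst mulr0 subrr.
Qed.

(** The difference [d] of two solutions satisfies [S d = lam * d] weakly, for the
    Bessel operator [S]; only its values on Gaussians are used. *)
Lemma shift_injective f f' g g' : A f g -> A f' g' -> same_class g g' -> same_class f f'.
Proof.
move=> [sg [h Afh gfh]] [sg' [h' Afh' gfh']] gg'.
have [sf sh fh] := (bessel_part_weak cN _ _).1 Afh.
have [sf' sh' fh'] := (bessel_part_weak cN _ _).1 Afh'.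
pose d := f - f'; have sd : in_space N d.
  by apply: (in_spaceD cN) => //; exact: (in_spaceN cN).
pose k := - h - - h'.
have sk : in_space N k by apply: (in_spaceD cN) => //; exact: (in_spaceN cN).
have kd : \forall x \ae leb, D x -> k x = lam%:C * d x.
  have FF : Filter (nbhs (almost_everywhere leb)) by exact: (ae_filter_ringOfSetsType leb).
  apply: filterS3 gfh gfh' gg' => x E1 E2 E3 Dx.
  have := E3 Dx; rewrite (E1 Dx) (E2 Dx) /k /d /cscale !fctE => E.
  rewrite opprK mulrBr.
  have -> : lam%:C * f x = lam%:C * f' x + h' x - h x by rewrite -E; ring.
  by ring.
have weak : weak_bessel mu d k.
  move=> phi Hphi.
  have I1 := in_H_bessel Hphi.
  by rewrite /d /k !(cintegral_pairingB cN) // fh // fh'.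
have [wr wi] := in_space_weighted_L1 cN sd.
have [wkr wki] := in_space_weighted_L1 cN sk.
have gdecay t : 0 < t -> fast_decay (fun x : R => expR (- t * x ^+ 2)) by exact: gauss_decay.
have part (u v : R -> R) : weighted_L1 mu u -> weighted_L1 mu v ->
    (\forall x \ae leb, D x -> v x = lam * u x) ->
    (forall t, 0 < t -> \int[leb]_(y in D) (u y * rbessel mu (gauss_test mu t) y) =
       \int[leb]_(y in D) (v y * gauss_test mu t y)) ->
    u = (fun=> 0) %[ae leb in D].
  move=> wu wv uv E; apply: (weak_injective hmu lam0 wu) => t t0.
  rewrite E //.
  have cgauss : pos_continuous (fun x : R => expR (- t * x ^+ 2)).
    exact/smooth_continuous/smooth_gauss.
  have Iu := decay_integrable wu cgauss (gdecay t t0).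
  have Iv := decay_integrable wv cgauss (gdecay t t0).
  rewrite -RintegralZl //.
  rewrite /Rintegral; congr fine; apply: ae_eq_integral => //.
  - by have /integrableP[] := Iv.
  - by have /integrableP[] := @integrableZl _ T R leb D mD lam _ Iu.
  by apply: filterS uv => x E' Dx; rewrite /gauss_test E' //; congr (_%:E); ring.
have gweak t (t0 : 0 < t) := weak _ (in_H_gauss t0).
have zr : (Re \o d) = (fun=> 0) %[ae leb in D].
  apply: (part (Re \o d) (Re \o k)) => //.
    by apply: filterS kd => x E Dx; rewrite /= E // ReZ.
  move=> t t0; have /(congr1 Re) := gweak t t0; rewrite /cintegral /= => E.
  transitivity (\int[leb]_(x in D) Re (d x * bessel mu (fun x => (gauss_test mu t x)%:C) x)).
    by apply: eq_Rintegral => x _; rewrite bessel_gauss ReM /= mulr0 subr0.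
  rewrite [LHS]E; apply: eq_Rintegral => x _.
  by rewrite /= ReM /= mulr0 subr0.
have zi : (Im \o d) = (fun=> 0) %[ae leb in D].
  apply: (part (Im \o d) (Im \o k)) => //.
    by apply: filterS kd => x E Dx; rewrite /= E // ImZ.
  move=> t t0; have /(congr1 Im) := gweak t t0; rewrite /cintegral /= => E.
  transitivity (\int[leb]_(x in D) Im (d x * bessel mu (fun x => (gauss_test mu t x)%:C) x)).
    by apply: eq_Rintegral => x _; rewrite bessel_gauss ImM /= mulr0 add0r.
  rewrite [LHS]E; apply: eq_Rintegral => x _.
  by rewrite /= ImM /= mulr0 add0r.
apply: filterS2 zr zi => x Er Ei Dx; apply/eqP; rewrite -subr_eq0; apply/eqP.
by apply: complex_eq; [exact: Er|exact: Ei].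
Qed.

(** By uniqueness, [f] is the image of [g] under the Green operator. *)
Lemma shift_bound f g : A f g -> (N f <= (lam^-1)%:E * N g)%E.
Proof.
move=> Afg; have [sg _] := Afg.
have gg : same_class g g by apply: aeW => x _.
have ff' := shift_injective Afg (shift_onto sg) gg.
apply: le_trans (cresolvent_norm hmu cN lam0 sg).
have [_ [h Afh _]] := Afg; have [[mf _] _ _] := Afh.
apply: (compatible_mono cN) => //.
  by have [] := in_space_cresolvent hmu cN lam0 sg.
apply: filterS ff'; first exact: (ae_filter_ringOfSetsType leb).
by move=> x E Dx; rewrite E.
Qed.

End nonnegativity.

Lemma bessel_part_nonnegative (R : realType) (mu : R) (N : (R -> R[i]) -> \bar R) :
  - 2^-1 < mu -> compatible_norm mu N ->
  nonnegative_operator N (op_opp (bessel_part mu N)).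
Proof.
move=> hmu cN; split.
  move=> lam lam0; split.
  - by move=> f f' g g' A1 A2; exact: (shift_injective hmu cN lam0 A1 A2).
  - by move=> g sg; exists (cresolvent mu lam g); exact: shift_onto.
  - apply: (@le_lt_trans _ _ (lam^-1)%:E); last exact: ltry.
    apply: ge_ereal_sup => _ [g [f [Afg Ng ->]]].
    apply: le_trans (shift_bound hmu cN lam0 Afg) _.
    rewrite -[leRHS]mule1; apply: lee_wpmul2l => //.
    by rewrite lee_fin invr_ge0 ltW.
apply: (@le_lt_trans _ _ 1%E); last exact: ltry.
apply: ge_ereal_sup => _ [lam lam0 <-].
apply: ge_ereal_sup => _ [g [f [[h Ahg ->] Ng ->]]].
have mh : cmeasurable h by have [_ [? [[mh _] _ _] _]] := Ahg.
apply: le_trans (compatible_scale cN (ltW lam0) mh) _.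
apply: (@le_trans _ _ (lam%:E * ((lam^-1)%:E * N g))%E).
  by apply: lee_wpmul2l; [rewrite lee_fin ltW|exact: (shift_bound hmu cN lam0 Ahg)].
by rewrite muleA -EFinM mulfV ?gt_eqF // mul1e.
Qed.

(** * The weighted supremum norm *)

Section weighted_spaces.
Context {R : realType}.
Local Notation leb := (@lebesgue_measure R).
Local Notation T := (measurableTypeR R).
Local Notation D := (half_line : set T).
Local Notation F := (R -> R[i]).
Implicit Types (f g : F).
Variable mu : R.
Hypothesis hmu : - 2^-1 < mu.
Local Notation om := (om mu).
Local Notation ww := (ww mu).
Local Notation r_ := (r_ mu).
Local Notation s_ := (s_ mu).

Let mD : measurable D := @measurable_half_line R.

(* On a null space the essential supremum of every function would be [-oo]. *)
Let T_gt0 : (0 < leb [set: T])%E.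
Proof.
apply: (@lt_le_trans _ _ (leb (`[0, 1]%classic : set T))).
  by rewrite lebesgue_measure_itv /= lte_fin ltr01 oppr0 adde0 lte_fin.
apply: le_measure => //; apply: mem_set => //.
Qed.

Lemma r_ge0 x : 0 <= r_ x.
Proof. exact: powR_ge0. Qed.

Lemma Linfty_leP f (n : R) : 0 <= n -> (Linfty_norm mu f <= n%:E)%E <->
  (\forall x \ae leb, D x -> modulus (f x) <= n * om x).
Proof.
move=> n0; rewrite /Linfty_norm; split=> [/ess_supP h|h]; [|apply/ess_supP];
  apply: filterS h => x.
  move=> + Dx; rewrite /= patchE mem_set // lee_fin modulusM modulus_real.
  move: Dx; rewrite half_lineE ger0_norm ?r_ge0 // => x0 h.
  rewrite -[leLHS]mul1r -(r_om mu x0) mulrAC; apply: ler_wpM2r => //; exact: om_ge0.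
rewrite /= patchE; case: ifPn => [/set_mem Dx|_ _]; last by rewrite lee_fin.
move=> /(_ Dx); move: Dx; rewrite half_lineE => x0.
rewrite lee_fin modulusM modulus_real ger0_norm ?r_ge0 // => h.
apply: le_trans (ler_wpM2l (r_ge0 x) h) _.
by rewrite mulrCA r_om // mulr1.
Qed.

Lemma Linfty_ge0 f : (0 <= Linfty_norm mu f)%E.
Proof.
apply: ess_sup_gee => //; apply: aeW => x /=; rewrite patchE lee_fin.
by case: ifP => // _; exact: modulus_ge0.
Qed.

Lemma Linfty_fin f : (Linfty_norm mu f < +oo)%E ->
  exists n : R, 0 <= n /\ Linfty_norm mu f = n%:E.
Proof.
move=> fN; have fE : Linfty_norm mu f = (fine (Linfty_norm mu f))%:E.
  by rewrite fineK // ge0_fin_numE // Linfty_ge0.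
exists (fine (Linfty_norm mu f)); split=> //.
by rewrite -lee_fin -fE Linfty_ge0.
Qed.

Lemma Linfty_compatible : compatible_norm mu (Linfty_norm mu).
Proof.
have mono f g (c : R) : 0 <= c ->
    (\forall x \ae leb, D x -> modulus (f x) <= c * modulus (g x)) ->
    (Linfty_norm mu g < +oo)%E -> (Linfty_norm mu f <= c%:E * Linfty_norm mu g)%E.
  move=> c0 fg /Linfty_fin[n [n0 nE]]; rewrite nE -EFinM.
  apply/Linfty_leP; first exact: mulr_ge0.
  have /Linfty_leP-/(_ n0) : (Linfty_norm mu g <= n%:E)%E by rewrite nE.
  apply: filterS2 fg => x h1 h2 Dx; rewrite -mulrA; apply: le_trans (h1 Dx) _.
  by apply: ler_wpM2l => //; exact: h2.
have I := om_ww_integrable hmu.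
split.
- move=> f g _ _ fg; have [gy|gfin] := eqVneq (Linfty_norm mu g) +oo%E.
    by rewrite gy leey.
  rewrite -[leRHS]mul1e; apply: mono; rewrite ?ltey //.
  by apply: filterS fg => x h Dx; rewrite mul1r; exact: h.
- move=> c f c0 mf; have [gy|gfin] := eqVneq (Linfty_norm mu f) +oo%E.
    have [->|cn0] := eqVneq c 0; last first.
      by rewrite gy gt0_muley ?leey // lte_fin lt_neqAle eq_sym cn0.
    rewrite mul0e; apply/(Linfty_leP _ (lexx 0)); apply: aeW => x _.
    by rewrite /cscale modulusM modulus_real normr0 !mul0r.
  apply: mono => //; last by rewrite ltey.
  by apply: aeW => x _; rewrite /cscale modulusM modulus_real ger0_norm.
- move=> f g [_ /Linfty_fin[n [n0 nE]]] [_ /Linfty_fin[m [m0 mE]]].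
  apply: (@le_lt_trans _ _ (n + m)%:E); last exact: ltry.
  apply/Linfty_leP; first exact: addr_ge0.
  have /Linfty_leP-/(_ n0) h1 : (Linfty_norm mu f <= n%:E)%E by rewrite nE.
  have /Linfty_leP-/(_ m0) h2 : (Linfty_norm mu g <= m%:E)%E by rewrite mE.
  apply: filterS2 h1 h2 => x h1 h2 Dx; apply: le_trans (modulusD _ _) _.
  by rewrite mulrDl; apply: lerD; [exact: h1|exact: h2].
- pose W := \int[leb]_(x in D) (om x * ww x).
  have WE : (\int[leb]_(x in D) (om x * ww x)%:E = W%:E)%E.
    rewrite /W /Rintegral fineK //; exact: integrable_fin_num.
  have W0 : 0 <= W.
    rewrite /W Rintegral_ge0 // => x; rewrite half_lineE => x0.
    by rewrite mulr_ge0 ?om_ge0 // ltW // ww_gt0.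
  exists (W + 1); split; first lra.
  move=> f [mf /Linfty_fin[n [n0 nE]]].
  have /Linfty_leP-/(_ n0) h : (Linfty_norm mu f <= n%:E)%E by rewrite nE.
  apply: (@le_trans _ _ (n%:E * W%:E)%E); last first.
    by rewrite nE -!EFinM lee_fin mulrC ler_wpM2r // lerDl.
  have mI : measurable_fun D (fun x => (om x * ww x)%:E).
    by have /integrableP[] := I.
  have pos x : D x -> 0 <= om x * ww x.
    by rewrite half_lineE => x0; rewrite mulr_ge0 ?om_ge0 // ltW // ww_gt0.
  rewrite -WE -ge0_integralZl //.
  apply: ae_ge0_le_integral => //.
  - move=> x; rewrite half_lineE => x0.
    by rewrite lee_fin mulr_ge0 ?modulus_ge0 // ltW // ww_gt0.
  - apply/measurable_EFinP; apply: measurable_funM; first exact: cmeasurable_modulus.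
    by apply: pos_continuous_measurable => //; exact: ww_continuous.
  - by move=> x /pos; rewrite -EFinM lee_fin => ?; exact: mulr_ge0.
  - by apply: measurable_funeM.
  apply: filterS h => x h Dx; rewrite -EFinM lee_fin (mulrA n).
  apply: ler_wpM2r; last exact: h.
  by move: Dx; rewrite half_lineE => x0; rewrite ltW // ww_gt0.
- move=> lam f g lam0 mf [mg /Linfty_fin[n [n0 nE]]] fg.
  have /Linfty_leP-/(_ n0) h : (Linfty_norm mu g <= n%:E)%E by rewrite nE.
  rewrite nE -EFinM; apply/Linfty_leP; first by rewrite mulr_ge0 // invr_ge0 ltW.
  apply: aeW => x; rewrite half_lineE => x0.
  have mgr : measurable_fun D (green mu lam x).
    by apply: pos_continuous_measurable => //; exact: green_continuous.
  have mom : measurable_fun D om.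
    by apply: pos_continuous_measurable => //; exact: om_continuous.
  have g0 y : D y -> 0 <= green mu lam x y.
    by rewrite half_lineE => y0; exact: green_ge0.
  rewrite -lee_fin; apply: le_trans (fg x x0) _.
  rewrite (_ : lam^-1 * n * om x = n * (om x / lam)); last by ring.
  apply: (@le_trans _ _ (n%:E * \int[leb]_(y in D) (green mu lam x y * om y)%:E)%E); last first.
    by rewrite EFinM; apply: lee_wpmul2l; [rewrite lee_fin|exact: green_schur].
  rewrite -ge0_integralZl //; last 2 first.
  - by apply/measurable_EFinP; apply: measurable_funM; [exact: mgr|exact: mom].
  - by move=> y Dy; have ? := g0 _ Dy; rewrite lee_fin mulr_ge0 ?om_ge0.
  apply: ae_ge0_le_integral => //.
  - by move=> y Dy; have ? := g0 _ Dy; rewrite lee_fin mulr_ge0 ?modulus_ge0.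
  - by apply/measurable_EFinP; apply: measurable_funM; [exact: mgr|exact: (cmeasurable_modulus mg)].
  - by move=> y Dy; have ? := g0 _ Dy; rewrite -EFinM lee_fin; nonneg.
  - apply: measurable_funeM; apply/measurable_EFinP.
    by apply: measurable_funM; [exact: mgr|exact: mom].
  apply: filterS h => y h Dy; rewrite -EFinM lee_fin mulrCA.
  by apply: ler_wpM2l; [exact: g0|exact: h].
Qed.

End weighted_spaces.

(** * Jensen's inequality *)

Section power_means.
Context {R : realType}.
Local Notation leb := (@lebesgue_measure R).
Local Notation T := (measurableTypeR R).
Implicit Types (p A s : R).

(** The tangent to [s `^ p] at [A] lies below the graph. *)
Lemma powR_tangent p A s : 1 <= p -> 0 <= A -> 0 <= s ->
  p * A `^ (p - 1) * s <= s `^ p + (p - 1) * A `^ p.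
Proof.
rewrite le_eqVlt => /predU1P[<-|p1] A0 s0.
  by rewrite subrr powRr0 powRr1 // !mul1r mul0r addr0.
have p0 : 0 < p by lra.
have p10 : 0 < p - 1 by lra.
have q0 : 0 < p / (p - 1) by rewrite divr_gt0.
have := conjugate_powR s0 (powR_ge0 A (p - 1)) p0 q0.
rewrite -powRrM mulrCA divff ?gt_eqF // mulr1 => /(_ _)/wrap[].
  by field; rewrite !gt_eqF.
rewrite -(ler_pM2l p0) => h; apply: le_trans (_ : p * (s * A `^ (p - 1)) <= _).
  by apply: eqW; ring.
apply: le_trans h _; apply: eqW.
by field; rewrite !gt_eqF.
Qed.

Variables (D : set T) (p m : R) (w s : T -> R).
Hypotheses (mD : measurable D) (p1 : 1 <= p) (m0 : 0 < m).
Hypotheses (mw : measurable_fun D w) (ms : measurable_fun D s).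
Hypotheses (w0 : forall x, D x -> 0 <= w x) (s0 : forall x, D x -> 0 <= s x).
Hypothesis wm : (\int[leb]_(x in D) (w x)%:E <= m%:E)%E.

Let J := (\int[leb]_(x in D) (w x * s x `^ p)%:E)%E.
Let B := (\int[leb]_(x in D) (w x * s x)%:E)%E.

Let msp : measurable_fun D (fun x => w x * s x `^ p).
Proof.
by apply: measurable_funM => //; apply: (measurableT_comp (measurable_powR p)).
Qed.

(* For [A = 1] this bounds [B] by [J] and [m], hence makes it finite. *)
Let tangent_integral A : 0 <= A ->
  ((p * A `^ (p - 1))%:E * B <= J + ((p - 1) * A `^ p * m)%:E)%E.
Proof.
move=> A0; have hp := p1.
have c0 : 0 <= p * A `^ (p - 1) by rewrite mulr_ge0 ?powR_ge0 //; lra.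
have d0 : 0 <= (p - 1) * A `^ p by rewrite mulr_ge0 ?powR_ge0 //; lra.
rewrite (EFinM _ m).
apply: (@le_trans _ _ (J + ((p - 1) * A `^ p)%:E * \int[leb]_(x in D) (w x)%:E)%E); last first.
  by apply: leeD2l; apply: lee_wpmul2l.
have mws : measurable_fun D (fun x => w x * s x) by exact: measurable_funM.
rewrite /B /J -!ge0_integralZl //; do ?[exact/measurable_EFinP];
  try by move=> x Dx; rewrite lee_fin ?mulr_ge0 ?w0 ?s0.
rewrite -ge0_integralD //; last 4 first.
- by move=> x Dx; rewrite lee_fin mulr_ge0 ?w0 ?powR_ge0.
- exact/measurable_EFinP.
- by move=> x Dx; rewrite mule_ge0 ?lee_fin ?w0.
- by apply: measurable_funeM; exact/measurable_EFinP.
apply: ge0_le_integral => //.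
- by move=> x Dx; rewrite -EFinM lee_fin; apply: mulr_ge0 => //; rewrite mulr_ge0 ?w0 ?s0.
- by apply: measurable_funeM; exact/measurable_EFinP.
- by apply: emeasurable_funD; [|apply: measurable_funeM]; exact/measurable_EFinP.
move=> x Dx; rewrite -!EFinM -EFinD lee_fin.
rewrite mulrCA (mulrC _ (w x)) -mulrDr; apply: ler_wpM2l; first exact: w0.
by apply: powR_tangent => //; exact: s0.
Qed.

(** Jensen's inequality for the measure [w], obtained by integrating the tangent
    inequality at the mean value of [s]. *)
Lemma power_mean : (B `^ p <= (m `^ (p - 1))%:E * J)%E.
Proof.
have hp := p1.
have J0 : (0 <= J)%E.
  by apply: integral_ge0 => x Dx; rewrite lee_fin mulr_ge0 ?w0 ?powR_ge0.
have B0 : (0 <= B)%E.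
  by apply: integral_ge0 => x Dx; rewrite lee_fin mulr_ge0 ?w0 ?s0.
have [Jy|Jfin] := eqVneq J +oo%E.
  by rewrite Jy gt0_muley ?leey // lte_fin powR_gt0.
have JE : J = (fine J)%:E by rewrite fineK // ge0_fin_numE // ltey.
have BE : B = (fine B)%:E.
  rewrite fineK // ge0_fin_numE //.
  have := tangent_integral ler01; rewrite powR1 mulr1 JE -EFinD => h.
  apply: le_lt_trans (_ : (p%:E * B < +oo)%E); last exact: le_lt_trans h (ltry _).
  by rewrite -[leLHS]mul1e; apply: lee_wpmul2r => //; rewrite lee_fin.
move: J0 B0; rewrite JE BE poweR_EFin -EFinM !lee_fin => J0 B0.
set j := fine J in JE J0 *; set b := fine B in BE B0 *.
have A0 : 0 <= b / m by rewrite divr_ge0 // ltW.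
have := tangent_integral A0; rewrite BE JE -EFinM -EFinD lee_fin.
set A := b / m => h.
have bE : b = A * m by rewrite /A divfK ?gt_eqF.
have AA : A `^ (p - 1) * A = A `^ p.
  have [->|An0] := eqVneq A 0; first by rewrite mulr0 powR0 // gt_eqF //; lra.
  by rewrite -[X in _ * X](powRr1 A0) -powRD ?An0 ?implybT // subrK.
have E : p * A `^ (p - 1) * b = p * A `^ p * m by rewrite bE -AA; ring.
rewrite bE powRM ?(ltW m0) //.
have -> : m `^ p = m `^ (p - 1) * m.
  by rewrite -[X in _ * X](powRr1 (ltW m0)) -powRD ?subrK // (gt_eqF m0) implybT.
rewrite mulrCA; apply: ler_wpM2l; first exact: powR_ge0.
by rewrite E in h; lra.
Qed.

End power_means.

(** * The weighted Lp norms *)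

Section Lp_compatible.
Context {R : realType}.
Local Notation leb := (@lebesgue_measure R).
Local Notation T := (measurableTypeR R).
Local Notation D := (half_line : set T).
Local Notation F := (R -> R[i]).
Implicit Types (f g : F).
Variables (mu p : R).
Hypotheses (hmu : - 2^-1 < mu) (p1 : 1 <= p).
Local Notation om := (om mu).
Local Notation ww := (ww mu).
Local Notation r_ := (r_ mu).
Local Notation s_ := (s_ mu).

Let mD : measurable D := @measurable_half_line R.
Let p0 : 0 < p := lt_le_trans ltr01 p1.
Let p'0 : 0 <= p^-1. Proof. by rewrite invr_ge0 ltW. Qed.
Let c0 : 0 < c_ mu := c_gt0 hmu.

(** The modulus of [f / om], in terms of which the norm is that of the Lp space
    of the measure [s_]. *)
Definition rel_modulus f (x : R) : R := r_ x * modulus (f x).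

Definition Lp_integral f : \bar R :=
  (\int[leb]_(x in D) (s_ x * rel_modulus f x `^ p)%:E)%E.

Lemma rel_modulus_ge0 f x : 0 <= rel_modulus f x.
Proof. by rewrite mulr_ge0 ?r_ge0 ?modulus_ge0. Qed.

Lemma modulus_om f x : 0 < x -> modulus (f x) = om x * rel_modulus f x.
Proof. by move=> x0; rewrite /rel_modulus mulrA (mulrC (om x)) r_om // mul1r. Qed.

Lemma s_ge0 x : 0 <= s_ x.
Proof. by rewrite divr_ge0 ?powR_ge0 // ltW. Qed.

Lemma s_om x : 0 < x -> s_ x = om x * om x / c_ mu.
Proof. by move=> x0; rewrite om_om. Qed.

Lemma rel_modulus_measurable f : cmeasurable f -> measurable_fun D (rel_modulus f).
Proof.
move=> mf; apply: measurable_funM; last exact: cmeasurable_modulus.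
by apply: pos_continuous_measurable => //; exact: powR_continuous.
Qed.

Let mpow f : cmeasurable f -> measurable_fun D (fun x => rel_modulus f x `^ p).
Proof.
move=> mf; apply: (measurableT_comp (measurable_powR p)).
exact: rel_modulus_measurable.
Qed.

Let ms : measurable_fun D s_.
Proof.
apply: measurable_funM; last exact: measurable_cst.
by apply: pos_continuous_measurable => //; exact: powR_continuous.
Qed.

Let mI f : cmeasurable f -> measurable_fun D (fun x => (s_ x * rel_modulus f x `^ p)%:E).
Proof.
by move=> mf; apply/measurable_EFinP; apply: measurable_funM; [exact: ms|exact: mpow].
Qed.

Let I0 f x : (0 <= (s_ x * rel_modulus f x `^ p)%:E)%E.
Proof. by rewrite lee_fin; apply: mulr_ge0; [exact: s_ge0|exact: powR_ge0]. Qed.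

Lemma Lp_integral_ge0 f : (0 <= Lp_integral f)%E.
Proof. by apply: integral_ge0 => x _; exact: I0. Qed.

Lemma Lp_normE f : Lp_norm mu p f = (Lp_integral f `^ p^-1)%E.
Proof.
apply: (congr1 (fun z => (z `^ p^-1)%E)); apply: eq_integral => x _; congr (_%:E).
rewrite /rel_modulus powRM ?r_ge0 ?modulus_ge0 //.
move: (modulus (f x) `^ p) (s_ x) (r_ x `^ p) => a b c; ring.
Qed.

Lemma Lp_norm_le (c : R) (y : \bar R) f : 0 <= c -> (0 <= y)%E ->
  (Lp_integral f <= (c `^ p)%:E * y)%E -> (Lp_norm mu p f <= c%:E * y `^ p^-1)%E.
Proof.
move=> c00 y0 h; rewrite Lp_normE.
apply: le_trans (gt0_ler_poweR p'0 _ _ h) _.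
- by rewrite in_itv /= Lp_integral_ge0 leey.
- by rewrite in_itv /= leey andbT mule_ge0 ?lee_fin ?powR_ge0.
rewrite poweRM ?lee_fin ?powR_ge0 // poweR_EFin -powRrM divff ?gt_eqF //.
by rewrite powRr1.
Qed.

Lemma Lp_norm_fin f : (Lp_norm mu p f < +oo)%E <-> (Lp_integral f < +oo)%E.
Proof.
rewrite Lp_normE; split; last exact: poweR_lty.
by apply: lty_poweRy; rewrite invr_eq0 gt_eqF.
Qed.

Let Ip_mono f g (c : R) : 0 <= c -> cmeasurable f -> cmeasurable g ->
  (\forall x \ae leb, D x -> modulus (f x) <= c * modulus (g x)) ->
  (Lp_integral f <= (c `^ p)%:E * Lp_integral g)%E.
Proof.
move=> c00 mf mg fg; rewrite -ge0_integralZl //; last 2 first.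
- exact: mI.
- by rewrite lee_fin powR_ge0.
apply: ae_ge0_le_integral => //; first exact: mI.
- by move=> x _; rewrite mule_ge0 ?lee_fin ?powR_ge0 //; exact: I0.
- by apply: measurable_funeM; exact: mI.
apply: filterS fg => x fg Dx; rewrite -EFinM lee_fin mulrCA.
apply: ler_wpM2l; first exact: s_ge0.
rewrite -powRM ?rel_modulus_ge0 //.
apply: ge0_ler_powR; rewrite ?nnegrE ?rel_modulus_ge0 ?(ltW p0) //.
  by rewrite mulr_ge0 ?rel_modulus_ge0.
by rewrite /rel_modulus mulrCA; apply: ler_wpM2l; [exact: r_ge0|exact: fg].
Qed.

Let Ip_add f g : cmeasurable f -> cmeasurable g ->
  (Lp_integral (f + g)%R <= (2 `^ p)%:E * (Lp_integral f + Lp_integral g))%E.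
Proof.
move=> mf mg; rewrite -ge0_integralD //; last 2 first.
- exact: mI.
- exact: mI.
rewrite -ge0_integralZl //; last 2 first.
- by apply: emeasurable_funD; exact: mI.
- by move=> x _; apply: adde_ge0; exact: I0.
apply: ge0_le_integral => //.
- by apply: mI; exact: cmeasurableD.
- by apply: measurable_funeM; apply: emeasurable_funD; exact: mI.
move=> x Dx; rewrite -EFinD -EFinM lee_fin -mulrDr mulrCA.
apply: ler_wpM2l; first exact: s_ge0.
set a := rel_modulus f x; set b := rel_modulus g x.
have a0 : 0 <= a by exact: rel_modulus_ge0.
have b0 : 0 <= b by exact: rel_modulus_ge0.
have hab : rel_modulus (f + g) x <= 2 * Num.max a b.
  apply: (@le_trans _ _ (a + b)).
    by rewrite /a /b /rel_modulus -mulrDr ler_wpM2l ?r_ge0 // modulusD.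
  have : a <= Num.max a b by rewrite le_max lexx.
  have : b <= Num.max a b by rewrite le_max lexx orbT.
  lra.
have m0 : 0 <= Num.max a b by rewrite le_max a0.
apply: le_trans (_ : (2 * Num.max a b) `^ p <= _).
  by apply: ge0_ler_powR; rewrite ?nnegrE ?rel_modulus_ge0 ?(ltW p0) // mulr_ge0.
rewrite powRM //; apply: ler_wpM2l; first exact: powR_ge0.
by rewrite /Num.max; case: ifP => _; rewrite ?lerDl ?lerDr powR_ge0.
Qed.

Let W := \int[leb]_(x in D) (om x * ww x).

Let WE : (\int[leb]_(x in D) (om x * ww x)%:E = W%:E)%E.
Proof.
rewrite /W /Rintegral fineK //; apply: integrable_fin_num => //.
exact: om_ww_integrable.
Qed.

Let W0 : 0 <= W.
Proof.
rewrite /W Rintegral_ge0 // => x; rewrite half_lineE => x0.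
by apply: mulr_ge0; [exact: om_ge0|apply: ltW; exact: ww_gt0].
Qed.

(** The embedding into the weighted L1 space: the measure [om * ww] is finite and
    bounded by a multiple of [s_]. *)
Lemma Lp_embed : exists C : R, 0 < C /\ forall f, in_space (Lp_norm mu p) f ->
  (wnorm mu f <= C%:E * Lp_norm mu p f)%E.
Proof.
pose m := W + 1; have m0 : 0 < m by rewrite /m; have := W0; lra.
pose K := m `^ (p - 1) * c_ mu.
have K0 : 0 < K by rewrite mulr_gt0 // powR_gt0.
exists (K `^ p^-1); split; first exact: powR_gt0.
move=> f [mf _].
pose w x := om x * ww x.
have w0 x : D x -> 0 <= w x.
  rewrite half_lineE => x0.
  by apply: mulr_ge0; [exact: om_ge0|apply: ltW; exact: ww_gt0].
have mw : measurable_fun D w.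
  apply: pos_continuous_measurable => //; apply: pos_continuousM.
    exact: om_continuous.
  exact: ww_continuous.
have wE : wnorm mu f = (\int[leb]_(x in D) (w x * rel_modulus f x)%:E)%E.
  apply: eq_integral => x /set_mem; rewrite half_lineE => x0; congr (_%:E).
  by rewrite modulus_om // /w; ring.
have wm : (\int[leb]_(x in D) (w x)%:E <= m%:E)%E by rewrite WE lee_fin lerDl.
have h := power_mean mD p1 m0 mw (rel_modulus_measurable mf) w0
  (fun x _ => rel_modulus_ge0 f x) wm.
have wn0 : (0 <= wnorm mu f)%E.
  rewrite wE; apply: integral_ge0 => x Dx; rewrite lee_fin.
  by apply: mulr_ge0; [exact: w0|exact: rel_modulus_ge0].
have h2 : ((wnorm mu f) `^ p <= K%:E * Lp_integral f)%E.
  rewrite wE; apply: le_trans h _.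
  rewrite (EFinM (m `^ (p - 1))) -muleA; apply: lee_wpmul2l.
    by rewrite lee_fin powR_ge0.
  rewrite -ge0_integralZl //; last 2 first.
  - exact: mI.
  - by rewrite lee_fin ltW.
  apply: ge0_le_integral => //.
  - by move=> x Dx; rewrite lee_fin; apply: mulr_ge0; [exact: w0|exact: powR_ge0].
  - by apply/measurable_EFinP; apply: measurable_funM; [exact: mw|exact: mpow].
  - by apply: measurable_funeM; exact: mI.
  move=> x; rewrite half_lineE => x0; rewrite -EFinM lee_fin mulrA.
  apply: ler_wpM2r; first exact: powR_ge0.
  rewrite (s_om x0) (mulrC (c_ mu)) divfK ?gt_eqF //.
  apply: ler_wpM2l; first exact: om_ge0.
  rewrite -[leRHS]mulr1; apply: ler_wpM2l; first exact: om_ge0.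
  by rewrite invf_le1 ?exprn_gt0 ?exprn_ege1 //; lra.
have := gt0_ler_poweR p'0 _ _ h2; rewrite !in_itv /= !leey !andbT poweR_ge0.
rewrite mule_ge0 ?Lp_integral_ge0 ?lee_fin ?(ltW K0) // => /(_ isT isT).
rewrite -poweRrM (divff (lt0r_neq0 p0)) (poweRe1 wn0) poweRM; last 2 first.
- by rewrite lee_fin ltW.
- exact: Lp_integral_ge0.
by rewrite poweR_EFin -Lp_normE.
Qed.

(** Schur's test: on the quotients by [om] the Green operator is given by a
    symmetric kernel of total mass at most [1 / lam] for a multiple of the
    measure [s_]. Jensen's inequality uses the mass in one variable, Tonelli's
    theorem and the symmetry the mass in the other. *)
Lemma Lp_schur (lam : R) f g : 0 < lam -> cmeasurable f -> in_space (Lp_norm mu p) g ->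
  (forall x, 0 < x -> ((modulus (f x))%:E <=
     \int[leb]_(y in D) (green mu lam x y * modulus (g y))%:E)%E) ->
  (Lp_norm mu p f <= (lam^-1)%:E * Lp_norm mu p g)%E.
Proof.
move=> lam0 mf [mg _] fg.
have l0 : 0 < lam^-1 by rewrite invr_gt0.
rewrite [in leRHS]Lp_normE; apply: Lp_norm_le; [exact: ltW|exact: Lp_integral_ge0|].
pose gr := green mu lam.
pose a := rel_modulus f; pose b := rel_modulus g.
have gr0 x y : D x -> D y -> 0 <= gr x y.
  by rewrite !half_lineE => x0 y0; exact: green_ge0.
have mgr x : D x -> measurable_fun D (gr x).
  rewrite half_lineE => x0.
  by apply: pos_continuous_measurable => //; exact: green_continuous.
have mom : measurable_fun D om.
  by apply: pos_continuous_measurable => //; exact: om_continuous.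
pose w x y := r_ x * gr x y * om y.
have w0 x y : D x -> D y -> 0 <= w x y.
  move=> Dx Dy; apply: mulr_ge0; last exact: om_ge0.
  by apply: mulr_ge0; [exact: r_ge0|exact: gr0].
have mw x : D x -> measurable_fun D (w x).
  move=> Dx; apply: measurable_funM; last exact: mom.
  by apply: measurable_funM; [exact: measurable_cst|exact: mgr].
have gom x : D x -> measurable_fun D (fun y => (gr x y * om y)%:E).
  by move=> Dx; apply/measurable_EFinP; apply: measurable_funM; [exact: mgr|exact: mom].
have gom0 x y : D x -> D y -> (0 <= (gr x y * om y)%:E)%E.
  by move=> Dx Dy; rewrite lee_fin; apply: mulr_ge0; [exact: gr0|exact: om_ge0].
have wm x : D x -> (\int[leb]_(y in D) (w x y)%:E <= (lam^-1)%:E)%E.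
  move=> Dx; have := Dx; rewrite half_lineE => x0.
  have -> : (\int[leb]_(y in D) (w x y)%:E = (r_ x)%:E * \int[leb]_(y in D) (gr x y * om y)%:E)%E.
    rewrite -ge0_integralZl //.
    - by apply: eq_integral => y _; rewrite -EFinM /w (mulrA (r_ x) (gr x y)).
    - exact: gom.
    - by move=> y; exact: gom0.
    - by rewrite lee_fin r_ge0.
  apply: (@le_trans _ _ ((r_ x)%:E * (om x / lam)%:E)%E).
    by apply: lee_wpmul2l; [rewrite lee_fin r_ge0|exact: green_schur].
  by rewrite -EFinM mulrA r_om // mul1r.
pose h xy := (s_ xy.1 * (w xy.1 xy.2 * b xy.2 `^ p))%:E.
have h0 x y : D x -> D y -> (0 <= h (x, y))%E.
  move=> Dx Dy; rewrite lee_fin; apply: mulr_ge0; first exact: s_ge0.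
  by apply: mulr_ge0; [exact: w0|exact: powR_ge0].
have mh : measurable_fun (D `*` D) (h : T * T -> \bar R).
  have mDD : measurable (D `*` D) by exact: measurableX.
  have m1 (k : R -> R) : measurable_fun D k ->
      measurable_fun (D `*` D) (fun xy : T * T => k xy.1).
    move=> mk; apply: (@measurable_comp _ _ _ _ _ _ D) => //.
      by move=> _ [[x y] [/= xD _] <-].
    exact: measurable_funS (measurable_fst).
  have m2 (k : R -> R) : measurable_fun D k ->
      measurable_fun (D `*` D) (fun xy : T * T => k xy.2).
    move=> mk; apply: (@measurable_comp _ _ _ _ _ _ D) => //.
      by move=> _ [[x y] [/= _ yD] <-].
    exact: measurable_funS (measurable_snd).
  have mr : measurable_fun D r_.
    by apply: pos_continuous_measurable => //; exact: powR_continuous.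
  apply/measurable_EFinP; apply: measurable_funM; first exact: (m1 _ ms).
  apply: measurable_funM; last exact: (m2 _ (mpow mg)).
  apply: measurable_funM; last exact: (m2 _ mom).
  by apply: measurable_funM; [exact: (m1 _ mr)|exact: green_measurable2].
have step1 : (Lp_integral f <= (lam^-1 `^ (p - 1))%:E *
    \int[leb]_(x in D) \int[leb]_(y in D) h (x, y))%E.
  rewrite -ge0_integralZl //; last 3 first.
  - exact: square_integral_measurable.
  - by move=> x Dx; apply: integral_ge0 => y Dy; exact: h0.
  - by rewrite lee_fin powR_ge0.
  apply: ge0_le_integral => //; first exact: mI.
    by apply: measurable_funeM; exact: square_integral_measurable.
  move=> x Dx; have := Dx; rewrite half_lineE => x0.
  have mwb : measurable_fun D (fun y => (w x y * b y `^ p)%:E).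
    by apply/measurable_EFinP; apply: measurable_funM; [exact: mw|exact: mpow].
  have -> : (\int[leb]_(y in D) h (x, y) =
      (s_ x)%:E * \int[leb]_(y in D) (w x y * b y `^ p)%:E)%E.
    rewrite -ge0_integralZl; [|exact: mD|exact: mwb| |by rewrite lee_fin s_ge0].
      by apply: eq_integral => y _; rewrite /h EFinM.
    by move=> y Dy; rewrite lee_fin; apply: mulr_ge0; [exact: w0|exact: powR_ge0].
  rewrite muleCA EFinM; apply: lee_wpmul2l; first by rewrite lee_fin s_ge0.
  apply: le_trans (power_mean mD p1 l0 (mw _ Dx) (rel_modulus_measurable mg)
    (fun y => w0 x y Dx) (fun y _ => rel_modulus_ge0 g y) (wm _ Dx)).
  rewrite -poweR_EFin; apply: gt0_ler_poweR; first exact: ltW.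
  - by rewrite in_itv /= leey andbT lee_fin rel_modulus_ge0.
  - rewrite in_itv /= leey andbT; apply: integral_ge0 => y Dy.
    by rewrite lee_fin; apply: mulr_ge0; [exact: w0|exact: rel_modulus_ge0].
  rewrite /rel_modulus EFinM.
  apply: le_trans (lee_wpmul2l _ (fg x x0)) _; first by rewrite lee_fin r_ge0.
  rewrite -ge0_integralZl //.
  - apply: eqW; apply: eq_integral => y /set_mem.
    rewrite half_lineE => y0; rewrite -EFinM; congr (_%:E).
    by rewrite {1}(modulus_om g y0) /w /rel_modulus -/gr; ring.
  - apply/measurable_EFinP; apply: measurable_funM; first exact: mgr.
    exact: (cmeasurable_modulus mg).
  - move=> y Dy; rewrite lee_fin; apply: mulr_ge0; [exact: gr0|exact: modulus_ge0].
  - by rewrite lee_fin r_ge0.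
have step2 : (\int[leb]_(x in D) \int[leb]_(y in D) h (x, y) <=
    (lam^-1)%:E * Lp_integral g)%E.
  rewrite square_tonelli // -ge0_integralZl //; last 2 first.
  - exact: mI.
  - by rewrite lee_fin ltW.
  apply: ge0_le_integral => //.
  - by move=> y Dy; apply: integral_ge0 => x Dx; exact: h0.
  - apply: (square_integral_measurable mD (h := fun yx => h (yx.2, yx.1))).
      apply: (@measurable_comp _ _ _ _ _ _ (D `*` D) h _ (fun yx : T * T => (yx.2, yx.1))) => //.
      - exact: measurableX.
      - by move=> _ [[y x] [/= yD xD] <-].
      - apply: measurable_funTS.  exact: measurable_swap.
    by move=> y x Dy Dx; exact: h0.
  - by apply: measurable_funeM; exact: mI.
  move=> y Dy; have := Dy; rewrite half_lineE => y0.
  have e0 : (0 <= (b y `^ p * om y / c_ mu)%:E)%E.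
    rewrite lee_fin; apply: mulr_ge0; last by rewrite invr_ge0 ltW.
    by apply: mulr_ge0; [exact: powR_ge0|exact: om_ge0].
  have -> : (\int[leb]_(x in D) h (x, y) = (b y `^ p * om y / c_ mu)%:E *
      \int[leb]_(x in D) (gr y x * om x)%:E)%E.
    rewrite -ge0_integralZl; [|exact: mD|exact: gom|by move=> x; exact: gom0|exact: e0].
    apply: eq_integral => x /set_mem; rewrite half_lineE => x0.
    rewrite -EFinM /h /=; congr (_%:E); rewrite (s_om x0) /w /gr green_sym.
    rewrite -[RHS]mul1r -(r_om mu x0); ring.
  have gs : (\int[leb]_(x in D) (gr y x * om x)%:E <= (om y / lam)%:E)%E.
    exact: green_schur.
  apply: le_trans (lee_wpmul2l e0 gs) _.
  rewrite -!EFinM lee_fin (s_om y0) -/b; apply: eqW; ring.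
apply: le_trans step1 _.
apply: le_trans (lee_wpmul2l _ step2) _; first by rewrite lee_fin powR_ge0.
rewrite muleA -EFinM -[X in (_ * X)%:E](powRr1 (ltW l0)) -powRD ?subrK //.
by rewrite (gt_eqF l0) implybT.
Qed.

Lemma Lp_compatible : compatible_norm mu (Lp_norm mu p).
Proof.
split.
- move=> f g mf mg fg; rewrite -[leRHS]mul1e [in leRHS]Lp_normE.
  apply: Lp_norm_le; rewrite ?Lp_integral_ge0 //; apply: Ip_mono => //.
  by apply: filterS fg => x h Dx; rewrite mul1r; exact: h.
- move=> c f c00 mf; rewrite [in leRHS]Lp_normE.
  apply: Lp_norm_le; rewrite ?Lp_integral_ge0 //; apply: Ip_mono => //.
    exact: cmeasurableZ.
  by apply: aeW => x _; rewrite /cscale modulusM modulus_real ger0_norm.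
- move=> f g [mf /Lp_norm_fin If] [mg /Lp_norm_fin Ig]; apply/Lp_norm_fin.
  apply: le_lt_trans (Ip_add mf mg) _; apply: lte_mul_pinfty.
  + by rewrite lee_fin powR_ge0.
  + by [].
  + exact: lte_add_pinfty If Ig.
- exact: Lp_embed.
- exact: Lp_schur.
Qed.

End Lp_compatible.

(** * Closedness and non-negativity *)

Theorem theorem3 (R : realType) (mu : R) (hmu : - 2^-1 < mu) :
  ((forall p : R, 1 <= p -> closed_operator (Lp_norm mu p) (S_p mu p)) /\
   closed_operator (Linfty_norm mu) (S_infty mu)) /\
  ((forall p : R, 1 <= p ->
      nonnegative_operator (Lp_norm mu p) (op_opp (S_p mu p))) /\
   nonnegative_operator (Linfty_norm mu) (op_opp (S_infty mu))).
Proof.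
have Linf := Linfty_compatible hmu; have Lp := Lp_compatible hmu.
split; split=> [p p1|].
- exact: bessel_part_closed (Lp _ p1).
- exact: bessel_part_closed Linf.
- exact: bessel_part_nonnegative (Lp _ p1).
- exact: bessel_part_nonnegative Linf.
Qed.
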